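(* Let $k\ge 2$, and let $\mathbf X_n^{(i)}=(X_{n1}^{(i)},\ldots,X_{nk}^{(i)})^\top$, $1\le i\le n$, $n\ge 1$, be independent $k$-dimensional elliptical random vectors with $\mathbf X_n^{(i)}\stackrel{d}{=}R_kA_n\mathbf U$, where $R_k>0$ has distribution function $H_k$, $\mathbf U=(U_1,\ldots,U_k)^\top$ is uniformly distributed on the unit sphere of $\mathbb R^k$ and independent of $R_k$, and $A_n$ is a $k\times k$ matrix such that $\Sigma_n=A_nA_n^\top$ is a positive definite correlation matrix. Let $G$ be the distribution function of $R_kU_1$, and put $M_{nj}=\max_{1\le i\le n}X_{nj}^{(i)}$, $\mathbf M_n=(M_{n1},\ldots,M_{nk})^\top$. Suppose that either $G\in\mathrm{GMDA}(w)$ or $H_k\in\mathrm{GMDA}(w)$, and that $$\lim_{n\to\infty}c_n(\mathbf 1\mathbf 1^\top-\Sigma_n)=\Gamma=(\gamma_{ij})_{i,j\le k},\qquad \gamma_{ij}\in(0,\infty)\ \text{ for } i\ne j,\ i,j\le k,$$ where $$c_n=2\frac{b_n}{a_n},\qquad b_n=G^{-1}(1-1/n),\qquad a_n=1/w(b_n),\qquad n>1.$$ Then for any $\mathbf x\in\mathbb R^k$ and any mean-zero Gaussian random vector $\mathbf Z=(Z_1,\ldots,Z_k)^\top\eqsim \mathit{Gauss}[\Gamma]$, $$\lim_{n\to\infty}\mathbf P\{(\mathbf M_n-b_n\mathbf 1)/a_n\le\mathbf x\}=Q_\Gamma(\mathbf x)=\exp\Bigl(-\int_{\mathbb R}\mathbf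 P\{\exists\, i\le k:\ Z_i>x_i-y+\theta_i/2\}\exp(-y)\,dy\Bigr),$$ where $\theta_i=\operatorname{Var}\{Z_i\}$, $i\le k$.
   Context: Notation: $\mathbf 1=(1,\ldots,1)^\top\in\mathbb R^k$; a correlation matrix has all diagonal entries equal to 1; inequalities between vectors are componentwise; $G^{-1}$ is the (generalised) inverse of $G$. A univariate distribution function $F$ with upper endpoint $\omega=\sup\{t:F(t)<1\}\in(0,\infty]$ belongs to $\mathrm{GMDA}(w)$ (Gumbel max-domain of attraction), with $w(\cdot)$ a positive scaling function, if for any $x\in\mathbb R$ $$\lim_{t\uparrow\omega}\frac{1-F(t+x/w(t))}{1-F(t)}=\exp(-x).$$ $G$ and $H_k$ have the same upper endpoint $\omega$. $\mathbf Z\eqsim\mathit{Gauss}[\Gamma]$ means that $\mathbf Z$ is a mean-zero Gaussian random vector, with positive component variances, and with incremental variance matrix $\Gamma$, i.e. $\operatorname{Var}\{Z_i-Z_j\}=\gamma_{ij}$ for all $i,j\le k$. *)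

(* Defs.v *)
From HB Require Import structures.
From mathcomp Require Export all_boot all_order all_algebra.
From mathcomp Require Export all_classical all_reals all_analysis.
Export numFieldNormedType.Exports.

Set Implicit Arguments.
Unset Strict Implicit.
Unset Printing Implicit Defensive.

Import Order.TTheory GRing.Theory Num.Theory.

Local Open Scope classical_set_scope.
Local Open Scope ring_scope.

(* Random vectors of R^k take values in k.-tuple R, whose sigma-algebra is
   generated by the coordinates, i.e. the Borel sigma-algebra of R^k. *)

Definition tuple_col (R : realType) (k : nat) (u : k.-tuple R) : 'cV[R]_k :=
  \col_i tnth u i.

Definition mulmx_tuple (R : realType) (k : nat) (A : 'M[R]_k)
    (u : k.-tuple R) : k.-tuple R :=
  [tuple (A *m tuple_col u) i 0 | i < k].

Definition scale_tuple (R : realType) (k : nat) (r : R) (u : k.-tuple R) :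
    k.-tuple R :=
  [tuple r * tnth u i | i < k].

Definition eq_in_law (d1 d2 d : measure_display) (T1 : measurableType d1)
    (T2 : measurableType d2) (T : measurableType d) (R : realType)
    (P1 : probability T1 R) (P2 : probability T2 R)
    (X : T1 -> T) (Y : T2 -> T) : Prop :=
  forall B : set T, measurable B -> P1 (X @^-1` B) = P2 (Y @^-1` B).

Definition independent_pair (d d1 d2 : measure_display) (T : measurableType d)
    (T1 : measurableType d1) (T2 : measurableType d2) (R : realType)
    (P : probability T R) (X : T -> T1) (Y : T -> T2) : Prop :=
  forall (B : set T1) (C : set T2), measurable B -> measurable C ->
    P (X @^-1` B `&` Y @^-1` C) = (P (X @^-1` B) * P (Y @^-1` C))%E.

Definition independent_family (d d' : measure_display) (T : measurableType d)
    (T' : measurableType d') (R : realType) (P : probability T R)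
    (I : choiceType) (X : I -> T -> T') : Prop :=
  forall (J : seq I) (B : I -> set T'), uniq J ->
    (forall i, measurable (B i)) ->
    P (\bigcap_(i in [set` J]) (X i @^-1` B i)) =
    (\prod_(i <- J) P (X i @^-1` B i))%E.

(* The uniform distribution on the unit sphere is the probability measure
   carried by the sphere that is invariant under all orthogonal maps. *)
Definition uniform_on_sphere (d : measure_display) (T : measurableType d)
    (R : realType) (P : probability T R) (k : nat) (U : T -> k.-tuple R) :
    Prop :=
  P [set t | \sum_(i < k) tnth (U t) i ^+ 2 = 1] = 1%E /\
  forall O : 'M[R]_k, O *m O^T = 1%:M ->
    eq_in_law P P (fun t => mulmx_tuple O (U t)) U.

Definition posdef (R : realType) (k : nat) (S : 'M[R]_k) : Prop :=
  S^T = S /\ forall v : 'cV[R]_k, v != 0 -> 0 < (v^T *m S *m v) 0 0.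

Definition posdef_correlation (R : realType) (k : nat) (S : 'M[R]_k) : Prop :=
  posdef S /\ forall i, S i i = 1.

Definition distr_fun (d : measure_display) (T : measurableType d)
    (R : realType) (P : probability T R) (Y : T -> R) (t : R) : R :=
  fine (P [set s | Y s <= t]).

Definition upper_endpoint (R : realType) (F : R -> R) : \bar R :=
  ereal_sup [set t%:E | t in [set t | F t < 1]].

Definition gen_inverse (R : realType) (F : R -> R) (p : R) : R :=
  inf [set t | p <= F t].

(* The filter of t increasing to x through reals t < x (x = -oo is junk). *)
Definition increasing_to (R : realType) (x : \bar R) : set_system R :=
  match x with
  | r%:E => r^'-
  | +oo%E => pinfty_nbhs R
  | -oo%E => ninfty_nbhs R
  end.

Definition GMDA (R : realType) (w : R -> R) (F : R -> R) : Prop :=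
  let omega := upper_endpoint F in
  [/\ (0 < omega)%E,
      forall t, (t%:E < omega)%E -> 0 < w t
    & forall x : R,
        (1 - F (t + x / w t)) / (1 - F t) @[t --> increasing_to omega]
          --> expR (- x)].

(* The library's normal_prob m 0 is not the point mass at m. *)
Definition normal_law (R : realType) (m s : R) (B : set R) : \bar R :=
  if s == 0 then \d_m B else normal_prob m s B.

Definition gaussian_vector (d : measure_display) (T : measurableType d)
    (R : realType) (P : probability T R) (k : nat) (Z : T -> k.-tuple R) :
    Prop :=
  forall c : 'I_k -> R, exists m s : R, forall B : set R, measurable B ->
    P ((fun t => \sum_(i < k) c i * tnth (Z t) i) @^-1` B) = normal_law m s B.

Definition Gauss (d : measure_display) (T : measurableType d)
    (R : realType) (P : probability T R) (k : nat) (Gamma : 'M[R]_k)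
    (Z : T -> k.-tuple R) : Prop :=
  [/\ gaussian_vector P Z,
      forall i, ('E_P[(fun t => tnth (Z t) i)%R] = 0)%E,
      forall i, (0 < 'V_P[(fun t => tnth (Z t) i)%R])%E
    & forall i j,
        ('V_P[(fun t => tnth (Z t) i - tnth (Z t) j)%R] = (Gamma i j)%:E)%E].

(* The integral is taken in \bar R, where expeR (-oo) = 0. *)
Definition Q_Gamma (d : measure_display) (T : measurableType d)
    (R : realType) (P : probability T R) (k : nat) (Z : T -> k.-tuple R)
    (x : k.-tuple R) : \bar R :=
  let theta i : R := fine ('V_P[(fun t => tnth (Z t) i)%R])%E in
  expeR (- \int[lebesgue_measure]_y
    (P [set t | exists i : 'I_k,
                  (tnth (Z t) i > tnth x i - y + theta i / 2)%R]
     * (expR (- y))%:E))%E.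

(* The real-valued componentwise maximum for 0 < n (it is 0 for n = 0). *)
Definition max_coord (T : Type) (R : realType) (k n : nat)
    (X : 'I_n -> T -> k.-tuple R) (j : 'I_k) (t : T) : R :=
  fine (\big[maxe/-oo%E]_(i < n) (tnth (X i t) j)%:E).

(* Main.v *)
(** Fix [s] in R^k with [sum_i s_i = 1]. Rotation invariance of [U] gives
    [<s, X_n> = rho_n R U_1] in law, where [rho_n ^ 2 = s^T Sigma_n s = 1 - kappa_n / c_n] and
    [kappa_n -> sum_ij s_i s_j gamma_ij]. As the tail of [R U_1] is of Gumbel type,
    [n P (<s, (X_n - b_n) / a_n> > z)] tends to [exp (- z - sum_ij s_i s_j gamma_ij / 4)], and
    by the Gaussian moment generating function this is the mass of the same half-space under the
    image [nu] of [exp (- y) dy * law Z] by [(y, Z) |-> Z - theta / 2 + y].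

    These half-spaces determine the limit: they give the integrals of [(<s, x> - c)_+ ^ q], then
    by differentiation in [s] those of [(<s, x> - c)_+ <r, x> ^ m] with [sum_i r_i = 0], then
    by Taylor expansion those of trigonometric functions of linear forms against functions of one
    coordinate vanishing near [-oo], and finally the mass of [{x | exists j, x_j > t_j}]. So
    [n P (not (X_n - b_n) / a_n <= x)] tends to [nu {exists j, x_j > t_j} = - ln Q_Gamma], and
    independence turns this into [(1 - l_n / n) ^ n -> exp (- l)].

    If it is [R] rather than [R U_1] that lies in the domain of attraction, the Gumbel tail passes
    to the product because the mass of a spherical cap at most multiplies by a constant when its
    height is doubled. *)

Require Import Defs.
From mathcomp Require Import measurable_realfun.
From mathcomp Require Import ring lra.

Import Order.TTheory GRing.Theory Num.Theory.
Set Implicit Arguments.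
Unset Strict Implicit.
Unset Printing Implicit Defensive.
Local Open Scope classical_set_scope.
Local Open Scope ring_scope.

(** * Convergence of integrals determined by half-spaces *)

(** The obstacle is that [nu] has infinite mass towards [-oo]. The half-space of a form [<r, x>]
    with [sum_i r_i = 0] is invariant along [(1, ..., 1)], the direction in which this mass is
    infinite, so only forms with [sum_i s_i = 1] are controlled. Characteristic functions and the
    usual continuity theorem for probabilities are therefore out of reach, and every test function
    must keep a factor that vanishes when some coordinate is very negative. Coefficients of any sign
    are allowed, which is what permits differentiation in directions of sum 0. Convergence of masses
    becomes convergence of integrals because the tails are bounded by every negative power,
    uniformly for large [n]; Taylor expansion succeeds because the exponential tails of [nu] give
    moments of growth [2^q q!]. Errors are measured by the integral of a majorant, constants not
    being integrable.

    The individual variances of [Z] drop out: when [sum_i s_i = 1], [Var <s, Z>] is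
    [sum_i s_i theta_i] minus half of [sum_ij s_i s_j gamma_ij], and the shift by [theta / 2]
    cancels the first sum in the exponential moment. *)

Section integral_approximation.
Context d (T : measurableType d) (R : realType).

Lemma EFin_Rintegral (m : {measure set T -> \bar R}) (f : T -> R) :
  m.-integrable setT (EFin \o f) ->
  (\int[m]_t f t)%:E = (\int[m]_t (f t)%:E)%E.
Proof. by move=> if_; rewrite /Rintegral fineK//; exact: integrable_fin_num. Qed.

(** Integrability of [f] is part of the conclusion: a finite integral of [D] makes [f - g]
    integrable, and [g] already is. *)
Lemma integrable_dominated (m : {measure set T -> \bar R}) (D f g : T -> R) (e : R) :
  m.-integrable setT (EFin \o g) -> measurable_fun setT f ->
  measurable_fun setT D ->
  (forall t, `|f t - g t| <= D t) -> (\int[m]_t (D t)%:E <= e%:E)%E ->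
  m.-integrable setT (EFin \o f) /\
  `|\int[m]_t f t - \int[m]_t g t| <= e.
Proof.
move=> ig mf mD fgD De.
have D0 t : 0 <= D t by apply: le_trans (fgD t).
have iD : m.-integrable setT (EFin \o D).
  apply/integrableP; split; first exact/measurable_EFinP.
  apply: le_lt_trans (ltry e); apply: le_trans De.
  by under eq_integral do rewrite /= ger0_norm//.
have mg : measurable_fun setT g.
  by case/integrableP: ig => /measurable_EFinP.
have ifg : m.-integrable setT (EFin \o (f \- g)).
  apply: le_integrable iD => //.
    by apply/measurable_EFinP; exact: measurable_funB.
  by move=> t _ /=; rewrite lee_fin (le_trans (fgD t))// ler_norm.
have if_ : m.-integrable setT (EFin \o f).
  have := integrableD measurableT ifg ig.
  by apply: eq_integrable => // t _ /=; rewrite -EFinD subrK.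
split=> //.
rewrite -RintegralB//; apply: (le_trans (le_normr_Rintegral _ ifg)) => //.
apply: (@le_trans _ _ (\int[m]_t D t)).
  apply: le_Rintegral => //.
  by move: ifg => /integrable_abse; apply: eq_integrable.
  by move=> t _ /=; exact: fgD.
by rewrite -lee_fin EFin_Rintegral.
Qed.

End integral_approximation.

(** * Convergence of integrals along a sequence of measures *)

Section cvg_int.
Context d (T : measurableType d) (R : realType).
Variables (nu_ : nat -> {measure set T -> \bar R}) (nu : {measure set T -> \bar R}).

(** A real integral takes the default value 0 when the extended one is infinite, so integrability is
    recorded next to the limit. It is asked for large [n] only, since the tail estimates hold only
    eventually. *)
Definition cvg_int (f : T -> R) :=
  [/\ measurable_fun setT f,
      \forall n \near \oo, (nu_ n).-integrable setT (EFin \o f),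
      nu.-integrable setT (EFin \o f)
    & \int[nu_ n]_t f t @[n --> \oo] --> \int[nu]_t f t].

(** An error budget. The bound is in the extended reals, so it contains integrability when [D] is
    nonnegative, and nothing is said about convergence of the integrals of [D]: tail parts are
    bounded without being known to converge. *)
Definition int_le (D : T -> R) (e : R) :=
  [/\ measurable_fun setT D,
      \forall n \near \oo, (\int[nu_ n]_t (D t)%:E <= e%:E)%E
    & (\int[nu]_t (D t)%:E <= e%:E)%E].

Lemma cvg_intZ (a : R) f : cvg_int f -> cvg_int (fun t => a * f t).
Proof.
case=> mf nf if_ cf; split.
- exact: measurable_funM.
- near=> n.
  have inf : (nu_ n).-integrable setT (EFin \o f) by near: n.
  by move: (integrableZl measurableT a inf); apply: eq_integrable.
- by move: (integrableZl measurableT a if_); apply: eq_integrable.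
- rewrite RintegralZl//.
  apply: (@cvg_trans _ ((fun n => a * \int[nu_ n]_t f t) @ \oo)); last exact: cvgMl_tmp.
  by apply: near_eq_cvg; near=> n; rewrite RintegralZl//; near: n.
Unshelve. all: by end_near. Qed.

Lemma cvg_intD f g : cvg_int f -> cvg_int g -> cvg_int (fun t => f t + g t).
Proof.
case=> mf nf if_ cf [mg ng ig cg]; split.
- exact: measurable_funD.
- near=> n.
  have inf : (nu_ n).-integrable setT (EFin \o f) by near: n.
  have ing : (nu_ n).-integrable setT (EFin \o g) by near: n.
  by move: (integrableD measurableT inf ing); apply: eq_integrable.
- by move: (integrableD measurableT if_ ig); apply: eq_integrable.
- rewrite RintegralD//.
  apply: (@cvg_trans _ ((fun n => \int[nu_ n]_t f t + \int[nu_ n]_t g t) @ \oo)).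
    by apply: near_eq_cvg; near=> n; rewrite RintegralD//; near: n.
  exact: cvgD.
Unshelve. all: by end_near. Qed.

Lemma cvg_intN f : cvg_int f -> cvg_int (fun t => - f t).
Proof.
by move/(cvg_intZ (-1)); under [X in cvg_int X]funext do rewrite mulN1r.
Qed.

Lemma cvg_intB f g : cvg_int f -> cvg_int g -> cvg_int (fun t => f t - g t).
Proof. by move=> cf /cvg_intN; exact: cvg_intD. Qed.

Lemma cvg_int0 : cvg_int (fun=> 0).
Proof.
split; [exact: measurable_cst|..].
- by near=> n; exact: integrable0.
- exact: integrable0.
- rewrite (_ : (fun n => _) = fun=> 0); first by rewrite Rintegral_cst// mul0r; exact: cvg_cst.
  by apply/funext => n; rewrite Rintegral_cst// mul0r.
Unshelve. all: by end_near. Qed.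

Lemma cvg_int_sum (I : Type) (r : seq I) (P : pred I) (f : I -> T -> R) :
  (forall i, cvg_int (f i)) -> cvg_int (fun t => \sum_(i <- r | P i) f i t).
Proof.
move=> cf; elim: r => [|i r ih].
  by under [X in cvg_int X]funext do rewrite big_nil; exact: cvg_int0.
under [X in cvg_int X]funext do rewrite big_cons.
by case: (P i) => //; exact: cvg_intD.
Qed.

(** The usual argument with three errors [e / 3], the distance between [f] and [g] being the
    integral of [D] under [nu] and under all late [nu_ n]. The case [e = 1] provides
    integrability. *)
Lemma cvg_int_approx (f : T -> R) : measurable_fun setT f ->
  (forall e : R, 0 < e -> exists g D, [/\ cvg_int g, int_le D e
     & forall t, `|f t - g t| <= D t]) -> cvg_int f.
Proof.
move=> mf H.
have [g1 [D1 [[_ ng1 ig1 _] [mD1 nD1 iD1] gD1]]] := H 1 ltr01.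
split=> //.
- near=> n; have [] // := @integrable_dominated _ _ _ (nu_ n) D1 f g1 1.
  + by near: n.
  + by near: n.
- by have [] := integrable_dominated ig1 mf mD1 gD1 iD1.
- apply/cvgrPdist_le => e e0.
  have e30 : 0 < e / 3 by rewrite divr_gt0.
  have [g [D [[_ ng ig cg] [mD nD iD] gD]]] := H _ e30.
  have [_ fg] := integrable_dominated ig mf mD gD iD.
  near=> n.
  have [] := @integrable_dominated _ _ _ (nu_ n) D f g (e / 3) _ mf mD gD _.
  + by near: n.
  + by near: n.
  move=> _ fgn.
  have cgn : `|\int[nu]_t g t - \int[nu_ n]_t g t| <= e / 3.
    by near: n; move/cvgrPdist_le : cg; apply.
  move: fg fgn cgn; rewrite !ler_norml => /andP[? ?] /andP[? ?] /andP[? ?].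
  apply/andP; split; lra.
Unshelve. all: by end_near. Qed.

(** The strict inequality for [nu] leaves room for the integrals under [nu_ n], which converge to
    that under [nu]. *)
Lemma cvg_int_le (D : T -> R) e : (forall t, 0 <= D t) -> cvg_int D ->
  \int[nu]_t D t < e -> int_le D e.
Proof.
move=> D0 [mD nD iD cD] De; split=> //.
  near=> n.
  have inD : (nu_ n).-integrable setT (EFin \o D) by near: n.
  have : \int[nu_ n]_t D t <= e.
    near: n; move/cvgrPdist_le : cD => /(_ (e - \int[nu]_t D t)).
    rewrite subr_gt0 De => /(_ isT); apply: filterS => n.
    rewrite ler_norml => /andP[? ?]; lra.
  by rewrite -lee_fin EFin_Rintegral.
by rewrite -EFin_Rintegral// lee_fin ltW.
Unshelve. all: by end_near. Qed.

End cvg_int.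

(** * Powers of positive parts and their difference quotients *)

Section positive_part.
Context (R : realType).
Implicit Types v w e a b M : R.

Definition pos v := Num.max v 0.

Lemma pos_ge0 v : 0 <= pos v.
Proof. by rewrite /pos le_max lexx orbT. Qed.

Lemma pos_id v : 0 <= v -> pos v = v.
Proof. by move=> v0; rewrite /pos; apply/max_idPl. Qed.

Lemma pos_eq0 v : v <= 0 -> pos v = 0.
Proof. by move=> v0; rewrite /pos; apply/max_idPr. Qed.

Lemma ler_pos v w : v <= w -> pos v <= pos w.
Proof. by move=> vw; rewrite /pos ge_max !le_max vw lexx orbT. Qed.

Lemma ge_pos v : v <= pos v.
Proof. by rewrite /pos le_max lexx. Qed.

Lemma pos_lipschitz v w : `|pos v - pos w| <= `|v - w|.
Proof.
wlog vw : v w / w <= v.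
  move=> H; have /orP[/H //|/H] := le_total w v.
  by rewrite distrC (distrC v).
rewrite !ger0_norm ?subr_ge0 ?ler_pos//.
have [w0|w0] := lerP 0 w; first by rewrite !pos_id// (le_trans w0).
rewrite (pos_eq0 (ltW w0)) subr0 /pos ge_max; apply/andP; split; lra.
Qed.

(** Induction on [q]: the next remainder is [a] times the present one plus [(q+2) b^(q+1) (a-b)^2].
    The crude constant [(q+2)^2] is one that survives this recursion. *)
Lemma expr_taylor1 q a b M : 0 <= a <= M -> 0 <= b <= M ->
  `|a ^+ q.+2 - b ^+ q.+2 - q.+2%:R * b ^+ q.+1 * (a - b)|
   <= q.+2%:R ^+ 2 * M ^+ q * (a - b) ^+ 2.
Proof.
move=> /andP[a0 aM] /andP[b0 bM].
have M0 : 0 <= M by exact: le_trans aM.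
elim: q => [|q ih].
  rewrite expr0 mulr1 expr1 (_ : _ - _ = (a - b) ^+ 2); last by ring.
  rewrite ger0_norm ?sqr_ge0// ler_peMl ?sqr_ge0//.
  by rewrite -natrX ler1n.
rewrite (_ : _ - _ = a * (a ^+ q.+2 - b ^+ q.+2 - q.+2%:R * b ^+ q.+1 * (a - b))
    + q.+2%:R * b ^+ q.+1 * (a - b) ^+ 2); last first.
  by rewrite -(natr1 q.+2) (exprS a q.+2) (exprS b q.+2) (exprS b q.+1); ring.
apply: le_trans (ler_normD _ _) _.
rewrite normrM (ger0_norm a0) (ger0_norm (_ : 0 <= q.+2%:R * _ * _)); last first.
  by rewrite mulr_ge0 ?sqr_ge0// mulr_ge0 ?exprn_ge0.
apply: (@le_trans _ _ (M * (q.+2%:R ^+ 2 * M ^+ q * (a - b) ^+ 2)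
   + q.+2%:R * M ^+ q.+1 * (a - b) ^+ 2)).
  apply: lerD; first exact: ler_pM.
  by rewrite ler_wpM2r ?sqr_ge0// ler_wpM2l// lerXn2r// nnegrE.
rewrite (_ : _ + _ = (q.+2%:R ^+ 2 + q.+2%:R) * (M ^+ q.+1 * (a - b) ^+ 2)); last first.
  by rewrite (exprS M); ring.
rewrite -[leRHS]mulrA ler_wpM2r//; first by rewrite mulr_ge0 ?sqr_ge0 ?exprn_ge0.
rewrite -(natr1 q.+2).
have : 0 <= q.+2%:R :> R by [].
nra.
Qed.

(** First-order error in differentiating [pos (v + e w)^(q+2)] at [e = 0]. The majorant is again
    made of powers of positive parts of forms [v + a w], hence can be integrated: its largest base
    bounds [pos v], [pos (v + e w)] and, unless both of these vanish, [|w|]. The base [v + 2 w]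
    serves the case [v <= 0 < v + e w], where [v + 2 w > w > 0]. *)
Lemma pos_diff_quotient q m v w e : 0 < e <= 1 ->
  `|(pos (v + e * w) ^+ q.+2 - pos v ^+ q.+2) / (q.+2%:R * e) * w ^+ m
     - pos v ^+ q.+1 * w ^+ m.+1|
  <= q.+3%:R * e * \sum_(i < 4) pos (v + (i%:R - 1) * w) ^+ (q + m).+2.
Proof.
move=> /andP[e0 e1].
set S := \sum_(_ < _) _.
have S0 : 0 <= S by rewrite sumr_ge0// => i _; rewrite exprn_ge0// pos_ge0.
have [B [B0 BS Bv Bev Bw]] : exists B, [/\ 0 <= B, B ^+ (q + m).+2 <= S, pos v <= B,
    pos (v + e * w) <= B & 0 < v \/ 0 < v + e * w -> `|w| <= B].
  pose f (i : 'I_4) := pos (v + (i%:R - 1) * w).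
  have [j _ jmax] := @Order.TotalTheory.arg_maxP _ _ _ (@Ordinal 4 0 isT) xpredT f isT.
  pose B := f j.
  have Bi (i : 'I_4) : pos (v + (i%:R - 1) * w) <= B by exact: jmax.
  have B_1 := Bi (@Ordinal 4 0 isT).
  have B_2 := Bi (@Ordinal 4 1 isT).
  have B_3 := Bi (@Ordinal 4 2 isT).
  have B_4 := Bi (@Ordinal 4 3 isT).
  rewrite /= in B_1 B_2 B_3 B_4.
  have g1 := ge_pos (v + (0 - 1) * w). have g2 := ge_pos (v + (1 - 1) * w).
  have g3 := ge_pos (v + (2 - 1) * w). have g4 := ge_pos (v + (3 - 1) * w).
  have B0 : 0 <= B := le_trans (pos_ge0 _) B_1.
  exists B; split => //.
  - rewrite /S (bigD1 j)//= lerDl.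
    by rewrite sumr_ge0// => i _; rewrite exprn_ge0// pos_ge0.
  - by rewrite /pos ge_max B0 andbT; lra.
  - rewrite /pos ge_max B0 andbT.
    have [w0|w0] := lerP 0 w; nra.
  - move=> H; rewrite ler_norml; apply/andP; split; case: H => H.
    + lra.
    + have [w0|w0] := lerP 0 w; nra.
    + lra.
    + have [w0|w0] := lerP 0 w; nra.
have [/andP[v0 ve0]|H] := boolP ((v <= 0) && (v + e * w <= 0)).
  rewrite !pos_eq0// !expr0n/= subrr !mul0r subrr normr0.
  by rewrite !mulr_ge0// ltW.
have {}Bw : `|w| <= B.
  by apply: Bw; move: H; rewrite negb_and -!ltNge => /orP[]; [left|right].
set a := pos (v + e * w) in Bev *; set b := pos v in Bv *.
have a0 : 0 <= a := pos_ge0 _.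
have b0 : 0 <= b := pos_ge0 _.
have ab : `|a - b| <= e * `|w|.
  apply: le_trans (pos_lipschitz _ _) _.
  by rewrite addrAC subrr add0r normrM (gtr0_norm e0).
(* The kink of [pos]: the left side is nonzero only if [v > 0 > v + e w], and then both factors are
   at most [e |w|]. *)
have key : b * `|(a - b) - e * w| <= e ^+ 2 * w ^+ 2.
  rewrite /a /b; have [v0|v0] := lerP v 0.
    by rewrite (pos_eq0 v0) mul0r -exprMn sqr_ge0.
  rewrite (pos_id (ltW v0)); have [ev0|ev0] := lerP 0 (v + e * w).
    rewrite (pos_id ev0) (_ : _ - _ = 0); last by ring.
    by rewrite normr0 mulr0 -exprMn sqr_ge0.
  rewrite (pos_eq0 (ltW ev0)) sub0r ger0_norm; last lra.
  rewrite -exprMn; nra.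
have e0' : e != 0 by rewrite gt_eqF.
have q0' : q.+2%:R != 0 :> R by rewrite pnatr_eq0.
rewrite (_ : _ - _ = ((a ^+ q.+2 - b ^+ q.+2 - q.+2%:R * b ^+ q.+1 * (a - b))
   + q.+2%:R * b ^+ q * (b * ((a - b) - e * w))) / (q.+2%:R * e) * w ^+ m); last first.
  rewrite (exprS a q.+1) (exprS b q.+1) (exprS b q) (exprS w m).
  by move: (q.+2%:R : R) q0' => c c0; field; rewrite e0' c0.
rewrite !normrM normrX normfV.
apply: (@le_trans _ _ ((q.+2%:R * q.+3%:R * B ^+ q * (e ^+ 2 * w ^+ 2)) / (q.+2%:R * e) * `|w| ^+ m)).
  apply: ler_wpM2r; first exact: exprn_ge0.
  rewrite (ger0_norm (_ : 0 <= q.+2%:R * e)) ?mulr_ge0 ?(ltW e0)//.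
  apply: ler_wpM2r; first by rewrite invr_ge0 mulr_ge0// ltW.
  apply: le_trans (ler_normD _ _) _.
  have -> : q.+2%:R * q.+3%:R * B ^+ q * (e ^+ 2 * w ^+ 2) =
    q.+2%:R ^+ 2 * B ^+ q * (e ^+ 2 * w ^+ 2) + q.+2%:R * B ^+ q * (e ^+ 2 * w ^+ 2).
    by rewrite -(natr1 q.+2); ring.
  apply: lerD.
    apply: le_trans (@expr_taylor1 q a b B _ _) _; rewrite ?a0 ?b0//.
    rewrite ler_wpM2l//; first by rewrite mulr_ge0 ?sqr_ge0 ?exprn_ge0.
    rewrite -exprMn -(real_normK (num_real (a - b))) -(real_normK (num_real (e * w))).
    by rewrite lerXn2r ?nnegrE// normrM (gtr0_norm e0).
  rewrite !normrM (ger0_norm b0) normrX (ger0_norm b0) ger0_norm//.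
  apply: ler_pM => //.
  - by rewrite mulr_ge0// exprn_ge0.
  - by rewrite mulr_ge0.
  - by rewrite ler_wpM2l// lerXn2r.
rewrite (_ : _ / _ * _ = q.+3%:R * e * (B ^+ q * (`|w| ^+ 2 * `|w| ^+ m))); last first.
  rewrite -(real_normK (num_real w)).
  by move: (q.+2%:R : R) q0' => c c0; field; rewrite e0' c0.
rewrite ler_wpM2l ?mulr_ge0// ?(ltW e0)//.
apply: le_trans BS.
rewrite -exprD (_ : (q + m).+2 = q + (2 + m))%N; last by rewrite addnCA.
rewrite (exprD B) ler_wpM2l ?exprn_ge0//.
by rewrite lerXn2r// nnegrE.
Qed.

End positive_part.

(** * Taylor polynomials of trigonometric functions *)

Section trig_taylor.
Context (R : realType).

Lemma poly_antiderivative (p : {poly R}) (a : R) :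
  exists q : {poly R}, q^`()%R = p /\ q.[0] = a.
Proof.
exists (\poly_(i < (size p).+1) (if i is j.+1 then p`_j / j.+1%:R else a)); split.
  apply/polyP => i; rewrite coef_deriv coef_poly ltnS.
  case: ltnP => [_|ip]; last by rewrite mul0rn nth_default.
  by rewrite -[LHS]mulr_natr divfK// pnatr_eq0.
by rewrite horner_coef0 coef_poly.
Qed.

Lemma is_derive_lincomb (f g : R -> R) (a b df dg x : R) :
  is_derive x 1 f df -> is_derive x 1 g dg ->
  is_derive x 1 (fun y => a * f y + b * g y) (a * df + b * dg).
Proof.
move=> hf hg.
exact: (@is_deriveD R R R^o (a \*: (f : R -> R^o)) (b \*: (g : R -> R^o)) x 1).
Qed.

(** A derivative bound integrated by the mean value theorem: for [s = 1] and [s = -1], [k s]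
    vanishes at 0 and has a nonnegative derivative to the right of it. *)
Lemma le_monomial_of_derive (C : R) N (h g : R -> R) :
  (forall x : R, is_derive x 1 h (g x)) -> h 0 = 0 ->
  (forall x, 0 <= x -> `|g x| <= C * x ^+ N / N`!%:R) ->
  forall x, 0 <= x -> `|h x| <= C * x ^+ N.+1 / N.+1`!%:R.
Proof.
move=> dh h0 gb x; rewrite le_eqVlt => /predU1P[<-|x0].
  by rewrite h0 normr0 expr0n/= mulr0 mul0r.
have f0 : N.+1%:R != 0 :> R by rewrite pnatr_eq0.
have f1 : N`!%:R != 0 :> R by rewrite pnatr_eq0 gtn_eqF// fact_gt0.
pose k (s y : R) := (C / N.+1`!%:R) * y ^+ N.+1 + s * h y.
have dk (s y : R) : is_derive y 1 (k s) (C * y ^+ N / N`!%:R + s * g y).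
  have dh1 := dh y; rewrite /k.
  have dX : is_derive y 1 (horner ('X^(N.+1) : {poly R})) (N.+1%:R * y ^+ N).
    by apply: is_derive_eq; rewrite derivXn hornerMn hornerXn mulr_natl.
  have := is_derive_lincomb (C / N.+1`!%:R) s dX dh1.
  rewrite (_ : (fun y => _ ) = (fun y => C / N.+1`!%:R * y ^+ N.+1 + s * h y)); last first.
    by apply/funext => z; rewrite hornerXn.
  move=> H; apply: (is_derive_eq H).
  rewrite factS natrM.
  by move: (N.+1%:R : R) (N`!%:R : R) f0 f1 => n f n0 f0; field; rewrite n0 f0.
have kge s : `|s| = 1 -> 0 <= k s x.
  move=> s1.
  have [|c] := @MVT R (k s) (fun y => C * y ^+ N / N`!%:R + s * g y) 0 x x0 (fun y _ => dk s y).
    apply: continuous_subspaceT => y; apply: differentiable_continuous.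
    by apply/derivable1_diffP; case: (dk s y).
  rewrite in_itv/= => /andP[c0 cx].
  rewrite {2}/k h0 mulr0 addr0 expr0n/= mulr0 !subr0 => ->.
  rewrite mulr_ge0 ?(ltW x0)//.
  have := gb c (ltW c0).
  have : `|s * g c| = `|g c| by rewrite normrM s1 mul1r.
  move=> <-; rewrite ler_norml => /andP[+ _]; lra.
have := kge 1 (normr1 _); have := kge (-1) (normrN1 _).
rewrite /k => k1 k2; rewrite ler_norml; apply/andP.
have -> : C * x ^+ N.+1 / N.+1`!%:R = C / N.+1`!%:R * x ^+ N.+1 by rewrite mulrAC.
split; lra.
Qed.

(** Induction on [N] by antidifferentiation: the derivative of [a cos + b sin] is [b cos - a sin],
    of the same shape and with the same [|a| + |b|]. Negative [x] are reached by reflection. *)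
Lemma trig_taylor N (a b : R) : exists p : {poly R}, forall x,
  `|a * cos x + b * sin x - p.[x]| <= (`|a| + `|b|) * `|x| ^+ N / N`!%:R.
Proof.
elim: N a b => [|N ih] a b.
  exists 0 => x; rewrite horner0 subr0 expr0 mulr1 divr1.
  apply: le_trans (ler_normD _ _) _.
  rewrite !normrM lerD//.
    by rewrite ler_piMr// ler_norml cos_geN1 cos_le1.
  by rewrite ler_piMr// ler_norml sin_geN1 sin_le1.
have [p pP] := ih b (- a).
have [q [qp q0]] := poly_antiderivative p a.
exists q => x.
have d (y : R) : is_derive y 1 (fun y => a * cos y + b * sin y - q.[y])
    (b * cos y + (- a) * sin y - p.[y]).
  have dq := is_derive_lincomb 1 (-1) (is_derive_lincomb a b (is_derive_cos y) (is_derive_sin y)) (is_derive_poly q y).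
  rewrite (_ : (fun y => _ ) = (fun y => 1 * (a * cos y + b * sin y) + -1 * q.[y])); last first.
    by apply/funext => z; ring.
  by apply: (is_derive_eq dq); rewrite qp; ring.
rewrite (addrC `|a|) -(normrN a).
have [x0|x0] := lerP 0 x.
  rewrite (ger0_norm x0).
  apply: (le_monomial_of_derive d) => //.
    by rewrite cos0 sin0 q0 mulr1 mulr0 addr0 subrr.
  by move=> y y0; have := pP y; rewrite (ger0_norm y0).
rewrite (ltr0_norm x0).
pose h (y : R) := a * cos (- y) + b * sin (- y) - q.[- y].
have -> : `|a * cos x + b * sin x - q.[x]| = `|h (- x)| by rewrite /h opprK.
apply: (@le_monomial_of_derive _ _ h
  (fun y => - (b * cos (- y) + (- a) * sin (- y) - p.[- y]))).
- by move=> y; apply: is_derive_eq; rewrite /GRing.scale/= qp; ring.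
- by rewrite /h oppr0 cos0 sin0 q0 mulr1 mulr0 addr0 subrr.
- by move=> y y0; rewrite (normrN (_ - _)); have := pP (- y); rewrite (normrN y) (ger0_norm y0).
- by rewrite oppr_ge0 ltW.
Qed.

End trig_taylor.

(** * Ramps and their polynomial approximation *)

Section ramps.
Context (R : realType).
Implicit Types (r : R -> R) (S e x z c h : R).

Definition poly_approx r := forall S e, 0 < S -> 0 < e ->
  exists p : {poly R}, forall z, `|z| <= S -> `|r z - p.[z]| <= e.

(* The iteration p := p + (z^2 - p^2) / 2 increases to |z| on [-1, 1]. *)
Lemma poly_approx_normr : poly_approx (fun z => `|z|).
Proof.
move=> S e S0 e0.
pose F n := iter n (fun p : {poly R} => p + 2^-1 *: ('X ^+ 2 - p ^+ 2)) 0.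
(* The third bound carries the rate. One step multiplies the gap [|z| - p] by [1 - (|z| + p) / 2],
   and the bound implies that the gap is at most [2 / n], uniformly in [z]. *)
have key n z : `|z| <= 1 -> [/\ 0 <= (F n).[z] , (F n).[z] <= `|z| &
    (1 + n%:R * (`|z| / 2)) * (`|z| - (F n).[z]) <= `|z|].
  move=> z1; have z0 := normr_ge0 z.
  have zz : z ^+ 2 = `|z| ^+ 2 by rewrite real_normK// num_real.
  elim: n => [|n [p0 pz ih]].
    by rewrite /F/= horner0 mul0r addr0 subr0 mul1r.
  rewrite /F iterS -/(F n) hornerD hornerZ hornerD hornerN !horner_exp hornerX zz -(natr1 n).
  move: (`|z|) (F n).[z] (n%:R : R) (ler0n R n) z0 z1 p0 pz ih => s p m m0 s0 s1 p0 ps ih.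
  have ps' : p ^+ 2 <= s ^+ 2 by rewrite lerXn2r.
  split; [lra|nra|].
  have -> : s - (p + 2^-1 * (s ^+ 2 - p ^+ 2)) = (s - p) * (1 - (s + p) / 2) by field.
  have : 0 <= s - p by rewrite subr_ge0.
  move: (s - p) ih => y ih y0.
  apply: le_trans ih.
  rewrite mulrCA [leRHS]mulrC ler_wpM2l//.
  have : 0 <= m * s by rewrite mulr_ge0.
  nra.
pose n := (Num.truncn (2 * S / e)).+1.
have nS : 2 * S / e < n%:R by rewrite truncnS_gt.
exists (S *: (F n \Po (S^-1 *: 'X))) => z zS.
rewrite hornerZ horner_comp hornerZ hornerX.
have zS1 : `|S^-1 * z| <= 1.
  by rewrite normrM normfV (gtr0_norm S0) mulrC ler_pdivrMr// mul1r.
have [p0 pz pe] := key n _ zS1.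
have -> : `|z| = S * `|S^-1 * z|.
  by rewrite normrM normfV (gtr0_norm S0) mulrA divff ?gt_eqF// mul1r.
rewrite -mulrBr normrM (gtr0_norm S0) ger0_norm ?subr_ge0//.
have z0 := normr_ge0 (S^-1 * z).
have n0 : 0 < n%:R :> R by [].
move: nS; rewrite ltr_pdivrMr// => nS.
move: (`|_|) (F n).[_] (n%:R : R) n0 z0 p0 pz pe nS {zS1} => s p m m0 s0 p0 ps H mS.
have y0 : 0 <= s - p by rewrite subr_ge0.
have ys : s - p <= s by rewrite gerBl.
move: (s - p) H y0 ys => y H y0 ys.
have my : m * y <= 2.
  have [sp|sn] := ltrP 0 s; last by have -> : y = 0 by [lra]; rewrite mulr0.
  by rewrite -(ler_pM2l sp); nra.
rewrite -(ler_pM2l m0); nra.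
Qed.

Lemma poly_approx_lincomb r r' (a b : R) : poly_approx r -> poly_approx r' ->
  poly_approx (fun z => a * r z + b * r' z).
Proof.
move=> hr hr' S e S0 e0.
have ab0 (c : R) : 0 < 2 * (`|c| + 1) by rewrite mulr_gt0// ltr_wpDl.
have [p pP] := hr S (e / (2 * (`|a| + 1))) S0 (divr_gt0 e0 (ab0 a)).
have [q qP] := hr' S (e / (2 * (`|b| + 1))) S0 (divr_gt0 e0 (ab0 b)).
exists (a *: p + b *: q) => z zS; rewrite hornerD !hornerZ.
have -> : a * r z + b * r' z - (a * p.[z] + b * q.[z]) =
  a * (r z - p.[z]) + b * (r' z - q.[z]) by ring.
have half (c y : R) : `|y| <= e / (2 * (`|c| + 1)) -> `|c * y| <= e / 2.
  move=> yc; rewrite normrM; apply: (@le_trans _ _ ((`|c| + 1) * (e / (2 * (`|c| + 1))))).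
    by rewrite ler_pM// lerDl.
  have : `|c| + 1 != 0 by rewrite gt_eqF// ltr_wpDl.
  by move: (`|c| + 1) => k k0; rewrite (_ : k * (e / (2 * k)) = e / 2)//; field.
apply: le_trans (ler_normD _ _) _.
have := half a _ (pP z zS); have := half b _ (qP z zS); lra.
Qed.

Lemma poly_approx_horner (p : {poly R}) : poly_approx (horner p).
Proof. by move=> S e S0 e0; exists p => z _; rewrite subrr normr0 ltW. Qed.

Lemma poly_approx_shift r c : poly_approx r -> poly_approx (fun z => r (z - c)).
Proof.
move=> hr S e S0 e0.
have [|p pP] := hr (S + `|c|) e _ e0; first by rewrite ltr_wpDr.
exists (p \Po ('X - c%:P)) => z zS.
rewrite horner_comp !hornerE; apply: pP.
by apply: le_trans (ler_normB _ _) _; rewrite lerD2r.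
Qed.

(** Written with two positive parts, so that convergence for [pos (xi - c)] passes directly to
    ramps. *)
Definition ramp c h x := (pos (x - c) - pos (x - (c + h))) / h.

Lemma poly_approx_ramp c h : poly_approx (ramp c h).
Proof.
have posE z : pos z = 2^-1 * `|z| + 2^-1 * ('X : {poly R}).[z].
  rewrite hornerX; have [z0|z0] := lerP 0 z.
    by rewrite pos_id// ger0_norm//; field.
  by rewrite pos_eq0 ?(ltW z0)// ltr0_norm//; field.
have hp : poly_approx (@pos R).
  have -> : @pos R = (fun z => 2^-1 * `|z| + 2^-1 * ('X : {poly R}).[z]).
    by apply/funext => z; exact: posE.
  by apply: poly_approx_lincomb; [exact: poly_approx_normr|exact: poly_approx_horner].
have -> : ramp c h = fun z => h^-1 * pos (z - c) + (- h^-1) * pos (z - (c + h)).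
  by apply/funext => z; rewrite /ramp mulrC; ring.
by apply: poly_approx_lincomb; exact: (poly_approx_shift _ hp).
Qed.

Lemma ramp_ge0 c h x : 0 < h -> 0 <= ramp c h x.
Proof. by move=> h0; rewrite divr_ge0 ?(ltW h0)// subr_ge0 ler_pos//; lra. Qed.

Lemma ramp_le1 c h x : 0 < h -> ramp c h x <= 1.
Proof.
move=> h0; rewrite ler_pdivrMr// mul1r lerBlDr /pos ge_max.
have := ge_pos (x - (c + h)); have := pos_ge0 (x - (c + h)).
by rewrite /pos => ? ?; apply/andP; split; lra.
Qed.

Lemma normr_ramp_le1 c h x : 0 < h -> `|ramp c h x| <= 1.
Proof. by move=> h0; rewrite ger0_norm ?ramp_ge0 ?ramp_le1. Qed.

Lemma ramp_eq0 c h x : 0 < h -> x <= c -> ramp c h x = 0.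
Proof. by move=> h0 xc; rewrite /ramp !pos_eq0 ?subrr ?mul0r//; lra. Qed.

Lemma ramp_eq1 c h x : 0 < h -> c + h <= x -> ramp c h x = 1.
Proof.
move=> h0 xc; rewrite /ramp !pos_id; try lra.
by field; rewrite gt_eqF.
Qed.

Lemma ramp_lipschitz c h x z : 0 < h -> `|ramp c h x - ramp c h z| <= 2 / h * `|x - z|.
Proof.
move=> h0; rewrite /ramp -mulrBl normrM normfV (gtr0_norm h0).
rewrite mulrAC ler_wpM2r ?invr_ge0 ?(ltW h0)//.
rewrite (_ : _ - _ - _ = (pos (x - c) - pos (z - c)) - (pos (x - (c + h)) - pos (z - (c + h)))); last by ring.
apply: le_trans (ler_normB _ _) _.
have := pos_lipschitz (x - c) (z - c); have := pos_lipschitz (x - (c + h)) (z - (c + h)).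
have xz (b : R) : x - b - (z - b) = x - z by ring.
rewrite !xz; lra.
Qed.

(** [fN] is the piecewise linear interpolant of [f] at the nodes [c + m h], frozen after the last
    one. As [f c = 0] it needs no constant term, hence is a combination of functions vanishing left
    of [c]. *)
Lemma ramp_interpolation (f : R -> R) (K c h : R) N : 0 < h -> 0 <= K ->
  (forall x z, `|f x - f z| <= K * `|x - z|) -> f c = 0 ->
  let fN x := \sum_(m < N) (f (c + m.+1%:R * h) - f (c + m%:R * h)) * ramp (c + m%:R * h) h x in
  (forall x, c + N%:R * h <= x -> fN x = f (c + N%:R * h)) /\
  (forall x, c <= x <= c + N%:R * h -> `|f x - fN x| <= 2 * K * h).
Proof.
move=> h0 K0 fK fc /=; elim: N => [|N [ih1 ih2]].
  split=> x; first by rewrite big_ord0 mul0r addr0.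
  rewrite mul0r addr0 -eq_le => /eqP <-.
  by rewrite big_ord0 fc subrr normr0 !mulr_ge0// ltW.
have cN : c + N.+1%:R * h = c + N%:R * h + h by rewrite -natr1; ring.
split=> x.
  rewrite big_ord_recr/= => xN; rewrite ih1 ?ramp_eq1//; first ring.
  - by rewrite -cN.
  - by apply: le_trans xN; rewrite cN lerDl ltW.
move=> /andP[cx xN]; rewrite big_ord_recr/=.
have [xN'|xN'] := lerP x (c + N%:R * h).
  by rewrite ramp_eq0// mulr0 addr0 ih2// cx.
rewrite ih1 ?(ltW xN')//.
have f1 := fK x (c + N%:R * h).
have f2 := fK (c + N.+1%:R * h) (c + N%:R * h).
have r0 := ramp_ge0 (c + N%:R * h) x h0.
have r1 := ramp_le1 (c + N%:R * h) x h0.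
move: f1 f2; rewrite (ger0_norm (_ : 0 <= x - _)); last by rewrite subr_ge0 ltW.
rewrite (ger0_norm (_ : 0 <= c + _ * h - _)); last by rewrite subr_ge0 cN lerDl ltW.
move: (ramp _ _ _) r0 r1 => r r0 r1 f1 f2.
rewrite opprD addrA; apply: le_trans (ler_normB _ _) _.
rewrite normrM (ger0_norm r0).
have : `|f (c + N.+1%:R * h) - f (c + N%:R * h)| * r <= K * h.
  apply: (@le_trans _ _ (K * (c + N.+1%:R * h - (c + N%:R * h)) * 1)).
    by apply: ler_pM.
  by rewrite mulr1 cN (addrC _ h) addrK.
have : K * (x - (c + N%:R * h)) <= K * h.
  by rewrite ler_wpM2l// lerBlDl -cN.
move: f1; lra.
Qed.

(** A quadratic bound valid on the whole line: scaled, it says that [l sin (y / l)] differs from [y]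
    by at most [y^2 / l], which second moments control. *)
Lemma normr_sin_id_le x : `|sin x - x| <= x ^+ 2.
Proof.
have cosb (y : R) : 0 <= y -> `|cos y - 1| <= y.
  move=> y0.
  have := @le_monomial_of_derive R 1 0 (fun y => cos y - 1) (fun y => - sin y) _ _ _ y y0.
  rewrite expr1 mul1r divr1; apply.
  - by move=> z; apply: is_derive_eq; rewrite subr0.
  - by rewrite cos0 subrr.
  - by move=> z _; rewrite normrN mul1r expr0 divr1 ler_norml sin_geN1 sin_le1.
have sinb (y : R) : 0 <= y -> `|sin y - y| <= y ^+ 2.
  move=> y0.
  have := @le_monomial_of_derive R 1 1 (fun y => sin y - y) (fun y => cos y - 1) _ _ _ y y0.
  rewrite mul1r => H; apply: (le_trans (H _ _ _)) => {H}.
  - by rewrite sin0 subrr.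
  - by move=> z z0; rewrite mul1r expr1 divr1; exact: cosb.
  - by rewrite ler_pdivrMr// ler_peMr ?sqr_ge0// ler1n.
have [x0|x0] := lerP 0 x; first exact: sinb.
have := sinb (- x); rewrite oppr_ge0 (ltW x0) => /(_ isT).
by rewrite sinN -opprD normrN sqrrN.
Qed.

End ramps.

(** When [v > 0], one of [v + w] and [v - w] is [v + |w|], which dominates both [v] and [|w|]. The
    sum has the shape of the majorant of [pos_diff_quotient]. *)
Lemma pos_monomial_le (R : realType) q m (v w : R) :
  pos v ^+ q.+1 * `|w| ^+ m <=
   \sum_(i < 4) pos (v + (i%:R - 1) * w) ^+ (q + m).+1.
Proof.
have S0 (P : pred 'I_4) :
    0 <= \sum_(i < 4 | P i) pos (v + (i%:R - 1) * w) ^+ (q + m).+1.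
  by rewrite sumr_ge0// => i _; rewrite exprn_ge0// pos_ge0.
have [v0|v0] := lerP v 0; first by rewrite pos_eq0// expr0n/= mul0r.
have key (i : 'I_4) B : pos (v + (i%:R - 1) * w) = B -> v <= B -> `|w| <= B ->
   pos v ^+ q.+1 * `|w| ^+ m <= \sum_(i < 4) pos (v + (i%:R - 1) * w) ^+ (q + m).+1.
  move=> iB vB wB; rewrite (bigD1 i)//= iB.
  have B0 : 0 <= B by rewrite -iB pos_ge0.
  apply: ler_wpDr; first exact: S0.
  rewrite -addSn exprD ler_pM ?exprn_ge0 ?pos_ge0//.
    by rewrite lerXn2r ?nnegrE ?pos_ge0// pos_id// ltW.
  by rewrite lerXn2r ?nnegrE.
have [w0|w0] := lerP 0 w.
  by apply: (key (@Ordinal 4 2 isT) (v + w)); rewrite /= ?pos_id ?(ger0_norm w0); lra.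
by apply: (key (@Ordinal 4 0 isT) (v - w)); rewrite /= ?pos_id ?(ltr0_norm w0); lra.
Qed.

Lemma Rintegral_sum d (T : measurableType d) (R : realType)
    (m : {measure set T -> \bar R}) (I : Type) (r : seq I) (f : I -> T -> R) :
  (forall i, m.-integrable setT (EFin \o f i)) ->
  \int[m]_t (\sum_(i <- r) f i t) = \sum_(i <- r) \int[m]_t f i t.
Proof.
move=> if_; elim: r => [|i r ih].
  rewrite big_nil -[RHS](mul0r (fine (m setT))) -Rintegral_cst//.
  by apply: eq_Rintegral => t _; rewrite big_nil.
rewrite big_cons -ih -RintegralD//.
  by apply: eq_Rintegral => t _; rewrite big_cons.
have := integrable_sum measurableT r (P := xpredT) (fun i _ => if_ i).
by apply: eq_integrable => // t _ /=; rewrite sumEFin.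
Qed.

(** * From powers of positive parts to trigonometric test functions *)

Section trig_test_functions.
Context d (T : measurableType d) (R : realType).
Variables (nu_ : nat -> {measure set T -> \bar R}) (nu : {measure set T -> \bar R}).
(** [A] stands for the forms [<s, x> - c] with [sum_i s_i = 1], [L] for the directions [<r, x>] with
    [sum_i r_i = 0], and [xi] below for one coordinate. [A_bound] amounts to a finite exponential
    moment and gives Taylor series a positive radius. *)
Variables A L : set (T -> R).
Hypothesis measurable_A : forall v, A v -> measurable_fun setT v.
Hypothesis measurable_L : forall w, L w -> measurable_fun setT w.
Hypothesis A_addL : forall v w a, A v -> L w -> A (fun t => v t + a * w t).
Hypothesis A_pow : forall v q, A v -> cvg_int nu_ nu (fun t => pos (v t) ^+ q.+1).
Hypothesis A_bound : forall v, A v -> exists C : R,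
  forall q, \int[nu]_t (pos (v t) ^+ q.+1) <= C * 2 ^+ q.+1 * (q.+1)`!%:R.

Lemma measurable_pos (v : T -> R) : measurable_fun setT v ->
  measurable_fun setT (fun t => pos (v t)).
Proof. by move=> mv; apply: measurable_maxr => //; exact: measurable_cst. Qed.

(* A factor [w] comes from differentiating [pos (v + r * w) ^+ q.+2] at [r = 0]. *)
Lemma cvg_int_pos_monomial v w q m : A v -> L w ->
  cvg_int nu_ nu (fun t => pos (v t) ^+ q.+1 * w t ^+ m).
Proof.
move=> Av Lw; elim: m v q Av => [|m ih] v q Av.
  by under [X in cvg_int _ _ X]funext do rewrite expr0 mulr1; exact: A_pow.
pose S t := \sum_(i < 4) pos (v t + (i%:R - 1) * w t) ^+ (q + m).+2.
have S0 t : 0 <= S t by rewrite /S sumr_ge0// => i _; rewrite exprn_ge0// pos_ge0.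
have cS : cvg_int nu_ nu S.
  by apply: cvg_int_sum => i; apply: A_pow; exact: A_addL.
apply: cvg_int_approx.
  apply: measurable_funM; apply: measurable_funX; last exact: measurable_L.
  by apply: measurable_pos; exact: measurable_A.
move=> e e0.
pose K := q.+3%:R * \int[nu]_t S t + 1.
have K0 : 0 < K by rewrite ltr_wpDl// mulr_ge0// Rintegral_ge0.
pose r := Num.min 1 (e / 2 / K).
have r0 : 0 < r by rewrite lt_min ltr01 !divr_gt0.
exists (fun t => (q.+2%:R * r)^-1 * (pos (v t + r * w t) ^+ q.+2 * w t ^+ m
                  - pos (v t) ^+ q.+2 * w t ^+ m)).
exists (fun t => q.+3%:R * r * S t); split.
- apply: cvg_intZ; apply: cvg_intB; apply: ih => //.
  exact: A_addL.
- apply: cvg_int_le.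
  + by move=> t; rewrite !mulr_ge0// ltW.
  + exact: cvg_intZ.
  + rewrite RintegralZl//; last by case: cS.
    apply: (@le_lt_trans _ _ (r * K)).
      by rewrite -mulrA mulrCA ler_wpM2l// ?(ltW r0)// lerDl.
    rewrite -ltr_pdivlMr// (le_lt_trans (_ : _ <= e / 2 / K))//.
      by rewrite ge_min lexx orbT.
    by rewrite ltr_pM2r ?invr_gt0// gtr_pMr//; lra.
- move=> t; rewrite distrC.
  have := @pos_diff_quotient _ q m (v t) (w t) r.
  rewrite r0 ge_min lexx => /(_ isT).
  by rewrite -mulrBl mulrA (mulrC _^-1).
Qed.

(* The Taylor remainder [w ^ M / M!] is dominated by [4 ^- M] times powers of [v + i (4 w)], so
   that it beats the factor [2 ^ M] of [A_bound], whatever the size of [w]. *)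
Lemma cvg_int_pos_trig v w a b : A v -> L w ->
  cvg_int nu_ nu (fun t => pos (v t) * (a * cos (w t) + b * sin (w t))).
Proof.
move=> Av Lw; apply: cvg_int_approx.
  apply: measurable_funM; first by apply: measurable_pos; exact: measurable_A.
  have mw := measurable_L Lw.
  apply: measurable_funD; apply: measurable_funM => //.
    by apply: measurableT_comp mw; apply: continuous_measurable_fun; exact: continuous_cos.
  by apply: measurableT_comp mw; apply: continuous_measurable_fun; exact: continuous_sin.
move=> e e0.
have A4 (i : 'I_4) : A (fun t => v t + (i%:R - 1) * (4 * w t)).
  have := A_addL ((i%:R - 1) * 4) Av Lw.
  by under [X in A X]funext do rewrite -mulrA.
have /choice[C CP] : forall i : 'I_4, exists C : R, forall q,
    \int[nu]_t (pos (v t + (i%:R - 1) * (4 * w t)) ^+ q.+1)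
    <= C * 2 ^+ q.+1 * (q.+1)`!%:R by move=> i; apply: A_bound.
pose S q t := \sum_(i < 4) pos (v t + (i%:R - 1) * (4 * w t)) ^+ q.+1.
have cS q : cvg_int nu_ nu (S q) by apply: cvg_int_sum => i; exact: A_pow.
have Sb q : \int[nu]_t S q t <= (\sum_i C i) * 2 ^+ q.+1 * (q.+1)`!%:R.
  rewrite Rintegral_sum; last by move=> i; case: (A_pow q (A4 i)).
  by rewrite !mulr_suml; apply: ler_sum => i _; rewrite -mulrA mulrA; exact: CP.
pose B := \sum_i `|C i|.
have B0 : 0 <= B by rewrite sumr_ge0.
have CB : \sum_i C i <= B by rewrite ler_sum// => i _; exact: ler_norm.
pose c := `|a| + `|b|.
have c0 : 0 <= c by rewrite addr_ge0.
(* The remainder of order [2M] integrates to at most [2 c B (2M+1) / 2^(2M)], which is at most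
   [4 c B / (M+1)] because [2^(2M) >= (M+1)^2]. *)
have [M MP] : exists M : nat, 4 * c * B / e < M.+1%:R.
  exists (Num.truncn (4 * c * B / e)).
  by rewrite truncnS_gt.
have [p pP] := @trig_taylor R M.*2 a b.
exists (fun t => \sum_(i < size p) p`_i * (pos (v t) ^+ 1 * w t ^+ i)).
exists (fun t => c * 4 ^- M.*2 / (M.*2)`!%:R * S M.*2 t).
have D0 : 0 <= c * 4 ^- M.*2 / (M.*2)`!%:R :> R.
  by rewrite !mulr_ge0// invr_ge0// exprn_ge0.
split.
- by apply: cvg_int_sum => i; apply: cvg_intZ; exact: cvg_int_pos_monomial.
- apply: cvg_int_le.
  + move=> t; rewrite mulr_ge0// sumr_ge0// => i _.
    by rewrite exprn_ge0// pos_ge0.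
  + exact: cvg_intZ.
  + rewrite RintegralZl//; last by case: (cS M.*2).
    apply: (@le_lt_trans _ _ (c * 4 ^- M.*2 / (M.*2)`!%:R * (B * 2 ^+ (M.*2).+1 * ((M.*2).+1)`!%:R))).
      rewrite ler_wpM2l//; apply: le_trans (Sb _) _.
      by rewrite !ler_wpM2r// exprn_ge0.
    have f0 : (M.*2)`!%:R != 0 :> R by rewrite pnatr_eq0 gtn_eqF// fact_gt0.
    pose z : R := 2 ^+ M.*2.
    have zM : M.+1%:R ^+ 2 <= z.
      rewrite /z -addnn exprD -expr2 lerXn2r ?nnegrE ?exprn_ge0//.
      by rewrite -natrX ler_nat ltn_expl.
    have z0 : 0 < z by rewrite exprn_gt0.
    have -> : (4 : R) ^+ M.*2 = z * z by rewrite -exprMn; congr (_ ^+ _); ring.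
    rewrite factS natrM exprS -/z.
    rewrite (_ : _ * _ = 2 * (c * B) * ((M.*2).+1%:R / z)); last first.
      move: (gt_eqF z0) f0 => /negbT z1; move: (_.+1%:R) (_`!%:R) => x y y0.
      by field; rewrite z1 y0.
    have M0 : 0 < M.+1%:R :> R by [].
    apply: (@le_lt_trans _ _ (2 * (c * B) * (2 * M.+1%:R / M.+1%:R ^+ 2))).
      rewrite ler_wpM2l ?mulr_ge0// ler_pM ?invr_ge0 ?(ltW z0)//.
        by rewrite -natrM ler_nat mul2n doubleS ltnW.
      by rewrite lef_pV2 ?posrE ?exprn_gt0.
    rewrite (_ : _ * _ = 4 * c * B / M.+1%:R); last by field; rewrite gt_eqF.
    by move: MP; rewrite !ltr_pdivrMr// (mulrC e).
- move=> t; rewrite expr1.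
  have -> : \sum_(i < size p) p`_i * (pos (v t) * w t ^+ i) = pos (v t) * p.[w t].
    by rewrite horner_coef mulr_sumr; apply: eq_bigr => i _; rewrite mulrCA.
  rewrite -mulrBr normrM (ger0_norm (pos_ge0 _)).
  apply: (@le_trans _ _ (pos (v t) * (c * `|w t| ^+ M.*2 / (M.*2)`!%:R))).
    by rewrite ler_wpM2l ?pos_ge0.
  have := @pos_monomial_le R 0 M.*2 (v t) (4 * w t).
  rewrite add0n -/(S M.*2 t) expr1 normrM exprMn (ger0_norm (ler0n _ _)).
  move=> H.
  have -> : pos (v t) * (c * `|w t| ^+ M.*2 / (M.*2)`!%:R) =
    c * 4 ^- M.*2 / (M.*2)`!%:R * (pos (v t) * (4 ^+ M.*2 * `|w t| ^+ M.*2)).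
    have : (4 : R) ^+ M.*2 != 0 by rewrite expf_neq0.
    have : (M.*2)`!%:R != 0 :> R by rewrite pnatr_eq0 gtn_eqF// fact_gt0.
    move: (_`!%:R) (4 ^+ _) => x y x0 y0; field; by rewrite x0 y0.
  by rewrite ler_wpM2l.
Qed.

Variable xi : T -> R.
Hypothesis A_xi : forall c, A (fun t => xi t - c).
Hypothesis L_add : forall w w' a, L w -> L w' -> L (fun t => w t + a * w' t).

Lemma measurable_xi : measurable_fun setT xi.
Proof.
by have := measurable_A (A_xi 0); under [X in measurable_fun _ X]funext do rewrite subr0.
Qed.

Lemma cvg_int_pos_xi c : cvg_int nu_ nu (fun t => pos (xi t - c)).
Proof.
by have := A_pow 0 (A_xi c); under [X in cvg_int _ _ X]funext do rewrite expr1.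
Qed.

(** [f] is replaced by its interpolant on a grid of mesh [h] with [N] nodes. On the grid the error
    is at most [2 K h], charged to [pos (xi - (c - 1))], which exceeds 1 where [xi > c]. Beyond the
    last node it is at most [2 M], charged as in Markov's inequality to [pos (xi - c) / (N h)].
    Hence [h] is chosen first, [N] next. *)
Lemma cvg_int_lipschitz (f : R -> R) (K M c : R) (Q : T -> R) (B : R) :
  (forall x z, `|f x - f z| <= K * `|x - z|) ->
  (forall x, x <= c -> f x = 0) -> (forall x, `|f x| <= M) ->
  measurable_fun setT Q -> 0 <= B -> (forall t, `|Q t| <= B) ->
  (forall b, cvg_int nu_ nu (fun t => pos (xi t - b) * Q t)) ->
  cvg_int nu_ nu (fun t => f (xi t) * Q t).
Proof.
move=> fK fc fM mQ B0 QB cQ.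
have K0 : 0 <= K.
  by have := le_trans (normr_ge0 _) (fK 0 1); rewrite sub0r normrN1 mulr1.
have M0 : 0 <= M := le_trans (normr_ge0 _) (fM 0).
have fcont : continuous f.
  move=> x; apply/cvgrPdist_le => e e0; near=> z.
  apply: le_trans (fK x z) _.
  have : `|x - z| <= e / (K + 1).
    near: z; apply: cvgr_dist_le => //.
    by rewrite divr_gt0// ltr_wpDl.
  rewrite ler_pdivlMr ?ltr_wpDl//; have := normr_ge0 (x - z); nra.
apply: cvg_int_approx.
  apply: measurable_funM => //; apply: measurableT_comp; last exact: measurable_xi.
  exact: continuous_measurable_fun.
move=> e e0.
pose I1 := \int[nu]_t pos (xi t - (c - 1)).
pose I2 := \int[nu]_t pos (xi t - c).
have I10 : 0 <= I1 by apply: Rintegral_ge0 => t _; exact: pos_ge0.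
have I20 : 0 <= I2 by apply: Rintegral_ge0 => t _; exact: pos_ge0.
have [h h0 hP] : exists2 h : R, 0 < h & (2 * K * h * B) * I1 < e / 2.
  have k0 : 0 < 4 * (K * B * I1 + 1) by rewrite mulr_gt0// ltr_wpDl// !mulr_ge0.
  exists (e / (4 * (K * B * I1 + 1))); first by rewrite divr_gt0.
  have -> : 2 * K * (e / (4 * (K * B * I1 + 1))) * B * I1 =
     (K * B * I1) / (K * B * I1 + 1) * (e / 2).
    by field; rewrite gt_eqF// ltr_wpDl// !mulr_ge0.
  rewrite gtr_pMl ?divr_gt0// ltr_pdivrMr ?mul1r ?ltrDl// ltr_wpDl// !mulr_ge0//.
have [N N0 NP] : exists2 N : nat, (0 < N)%N & (2 * M / (N%:R * h) * B) * I2 < e / 2.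
  pose Y := 2 * M * B * I2 / (h * (e / 2)).
  exists (Num.truncn Y).+1 => //.
  have : Y < (Num.truncn Y).+1%:R by rewrite truncnS_gt.
  rewrite {1}/Y ltr_pdivrMr ?mulr_gt0 ?divr_gt0// => H.
  have N1 : 0 < (Num.truncn Y).+1%:R :> R by [].
  have hz : h != 0 by rewrite gt_eqF.
  move: (_.+1%:R) N1 H => N N1 H.
  have -> : 2 * M / (N * h) * B * I2 = 2 * M * B * I2 / (N * h).
    by field; rewrite hz gt_eqF.
  by rewrite ltr_pdivrMr ?mulr_gt0// (_ : e / 2 * (N * h) = N * (h * (e / 2))); [|ring].
have [fN1 fN2] := @ramp_interpolation R f K c h N h0 K0 fK (fc _ (lexx c)).
pose g t := \sum_(m < N) (f (c + m.+1%:R * h) - f (c + m%:R * h)) * (h^-1 *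
   (pos (xi t - (c + m%:R * h)) * Q t - pos (xi t - (c + m%:R * h + h)) * Q t)).
exists g, (fun t => 2 * K * h * B * pos (xi t - (c - 1))
                     + 2 * M / (N%:R * h) * B * pos (xi t - c)).
have cD : cvg_int nu_ nu (fun t => 2 * K * h * B * pos (xi t - (c - 1))
                     + 2 * M / (N%:R * h) * B * pos (xi t - c)).
  by apply: cvg_intD; apply: cvg_intZ; exact: cvg_int_pos_xi.
have k1 : 0 <= 2 * K * h * B by rewrite !mulr_ge0// ltW.
have k2 : 0 <= 2 * M / (N%:R * h) * B by rewrite !mulr_ge0// invr_ge0 mulr_ge0// ltW.
split.
- apply: cvg_int_sum => m; apply: cvg_intZ; apply: cvg_intZ.
  by apply: cvg_intB; exact: cQ.
- apply: cvg_int_le => //.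
    by move=> t; apply: addr_ge0; apply: mulr_ge0 => //; exact: pos_ge0.
  rewrite RintegralD//; last 2 first.
    by case: (cvg_intZ (2 * K * h * B) (cvg_int_pos_xi (c - 1))).
    by case: (cvg_intZ (2 * M / (N%:R * h) * B) (cvg_int_pos_xi c)).
  rewrite !RintegralZl//; last 2 first.
    by case: (cvg_int_pos_xi c).
    by case: (cvg_int_pos_xi (c - 1)).
  rewrite -/I1 -/I2; lra.
- move=> t.
  have -> : g t = (\sum_(m < N) (f (c + m.+1%:R * h) - f (c + m%:R * h)) * ramp (c + m%:R * h) h (xi t)) * Q t.
    rewrite mulr_suml; apply: eq_bigr => m _; rewrite /ramp; ring.
  rewrite -mulrBl normrM.
  have QBt := QB t.
  have p1 := pos_ge0 (xi t - (c - 1)); have p2 := pos_ge0 (xi t - c).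
  have g1 := ge_pos (xi t - (c - 1)); have g2 := ge_pos (xi t - c).
  have [xc|xc] := lerP (xi t) c.
    rewrite fc// big1; last first.
      by move=> m _; rewrite ramp_eq0 ?mulr0// (le_trans xc)// lerDl mulr_ge0// ltW.
    by rewrite subrr normr0 mul0r; apply: addr_ge0; apply: mulr_ge0.
  have [xN|xN] := lerP (xi t) (c + N%:R * h).
    apply: ler_wpDr; first by rewrite mulr_ge0.
    have fx := fN2 (xi t).
    rewrite (ltW xc) xN in fx.
    apply: (@le_trans _ _ (2 * K * h * B)); first by rewrite ler_pM// fx.
    by rewrite ler_peMr//; lra.
  apply: ler_wpDl; first by rewrite mulr_ge0.
  rewrite fN1 ?(ltW xN)//.
  have Nh0 : 0 < N%:R * h by rewrite mulr_gt0// ltr0n.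
  apply: (@le_trans _ _ (2 * M * B)).
    rewrite ler_pM//; apply: le_trans (ler_normB _ _) _.
    by have := fM (xi t); have := fM (c + N%:R * h); lra.
  rewrite -(mulrA (2 * M)) -(mulrA (2 * M)) ler_wpM2l ?mulr_ge0//.
  rewrite -mulrA mulrCA ler_peMr// mulrC ler_pdivlMr// mul1r; lra.
Unshelve. all: by end_near. Qed.

(** [tau xi + w] is not a direction of [L] in general; the addition formulas split off functions of
    [tau xi], which the ramp turns into bounded Lipschitz functions of [xi] vanishing left of
    [c]. *)
Lemma cvg_int_ramp_trig (c h tau a b : R) w : 0 < h -> L w ->
  cvg_int nu_ nu (fun t => ramp c h (xi t) *
    (a * cos (tau * xi t + w t) + b * sin (tau * xi t + w t))).
Proof.
move=> h0 Lw.
have mw := measurable_L Lw.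
have mtrig a' b' : measurable_fun setT (fun t => a' * cos (w t) + b' * sin (w t)).
  apply: measurable_funD; apply: measurable_funM => //.
    by apply: measurableT_comp mw; apply: continuous_measurable_fun; exact: continuous_cos.
  by apply: measurableT_comp mw; apply: continuous_measurable_fun; exact: continuous_sin.
have trig_le a' b' x : `|a' * cos x + b' * sin x| <= `|a'| + `|b'| :> R.
  apply: le_trans (ler_normD _ _) _; rewrite !normrM lerD//.
    by rewrite ler_piMr// ler_norml cos_geN1 cos_le1.
  by rewrite ler_piMr// ler_norml sin_geN1 sin_le1.
have lip (f : R -> R) : (forall x : R, `|f x| <= 1) -> (forall x z, `|f x - f z| <= `|x - z|) ->
   forall a' b', cvg_int nu_ nu (fun t => ramp c h (xi t) * f (tau * xi t) * (a' * cos (w t) + b' * sin (w t))).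
  move=> f1 fK a' b'.
  apply: (@cvg_int_lipschitz (fun x => ramp c h x * f (tau * x)) (2 / h + `|tau|) 1 c _ (`|a'| + `|b'|)) => //.
  - move=> x z.
    rewrite (_ : _ - _ = (ramp c h x - ramp c h z) * f (tau * x) + ramp c h z * (f (tau * x) - f (tau * z))); last by ring.
    apply: le_trans (ler_normD _ _) _; rewrite (normrM (_ - _)) (normrM (ramp _ _ _)) mulrDl lerD//.
      rewrite -[leRHS]mulr1; apply: ler_pM => //; exact: ramp_lipschitz.
    rewrite -[leRHS]mul1r; apply: ler_pM => //; first exact: normr_ramp_le1.
    by rewrite (le_trans (fK _ _))// -mulrBr normrM.
  - by move=> x xc; rewrite ramp_eq0// mul0r.
  - by move=> x; rewrite normrM mulr_ile1//; exact: normr_ramp_le1.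
  - by move=> c'; apply: cvg_int_pos_trig.
have sin_lip (x z : R) : `|sin x - sin z| <= `|x - z|.
  wlog xz : x z / z < x.
    move=> H; have [/H//|/H|->] := ltgtP z x; last by rewrite !subrr.
    by rewrite distrC (distrC x).
  have [|y _ ->] := @MVT R sin cos z x xz (fun y _ => is_derive_sin y).
    by apply: continuous_subspaceT; exact: continuous_sin.
  by rewrite normrM ler_piMl// ler_norml cos_geN1 cos_le1.
have cos_lip (x z : R) : `|cos x - cos z| <= `|x - z|.
  have cE y : cos y = sin (y + pi / 2) :> R by rewrite sinDpihalf.
  rewrite !cE (le_trans (sin_lip _ _))// (_ : x + _ - _ = x - z)//; ring.
have h1 := lip cos (fun x => _) cos_lip a b.
have h2 := lip sin (fun x => _) sin_lip b (- a).
have -> : (fun t => ramp c h (xi t) * (a * cos (tau * xi t + w t) + b * sin (tau * xi t + w t)))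
  = (fun t => ramp c h (xi t) * cos (tau * xi t) * (a * cos (w t) + b * sin (w t))
  + ramp c h (xi t) * sin (tau * xi t) * (b * cos (w t) + (- a) * sin (w t))).
  by apply/funext => t; rewrite cosD sinD; ring.
apply: cvg_intD; [apply: h1 => x|apply: h2 => x].
  by rewrite ler_norml cos_geN1 cos_le1.
by rewrite ler_norml sin_geN1 sin_le1.
Qed.

(** All linear forms in the intended use: [xi] has coefficient sum 1, so a form of sum [tau] is
    [tau xi] plus a direction of sum 0. *)
Definition xi_linear (u : T -> R) :=
  exists tau w, L w /\ u = (fun t => tau * xi t + w t).

Lemma xi_linear_add u u' a : xi_linear u -> xi_linear u' ->
  xi_linear (fun t => u t + a * u' t).
Proof.
move=> [tau [w [Lw ->]]] [tau' [w' [Lw' ->]]].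
exists (tau + a * tau'), (fun t => w t + a * w' t); split; first exact: L_add.
by apply/funext => t; ring.
Qed.

Lemma measurable_xi_linear u : xi_linear u -> measurable_fun setT u.
Proof.
move=> [tau [w [Lw ->]]]; apply: measurable_funD; last exact: measurable_L.
by apply: measurable_funM => //; exact: measurable_xi.
Qed.

(** An integrable majorant for second moments of any linear form, to which errors [y^2 / l] are
    charged. It follows from [(tau (z + c) + w)^2 <= 4 tau^2 z^2 + 4 tau^2 c^2 + 2 w^2] with
    [z = xi - c]. *)
Lemma cvg_int_pos_sqr c u : xi_linear u ->
  exists D, [/\ cvg_int nu_ nu D & forall t, pos (xi t - c) * u t ^+ 2 <= D t].
Proof.
move=> [tau [w [Lw ->]]].
exists (fun t => (4 * tau ^+ 2) * pos (xi t - c) ^+ 3 +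
  ((4 * tau ^+ 2 * c ^+ 2) * pos (xi t - c) + 2 * (pos (xi t - c) ^+ 1 * w t ^+ 2))); split.
  apply: cvg_intD; first by apply: cvg_intZ; exact: A_pow.
  apply: cvg_intD; first by apply: cvg_intZ; exact: cvg_int_pos_xi.
  by apply: cvg_intZ; apply: cvg_int_pos_monomial.
move=> t; rewrite expr1.
have [x0|x0] := lerP (xi t - c) 0; first by rewrite pos_eq0//; nra.
rewrite pos_id ?(ltW x0)//.
have -> : xi t = (xi t - c) + c by ring.
rewrite addrK; move: (xi t - c) (w t) x0 => z y z0.
rewrite (_ : z ^+ 3 = z * z ^+ 2); last by ring.
rewrite -subr_ge0 (_ : _ - _ = z * (2 * tau ^+ 2 * (z - c) ^+ 2 + (tau * (z + c) - y) ^+ 2)); last by ring.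
by rewrite mulr_ge0 ?(ltW z0)// addr_ge0 ?sqr_ge0// mulr_ge0 ?sqr_ge0// mulr_ge0 ?sqr_ge0.
Qed.

(** Factors that may be inserted into the convergent integrals. Quantifying over all [u], [a], [b]
    at once lets a further sine be absorbed into the trigonometric factor. *)
Definition trig_multiplier (c h : R) (G : T -> R) :=
  [/\ measurable_fun setT G, forall t, `|G t| <= 1 & forall u a b, xi_linear u ->
    cvg_int nu_ nu (fun t => ramp c h (xi t) * (a * cos (u t) + b * sin (u t)) * G t)].

(* [y] is close to [l sin (y / l)] for large [l], on whose range [r] is close to a polynomial, and
   multiplication by [sin (y / l)] preserves the span of the trigonometric functions. *)
Lemma trig_multiplierM c h (r : R -> R) (K : R) y G : 0 < h ->
  poly_approx r -> (forall x z, `|r x - r z| <= K * `|x - z|) ->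
  (forall x, `|r x| <= 1) -> measurable_fun setT r -> xi_linear y ->
  trig_multiplier c h G -> trig_multiplier c h (fun t => r (y t) * G t).
Proof.
move=> h0 ar rK r1 mr Ly [mG G1 cG].
have my := measurable_xi_linear Ly.
have mry : measurable_fun setT (fun t => r (y t)) by exact: measurableT_comp.
split; first exact: measurable_funM.
  by move=> t; rewrite normrM mulr_ile1.
move=> u a b Lu.
have mu := measurable_xi_linear Lu.
have K0 : 0 <= K.
  by have := le_trans (normr_ge0 _) (rK 0 1); rewrite sub0r normrN1 mulr1.
have mramp : measurable_fun setT (fun t => ramp c h (xi t)).
  apply: measurable_funM => //; apply: measurable_funB; apply: measurable_pos;
  by apply: measurable_funB => //; exact: measurable_xi.
have powers l m : forall a b u, xi_linear u -> cvg_int nu_ nu (fun t =>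
    ramp c h (xi t) * (a * cos (u t) + b * sin (u t)) * (l * sin (l^-1 * y t)) ^+ m * G t).
  elim: m => [|m ih] a' b' u' Lu'.
    by under [X in cvg_int _ _ X]funext do rewrite expr0 mulr1; exact: cG.
  have := cvg_intD (ih (- (l * b' / 2)) (l * a' / 2) _ (xi_linear_add l^-1 Lu' Ly))
     (ih (l * b' / 2) (- (l * a' / 2)) _ (xi_linear_add (- l^-1) Lu' Ly)).
  congr cvg_int; apply/funext => t.
  rewrite (mulNr l^-1) !cosD !sinD cosN sinN exprS.
  by field.
apply: cvg_int_approx.
  apply: measurable_funM; last exact: measurable_funM.
  apply: measurable_funM => //.
  apply: measurable_funD; apply: measurable_funM => //.
    by apply: measurableT_comp mu; apply: continuous_measurable_fun; exact: continuous_cos.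
  by apply: measurableT_comp mu; apply: continuous_measurable_fun; exact: continuous_sin.
move=> e e0.
have [D [cD yD]] := cvg_int_pos_sqr (c - 1) Ly.
pose B := `|a| + `|b|.
have B0 : 0 <= B by rewrite addr_ge0.
have D0 t : 0 <= D t by apply: le_trans (yD t); rewrite mulr_ge0 ?pos_ge0 ?sqr_ge0.
pose I1 := \int[nu]_t D t; pose I2 := \int[nu]_t pos (xi t - (c - 1)).
have I10 : 0 <= I1 by apply: Rintegral_ge0.
have I20 : 0 <= I2 by apply: Rintegral_ge0 => t _; exact: pos_ge0.
have small I : 0 <= I -> 0 < e / 2 / (B * (K + 1) * I + 1) .
  by move=> I0; rewrite !divr_gt0// ltr_wpDl// !mulr_ge0// addr_ge0.
(* [l] is fixed so that the part [K y^2 / l] of the error integrates to less than [e / 2]; only then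
   is [r] approximated on [[-l, l]], within an [s] that takes care of the other half. *)
pose l := (e / 2 / (B * (K + 1) * I1 + 1))^-1.
have l0 : 0 < l by rewrite invr_gt0 small.
pose s := e / 2 / (B * (K + 1) * I2 + 1).
have s0 : 0 < s by exact: small.
have [p pP] := ar l s l0 s0.
exists (fun t => \sum_(i < size p) p`_i * (ramp c h (xi t) * (a * cos (u t) + b * sin (u t)) * (l * sin (l^-1 * y t)) ^+ i * G t)).
exists (fun t => B * K / l * D t + B * s * pos (xi t - (c - 1))).
have k1 : 0 <= B * K / l by rewrite !mulr_ge0// invr_ge0 ltW.
have k2 : 0 <= B * s by rewrite mulr_ge0 ?(ltW s0).
split.
- by apply: cvg_int_sum => i; apply: cvg_intZ; exact: powers.
- apply: cvg_int_le.
  + by move=> t; apply: addr_ge0; apply: mulr_ge0 => //; exact: pos_ge0.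
  + by apply: cvg_intD; apply: cvg_intZ => //; exact: cvg_int_pos_xi.
  rewrite RintegralD//; last 2 first.
    by case: (cvg_intZ (B * K / l) cD).
    by case: (cvg_intZ (B * s) (cvg_int_pos_xi (c - 1))).
  rewrite !RintegralZl//; last 2 first.
    by case: (cvg_int_pos_xi (c - 1)).
    by case: cD.
  rewrite -/I1 -/I2.
  have half I k : 0 <= I -> 0 <= k -> k <= K + 1 -> B * k * (e / 2 / (B * (K + 1) * I + 1)) * I < e / 2.
    move=> I0 k0' kK.
    have J0 : 0 < B * (K + 1) * I + 1 by rewrite ltr_wpDl// !mulr_ge0// addr_ge0.
    rewrite (_ : _ * _ = (B * k * I) * (e / 2) / (B * (K + 1) * I + 1)); last by field; rewrite gt_eqF.
    rewrite ltr_pdivrMr// mulrC ltr_pM2l ?divr_gt0//.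
    have : B * k * I <= B * (K + 1) * I by rewrite ler_wpM2r// ler_wpM2l.
    lra.
  have K1 : K <= K + 1 by rewrite lerDl.
  have := half I1 K I10 K0 K1; have := half I2 1 I20 ler01.
  rewrite lerDr mulr1 -/s => /(_ K0).
  rewrite -[e / 2 / (_ + 1)]invrK -/l; lra.
- move=> t.
  set z := l * sin (l^-1 * y t).
  have -> : \sum_(i < size p) p`_i * (ramp c h (xi t) * (a * cos (u t) + b * sin (u t)) * z ^+ i * G t)
     = ramp c h (xi t) * (a * cos (u t) + b * sin (u t)) * (p.[z] * G t).
    by rewrite horner_coef mulr_suml mulr_sumr; apply: eq_bigr => i _; ring.
  rewrite -mulrBr -mulrBl.
  have zl : `|z| <= l.
    by rewrite /z normrM (gtr0_norm l0) ler_piMr ?(ltW l0)// ler_norml sin_geN1 sin_le1.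
  have zy : `|y t - z| <= y t ^+ 2 / l.
    have -> : y t - z = - (l * (sin (l^-1 * y t) - l^-1 * y t)).
      by rewrite /z; field; rewrite gt_eqF.
    rewrite normrN normrM (gtr0_norm l0).
    apply: (@le_trans _ _ (l * (l^-1 * y t) ^+ 2)).
      by rewrite ler_wpM2l ?(ltW l0)// normr_sin_id_le.
    by rewrite exprMn (_ : l * _ = y t ^+ 2 / l)//; field; rewrite gt_eqF.
  have rp : `|r (y t) - p.[z]| <= K * (y t ^+ 2 / l) + s.
    rewrite (_ : _ - _ = (r (y t) - r z) + (r z - p.[z])); last by ring.
    apply: le_trans (ler_normD _ _) _; rewrite lerD ?pP//.
    by rewrite (le_trans (rK _ _))// ler_wpM2l.
  have trig_le : `|a * cos (u t) + b * sin (u t)| <= B.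
    apply: le_trans (ler_normD _ _) _; rewrite !normrM lerD//.
      by rewrite ler_piMr// ler_norml cos_geN1 cos_le1.
    by rewrite ler_piMr// ler_norml sin_geN1 sin_le1.
  have rampx : `|ramp c h (xi t)| <= pos (xi t - (c - 1)).
    have [xc|xc] := lerP (xi t) c; first by rewrite ramp_eq0// normr0 pos_ge0.
    rewrite (le_trans (normr_ramp_le1 _ _ h0))// pos_id; lra.
  rewrite normrM (normrM (ramp _ _ _)) (normrM (r _ - _)).
  apply: (@le_trans _ _ (pos (xi t - (c - 1)) * B * ((K * (y t ^+ 2 / l) + s) * 1))).
    by apply: ler_pM; rewrite ?mulr_ge0//; apply: ler_pM.
  rewrite mulr1 [leLHS](_ : _ = B * K / l * (pos (xi t - (c - 1)) * y t ^+ 2) + B * s * pos (xi t - (c - 1))); last by ring.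
  by rewrite lerD2r ler_wpM2l.
Qed.

End trig_test_functions.

Lemma measurable_ramp d (T : measurableType d) (R : realType) (c h : R) (f : T -> R) : measurable_fun setT f ->
  measurable_fun setT (fun t => ramp c h (f t)).
Proof.
move=> mf; apply: measurable_funM => //; apply: measurable_funB;
by apply: measurable_pos; apply: measurable_funB.
Qed.

Lemma prodB_le (R : realType) (I : Type) (s : seq I) (a b : I -> R) :
  (forall i, 0 <= a i <= 1) -> (forall i, 0 <= b i <= 1) ->
  `|\prod_(i <- s) a i - \prod_(i <- s) b i| <= \sum_(i <- s) `|a i - b i|.
Proof.
move=> a01 b01; elim: s => [|i s ih]; first by rewrite !big_nil subrr normr0.
rewrite !big_cons (_ : _ - _ = (a i - b i) * \prod_(j <- s) a j +
   b i * (\prod_(j <- s) a j - \prod_(j <- s) b j)); last by ring.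
apply: le_trans (ler_normD _ _) _; rewrite !normrM lerD//.
  rewrite ler_piMr// normr_prod prodr_ile1// => j _.
  by rewrite normr_ge0/= ger0_norm; have /andP[] := a01 j.
apply: le_trans ih; rewrite ler_piMl//.
by rewrite ger0_norm; have /andP[] := b01 i.
Qed.

(** The majorant is a trapezoid supported on [[c - h, c + 2 h]]: its integral is small with [h] when
    level [c] carries no mass. *)
Lemma indic_ramp_le (R : realType) (c h x : R) : 0 < h ->
  `|(c < x)%R%:R - ramp c h x| <= ramp (c - h) h x - ramp (c + h) h x.
Proof.
move=> h0; have [cx|cx] := ltrP c x.
  rewrite (@ramp_eq1 _ (c - h)) ?subrK ?(ltW cx)//.
  have [xc|xc] := lerP (c + h) x.
    by rewrite (@ramp_eq1 _ c)// subrr normr0 subr_ge0 ramp_le1.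
  rewrite (@ramp_eq0 _ (c + h)) ?(ltW xc)// subr0.
  have := ramp_ge0 c x h0; have := ramp_le1 c x h0 => ? ?.
  by rewrite ger0_norm ?subr_ge0// gerBl.
rewrite !(@ramp_eq0 _ c)// subrr normr0 (@ramp_eq0 _ (c + h)) ?subr0 ?ramp_ge0//.
by rewrite (le_trans cx)// lerDl ltW.
Qed.

(** * Masses of unions of exceedances *)

Section half_spaces.
Context d (T : measurableType d) (R : realType) (k : nat).
Variables (nu_ : nat -> {measure set T -> \bar R}) (nu : {measure set T -> \bar R}).
Variable x : 'I_k -> T -> R.
Let lin (s : 'I_k -> R) t := \sum_(i < k) s i * x i t.
Hypothesis mx : forall i, measurable_fun setT (x i).
Hypothesis lin_pow : forall s c q, \sum_i s i = 1 ->
  cvg_int nu_ nu (fun t => pos (lin s t - c) ^+ q.+1).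
Hypothesis lin_bound : forall s c, \sum_i s i = 1 -> exists C : R, forall q,
  \int[nu]_t (pos (lin s t - c) ^+ q.+1) <= C * 2 ^+ q.+1 * (q.+1)`!%:R.
Hypothesis lin_thin : forall j c e, 0 < e -> exists2 h : R, 0 < h &
  \int[nu]_t (ramp (c - h) h (x j t) - ramp (c + h) h (x j t)) < e.

Let A : set (T -> R) :=
  [set v | exists s c, \sum_i s i = 1 /\ v = (fun t => lin s t - c)].
Let L : set (T -> R) := [set w | exists s, \sum_i s i = 0 /\ w = lin s].

Let lin_add s s' a t : lin (fun i => s i + a * s' i) t = lin s t + a * lin s' t.
Proof.
by rewrite /lin mulr_sumr -big_split/=; apply: eq_bigr => i _; rewrite mulrDl mulrA.
Qed.

Let sum_add (s s' : 'I_k -> R) a :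
  \sum_i (s i + a * s' i) = \sum_i s i + a * \sum_i s' i.
Proof. by rewrite mulr_sumr -big_split. Qed.

Let mlin s : measurable_fun setT (lin s).
Proof.
by apply: measurable_sum => i; apply: measurable_funM.
Qed.

Let delta (i j : 'I_k) : R := (j == i)%:R.

Let lin_delta i t : lin (delta i) t = x i t.
Proof.
rewrite /lin (bigD1 i)//= /delta eqxx mul1r big1 ?addr0// => j /negbTE ->.
by rewrite mul0r.
Qed.

Let sum_delta i : \sum_j delta i j = 1.
Proof.
rewrite (bigD1 i)//= /delta eqxx big1 ?addr0// => j /negbTE ->.
by [].
Qed.

Let mA v : A v -> measurable_fun setT v.
Proof. by move=> [s [c [_ ->]]]; apply: measurable_funB => //. Qed.

Let mL w : L w -> measurable_fun setT w.
Proof. by move=> [s [_ ->]]. Qed.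

Let AL v w a : A v -> L w -> A (fun t => v t + a * w t).
Proof.
move=> [s [c [s1 ->]]] [s' [s0 ->]]; exists (fun i => s i + a * s' i), c; split.
  by rewrite sum_add s1 s0 mulr0 addr0.
by apply/funext => t; rewrite lin_add; ring.
Qed.

Let LL v w a : L v -> L w -> L (fun t => v t + a * w t).
Proof.
move=> [s [s1 ->]] [s' [s0 ->]]; exists (fun i => s i + a * s' i); split.
  by rewrite sum_add s1 s0 mulr0 addr0.
by apply/funext => t; rewrite lin_add.
Qed.

Let Apow v q : A v -> cvg_int nu_ nu (fun t => pos (v t) ^+ q.+1).
Proof. by move=> [s [c [s1 ->]]]; exact: lin_pow. Qed.

Let Abound v : A v -> exists C : R,
  forall q, \int[nu]_t (pos (v t) ^+ q.+1) <= C * 2 ^+ q.+1 * (q.+1)`!%:R.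
Proof. by move=> [s [c [s1 ->]]]; exact: lin_bound. Qed.

Let Ax i c : A (fun t => x i t - c).
Proof.
exists (delta i), c; split; first exact: sum_delta.
by apply/funext => t; rewrite lin_delta.
Qed.

Let x_linear i j : xi_linear L (x i) (x j).
Proof.
exists 1, (lin (fun l => delta j l + (-1) * delta i l)); split.
  exists (fun l => delta j l + (-1) * delta i l); split=> //.
  by rewrite sum_add !sum_delta mulN1r subrr.
by apply/funext => t; rewrite lin_add !lin_delta; ring.
Qed.

Let linear0 i : xi_linear L (x i) (fun=> 0).
Proof.
exists 0, (fun=> 0); split; last by apply/funext => t; rewrite mul0r addr0.
exists (fun=> 0); split; first by rewrite big1.
by apply/funext => t; rewrite /lin big1// => l _; rewrite mul0r.
Qed.

Let cvg_prod (t_ h : 'I_k -> R) i (s : seq 'I_k) : (forall j, 0 < h j) ->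
  trig_multiplier nu_ nu L (x i) (t_ i) (h i) (fun t => \prod_(j <- s) (1 - ramp (t_ j) (h j) (x j t))).
Proof.
move=> h0; elim: s => [|j s ih].
  split.
  - by under eq_fun do rewrite big_nil; exact: measurable_cst.
  - by move=> t; rewrite big_nil normr1.
  - move=> u a b [tau [w [Lw ->]]].
    under [X in cvg_int _ _ X]funext do rewrite big_nil mulr1.
    apply: (cvg_int_ramp_trig mA mL AL Apow Abound (Ax i)) => //.
under [X in trig_multiplier _ _ _ _ _ _ X]funext do rewrite big_cons.
apply: (trig_multiplierM mA mL AL Apow (Ax i) LL (r := fun z => 1 - ramp (t_ j) (h j) z) (K := 2 / h j)) => //.
- have := poly_approx_lincomb 1 (-1) (poly_approx_horner (1%:P : {poly R})) (poly_approx_ramp (t_ j) (h j)).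
  by congr poly_approx; apply/funext => z; rewrite hornerC; ring.
- move=> y z; rewrite (_ : _ - _ = - (ramp (t_ j) (h j) y - ramp (t_ j) (h j) z)); last by ring.
  by rewrite normrN ramp_lipschitz.
- move=> y; have := ramp_ge0 (t_ j) y (h0 j); have := ramp_le1 (t_ j) y (h0 j).
  by rewrite ler_norml => ? ?; apply/andP; split; lra.
- by apply: measurable_funB => //; exact: measurable_ramp.
Qed.

(* Telescoping gives each term of [1 - \prod_j (1 - r_j)] a factor [r_i], vanishing near [-oo]:
   [nu] is infinite, so the constant [1] could not be integrated. *)
Let cvg_union (t_ h : 'I_k -> R) (s : seq 'I_k) : (forall j, 0 < h j) ->
  cvg_int nu_ nu (fun t => 1 - \prod_(j <- s) (1 - ramp (t_ j) (h j) (x j t))).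
Proof.
move=> h0; elim/last_ind: s => [|s i ih].
  by under [X in cvg_int _ _ X]funext do rewrite big_nil subrr; exact: cvg_int0.
have [_ _ cs] := cvg_prod t_ i s h0.
have := cvg_intD ih (cs _ 1 0 (linear0 i)); congr cvg_int; apply/funext => t.
rewrite -cats1 big_cat/= big_seq1 cos0 sin0; ring.
Qed.

Let cvg_ramp i c h : 0 < h -> cvg_int nu_ nu (fun t => ramp c h (x i t)).
Proof.
move=> h0; have := cvg_union (fun=> c) (h := fun=> h) [:: i] (fun=> h0); congr cvg_int.
by apply/funext => t; rewrite big_seq1; ring.
Qed.

(** The indicator is [1 - \prod_j (1 - r_j)] with [r_j] the indicator of [t_j < x_j]. Replacing
    these by ramps costs at most the sum of the trapezoids [D j], whose integrals [lin_thin] makes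
    small. *)
Lemma cvg_int_exceedance (t_ : 'I_k -> R) :
  cvg_int nu_ nu (\1_[set t | exists j, t_ j < x j t]).
Proof.
have UE t : (\1_[set t | exists j, t_ j < x j t] t : R) =
    1 - \prod_(j < k) (1 - (t_ j < x j t)%R%:R).
  rewrite indicE; case: (pselect (exists j, t_ j < x j t)) => [[j tj]|nt].
    rewrite mem_set; last by exists j.
    by rewrite (bigD1 j)//= tj subrr mul0r subr0.
  rewrite memNset// big1 ?subrr// => j _.
  by case: ltrP => [tj|_]; [exfalso; apply: nt; exists j|rewrite subr0].
apply: cvg_int_approx.
  apply: measurable_indic.
  rewrite (_ : [set t | _] = \bigcup_(j in [set: 'I_k]) (x j @^-1` `]t_ j, +oo[)).
    by apply: fin_bigcup_measurable => // j _; rewrite -[_ @^-1` _]setTI; exact: mx.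
  apply/seteqP; split=> [t [j tj]|t [j _]]; [exists j => //|move=> tj; exists j].
    by rewrite /= in_itv/= andbT.
  by move: tj; rewrite /= in_itv/= andbT.
move=> e e0.
have e1 : 0 < e / k.+1%:R by rewrite divr_gt0.
have /choice[h hP] : forall j, exists h, 0 < h /\
    \int[nu]_t (ramp (t_ j - h) h (x j t) - ramp (t_ j + h) h (x j t)) < e / k.+1%:R.
  by move=> j; have [h ? ?] := lin_thin j (t_ j) e1; exists h.
pose D j t := ramp (t_ j - h j) (h j) (x j t) - ramp (t_ j + h j) (h j) (x j t).
have cD j : cvg_int nu_ nu (D j).
  by apply: cvg_intB; apply: cvg_ramp; case: (hP j).
have h0 j : 0 < h j by case: (hP j).
exists (fun t => 1 - \prod_(j < k) (1 - ramp (t_ j) (h j) (x j t))).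
exists (fun t => \sum_(j < k) D j t); split.
- exact: cvg_union.
- apply: cvg_int_le.
  + by move=> t; rewrite sumr_ge0// => j _; apply: le_trans (indic_ramp_le _ _ (h0 j)).
  + exact: cvg_int_sum.
  + rewrite Rintegral_sum; last by move=> j; case: (cD j).
    apply: (@le_lt_trans _ _ (\sum_(j < k) e / k.+1%:R)).
      by apply: ler_sum => j _; rewrite ltW//; case: (hP j).
    rewrite sumr_const card_ord -[_ *+ k]mulr_natl mulrCA gtr_pMr// ltr_pdivrMr//.
    by rewrite mul1r ltr_nat.
- move=> t; rewrite UE opprB addrC addrA subrK.
  apply: le_trans (prodB_le _ _ _) _ => [j|j|].
  + rewrite subr_ge0 gerBl ramp_ge0 ?ramp_le1//.
  + by case: (t_ j < x j t)%R; rewrite ?subrr ?subr0 ?lexx ?ler01.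
  apply: ler_sum => j _.
  rewrite (_ : _ - _ = (t_ j < x j t)%R%:R - ramp (t_ j) (h j) (x j t)); last by ring.
  exact: indic_ramp_le.
Qed.

End half_spaces.

(** * Moments from tail bounds *)

Section moments_from_tails.
Context d (T : measurableType d) (R : realType).

Lemma measurable_gtr (v : T -> R) z : measurable_fun setT v ->
  measurable [set t | z < v t].
Proof.
move=> mv; rewrite (_ : [set t | _] = v @^-1` `]z, +oo[).
  by rewrite -[_ @^-1` _]setTI; exact: mv.
by apply/seteqP; split=> t /=; rewrite in_itv/= andbT.
Qed.

Lemma exists_step (a : nat -> R) z : a 0%N < z -> (exists n, z <= a n) ->
  exists j, a j < z <= a j.+1.
Proof.
move=> a0 [n]; elim: n => [|n ih] zn; first by rewrite leNgt a0 in zn.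
by have [/ih//|an] := lerP z (a n); exists n; rewrite an zn.
Qed.

(** On the layer [a j < v <= a (j+1)], [f] is at most [M j] times the indicator of the whole
    superlevel set [a j < v]; the budgets [e / 2^(j+1)] add up to [e]. *)
Lemma integral_le_dyadic (m : {measure set T -> \bar R}) (v f : T -> R)
    (a M : nat -> R) (e : R) :
  measurable_fun setT v -> measurable_fun setT f -> (forall t, 0 <= f t) ->
  (forall z, exists n, z <= a n) -> (forall j, 0 <= M j) -> 0 <= e ->
  (forall t, v t <= a 0%N -> f t = 0) ->
  (forall t j, a j < v t <= a j.+1 -> f t <= M j) ->
  (forall j, ((M j)%:E * m [set t | (a j < v t)%R] <= (e / (2 ^ j.+1)%:R)%:E)%E) ->
  (\int[m]_t (f t)%:E <= e%:E)%E.
Proof.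
move=> mv mf f0 a_oo M0 e0 fa fM Me.
have mE j := measurable_gtr (a j) mv.
pose g j t : \bar R := ((M j)%:E * (\1_[set t | a j < v t] t)%:E)%E.
have g0 j t : (0 <= g j t)%E by rewrite mule_ge0// lee_fin// indicE.
have mg j : measurable_fun setT (g j).
  apply: emeasurable_funM; first exact: measurable_cst.
  by apply/measurable_EFinP; exact: measurable_indic.
apply: (@le_trans _ _ (\int[m]_t (\sum_(0 <= j <oo) g j t))%E).
  apply: ge0_le_integral => //.
  - by move=> t _; rewrite lee_fin.
  - exact/measurable_EFinP.
  - by apply: ge0_emeasurable_sum => //.
  - move=> t _; have [/fa->|vt] := lerP (v t) (a 0%N); first exact: nneseries_ge0.
    have [j jP] := exists_step vt (a_oo (v t)).
    apply: (@le_trans _ _ (g j t)).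
      rewrite /g indicE mem_set; last by case/andP: jP.
      by rewrite mule1 lee_fin fM.
    apply: (@le_trans _ _ (\sum_(0 <= i < j.+1) g i t)%E).
      by rewrite big_nat_recr//= leeDr// sume_ge0.
    exact: nneseries_lim_ge.
rewrite integral_nneseries//.
apply: le_trans (epsilon_trick0 xpredT e0).
apply: lee_nneseries => [j _ _|j _]; first exact: integral_ge0.
apply: le_trans (Me j).
by rewrite ge0_integralZl_EFin// ?integral_indic// ?setIT//; apply/measurable_EFinP.
Qed.

(** Dyadic layers [2^(J+j)]. A tail of order [q+2], one more than the power integrated, leaves a
    factor [2^-(J+j)] in each layer. *)
Lemma tail_moment_le (m : {measure set T -> \bar R}) (v : T -> R) (C : R) q J :
  measurable_fun setT v -> 0 <= C ->
  (forall z, 1 <= z -> (m [set t | (z < v t)%R] <= (C * z ^- q.+2)%:E)%E) ->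
  (\int[m]_t (if 2 ^+ J < v t then pos (v t) ^+ q.+1 else 0)%:E
     <= (C * 2 ^+ q.+2 / 2 ^+ J)%:E)%E.
Proof.
move=> mv C0 tail.
pose a j : R := 2 ^+ (J + j).
have a1 j : 1 <= a j by rewrite exprn_ege1// ler1n.
have a0 j : 0 < a j by exact: lt_le_trans (a1 j).
have mi : measurable_fun setT (fun t => if 2 ^+ J < v t then pos (v t) ^+ q.+1 else 0).
  apply: measurable_fun_ifT => //.
    exact: measurable_fun_ltr.
  by apply: measurable_funX; exact: measurable_pos.
apply: (@integral_le_dyadic m v _ a (fun j => a j.+1 ^+ q.+1)) => //.
- by move=> t; case: ifP => // _; rewrite exprn_ge0// pos_ge0.
- move=> z; exists (Num.truncn z).+1.
  apply: (@le_trans _ _ (Num.truncn z).+1%:R); first by rewrite ltW// truncnS_gt.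
  by rewrite /a -natrX ler_nat (leq_trans (ltnW (ltn_expl _ (ltnSn 1))))// leq_exp2l// leq_addl.
- by move=> j; rewrite exprn_ge0// ltW.
- by rewrite divr_ge0 ?exprn_ge0// mulr_ge0 ?exprn_ge0.
- by move=> t; rewrite /a addn0 leNgt => /negbTE ->.
- move=> t j /andP[aj ja].
  rewrite (le_lt_trans _ aj); last by rewrite ler_eXn2l ?ltr1n// leq_addr.
  by rewrite lerXn2r ?nnegrE ?pos_ge0 ?(ltW (a0 _))// pos_id// ltW// (lt_trans (a0 j)).
- move=> j; apply: (@le_trans _ _ ((a j.+1 ^+ q.+1)%:E * (C * a j ^- q.+2)%:E)%E).
    by rewrite lee_pmul2l ?tail// lte_fin exprn_gt0.
  rewrite -EFinM lee_fin le_eqVlt; apply/orP; left; apply/eqP.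
  have aS : a j.+1 = 2 * a j by rewrite /a addnS exprS.
  rewrite aS exprMn natrX (exprS 2 j) (exprS 2 q.+1) (exprS (a j) q.+1).
  have : a j ^+ q.+1 != 0 by rewrite expf_neq0// gt_eqF.
  have : (2 : R) ^+ J != 0 by rewrite expf_neq0.
  have : (2 : R) ^+ j != 0 by rewrite expf_neq0.
  rewrite (_ : a j = 2 ^+ J * 2 ^+ j); last by rewrite -exprD.
  move: (((2 : R) ^+ J * 2 ^+ j) ^+ q.+1) ((2 : R) ^+ J) ((2 : R) ^+ j) ((2 : R) ^+ q.+1) => Y x y z y0 x0 Y0.
  by field; rewrite x0 y0 Y0.
Qed.

(** Half of the exponential decay is spent on [x^(q+1) <= 2^(q+1) (q+1)! exp (x / 2)], the origin of
    the powers of 2. On layers of width 2 there remains [exp (1 - j)], and [exp (- j) <= 2^-j]. *)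
Lemma exp_moment_le (m : {measure set T -> \bar R}) (v : T -> R) (C : R) q :
  measurable_fun setT v -> 0 <= C ->
  (forall z, 0 <= z -> (m [set t | (z < v t)%R] <= (C * expR (- z))%:E)%E) ->
  (\int[m]_t (pos (v t) ^+ q.+1)%:E
     <= ((C * expR 1 * 2) * 2 ^+ q.+1 * (q.+1)`!%:R)%:E)%E.
Proof.
move=> mv C0 tail.
set B : R := 2 ^+ q.+1 * (q.+1)`!%:R.
have B0 : 0 <= B by rewrite mulr_ge0// exprn_ge0.
apply: (@integral_le_dyadic m v _ (fun j => 2 * j%:R) (fun j => B * expR j.+1%:R)) => //.
- by apply: measurable_funX; exact: measurable_pos.
- by move=> t; rewrite exprn_ge0// pos_ge0.
- move=> z; exists (Num.truncn z).+1.
  apply: (@le_trans _ _ (Num.truncn z).+1%:R); first by rewrite ltW// truncnS_gt.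
  by rewrite ler_peMl// ler1n.
- by move=> j; rewrite mulr_ge0// expR_ge0.
- by rewrite -mulrA -/B !mulr_ge0// expR_ge0.
- by move=> t; rewrite mulr0 => v0; rewrite pos_eq0// expr0n.
- move=> t j /andP[jv vj].
  have v0 : 0 <= v t by rewrite (le_trans _ (ltW jv))// mulr_ge0.
  rewrite pos_id//.
  apply: (@le_trans _ _ (B * expR (v t / 2))).
    have := @expR_ge1Dxn R (v t / 2) q.
    rewrite divr_ge0// => /(_ isT) H.
    have {}H : (v t / 2) ^+ q.+1 / (q.+1)`!%:R <= expR (v t / 2).
      by apply: le_trans H; rewrite lerDr.
    have f0 : 0 < (q.+1)`!%:R :> R by rewrite ltr0n fact_gt0.
    move: H; rewrite ler_pdivrMr// expr_div_n ler_pdivrMr ?exprn_gt0// => H.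
    by rewrite (le_trans H)// /B le_eqVlt; apply/orP; left; apply/eqP; ring.
  by rewrite ler_wpM2l// ler_expR ler_pdivrMr// mulrC.
- move=> j; apply: (@le_trans _ _ ((B * expR j.+1%:R)%:E * (C * expR (- (2 * j%:R)))%:E)%E).
    apply: lee_wpmul2l; first by rewrite lee_fin mulr_ge0// expR_ge0.
    by apply: tail; rewrite mulr_ge0.
  rewrite -EFinM lee_fin.
  have -> : B * expR j.+1%:R * (C * expR (- (2 * j%:R))) =
     (C * expR 1 * B) * expR (- j%:R).
    rewrite -natr1 expRD mulrC (_ : - (2 * j%:R) = - j%:R + - j%:R); last by ring.
    rewrite expRD !expRN; have := expR_gt0 (j%:R : R); move: (expR _) => x x0.
    by field; rewrite gt_eqF.
  rewrite (_ : _ / _ = C * expR 1 * B * (2 / (2 ^ j.+1)%:R)); last by rewrite /B; ring.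
  rewrite ler_wpM2l//; first by rewrite mulr_ge0// mulr_ge0// expR_ge0.
  rewrite natrX exprS invfM mulrA divff// mul1r expRN lef_pV2 ?posrE ?expR_gt0 ?exprn_gt0//.
  rewrite -[X in expR X]mul1r expRM_natr lerXn2r ?nnegrE ?expR_ge0//.
  by have := expR_ge1Dx (1 : R).
Qed.

End moments_from_tails.

Lemma indic_pred (T : Type) (R : pzRingType) (P : pred T) (t : T) :
  (\1_[set t | P t] t : R) = (P t)%:R.
Proof. by rewrite indicE; congr (nat_of_bool _)%:R; apply/idP/idP; rewrite inE. Qed.

Lemma exists_expr2_gt (R : realType) (y : R) : exists J : nat, y < 2 ^+ J.
Proof.
exists (Num.truncn y).+1; apply: lt_le_trans (truncnS_gt _) _.
by rewrite -natrX ler_nat ltnW// ltn_expl.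
Qed.

Lemma subrX_le (R : realType) q (x y Z : R) : 0 <= y -> y <= x -> x <= Z ->
  x ^+ q.+1 - y ^+ q.+1 <= q.+1%:R * Z ^+ q * (x - y).
Proof.
move=> y0 yx xZ; elim: q => [|q ih]; first by rewrite !expr1 expr0 !mul1r.
have x0 := le_trans y0 yx.
rewrite (_ : _ - _ = x * (x ^+ q.+1 - y ^+ q.+1) + (x - y) * y ^+ q.+1); last first.
  by rewrite (exprS x q.+1) (exprS y q.+1); ring.
rewrite (_ : _ * (x - y) = Z * (q.+1%:R * Z ^+ q * (x - y)) + (x - y) * Z ^+ q.+1); last first.
  by rewrite -(natr1 q.+1) (exprS Z q); ring.
apply: lerD; first by rewrite ler_pM// subr_ge0 lerXn2r ?nnegrE.
by rewrite ler_wpM2l ?subr_ge0// lerXn2r ?nnegrE ?(le_trans y0)// (le_trans yx).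
Qed.

Lemma sum_step_telescope (R : realType) (b : nat -> R) (P : pred nat) j M :
  (j <= M)%N -> (forall m, (m < j)%N -> P m) ->
  (forall m, (j <= m)%N -> ~~ P m) ->
  \sum_(m < M) (b m.+1 - b m) * (P m)%:R = b j - b 0%N.
Proof.
move=> jM Plt Pge.
rewrite -(big_mkord xpredT (fun m => (b m.+1 - b m) * (P m)%:R)) (@big_cat_nat _ _ _ j)//=.
rewrite [X in _ + X]big1_seq ?addr0; last first.
  by move=> m /andP[_]; rewrite mem_index_iota => /andP[/Pge/negbTE -> _]; rewrite mulr0.
rewrite -telescope_sumr//; apply: eq_big_nat => m /andP[_ mj].
by rewrite Plt// mulr1.
Qed.

Section powers.
Context d (T : measurableType d) (R : realType).
Variables (nu_ : nat -> {measure set T -> \bar R}) (nu : {measure set T -> \bar R}).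

(** Below a level [Z] the power is approximated by a staircase of mesh [h], whose integral is a
    combination of masses [z < v]; the error [K h] there is charged to the finite mass of [0 < v].
    Above [Z] the polynomial tails, common to [nu] and all late [nu_ n], make the remaining moment
    small. *)
Lemma cvg_int_pow_of_tails (v : T -> R) (C0 : R) q :
  measurable_fun setT v -> 0 <= C0 ->
  (forall z, 0 <= z -> cvg_int nu_ nu (\1_[set t | z < v t])) ->
  (forall p, exists2 C : R, 0 <= C & \forall n \near \oo, forall z, 1 <= z ->
    (nu_ n [set t | (z < v t)%R] <= (C * z ^- p)%:E)%E) ->
  (forall z, 0 <= z -> (nu [set t | (z < v t)%R] <= (C0 * expR (- z))%:E)%E) ->
  cvg_int nu_ nu (fun t => pos (v t) ^+ q.+1).
Proof.
move=> mv C00 cv tail nutail.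
have [C1 C10 tail1] := tail q.+2.
have [C2 C20 tail2] : exists2 C : R, 0 <= C & forall z, 1 <= z ->
    (nu [set t | (z < v t)%R] <= (C * z ^- q.+2)%:E)%E.
  exists (C0 * (q.+2)`!%:R); first by rewrite mulr_ge0.
  move=> z z1; have z0 : 0 < z by exact: lt_le_trans z1.
  apply: le_trans (nutail z (ltW z0)) _.
  rewrite lee_fin -mulrA ler_wpM2l// expRN -[leRHS]invrK lef_pV2 ?posrE ?expR_gt0//; last first.
    by rewrite invr_gt0 mulr_gt0 ?invr_gt0 ?exprn_gt0// ltr0n fact_gt0.
  rewrite invfM invrK mulrC.
  by apply: le_trans (expR_ge1Dxn q.+1 (ltW z0)); rewrite lerDr.
pose C := C1 + C2.
have C_0 : 0 <= C by rewrite addr_ge0.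
have widen (C' : R) (m : {measure set T -> \bar R}) : C' <= C -> (forall z, 1 <= z ->
    (m [set t | (z < v t)%R] <= (C' * z ^- q.+2)%:E)%E) -> forall z, 1 <= z ->
    (m [set t | (z < v t)%R] <= (C * z ^- q.+2)%:E)%E.
  move=> CC H z z1; apply: le_trans (H z z1) _.
  by rewrite lee_fin ler_wpM2r// invr_ge0 exprn_ge0// (le_trans _ z1).
apply: cvg_int_approx; first by apply: measurable_funX; exact: measurable_pos.
move=> e e0.
have [J Je] : exists J : nat, C * 2 ^+ q.+2 / 2 ^+ J < e / 2.
  have [J] := exists_expr2_gt (C * 2 ^+ q.+2 / (e / 2)); exists J.
  by move: p; rewrite !ltr_pdivrMr ?divr_gt0 ?exprn_gt0// (mulrC (e / 2)).
pose Z : R := 2 ^+ J.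
have Z0 : 0 < Z by rewrite exprn_gt0.
pose I0 := \int[nu]_t (\1_[set t | 0 < v t] t).
have I00 : 0 <= I0 by apply: Rintegral_ge0 => t _; rewrite indicE.
pose K : R := q.+1%:R * Z ^+ q.
have K0 : 0 <= K by rewrite mulr_ge0// exprn_ge0// ltW.
have [M M0 MP] : exists2 M : nat, (0 < M)%N & K * (Z / M%:R) * I0 < e / 2.
  pose Y := K * Z * I0 / (e / 2).
  exists (Num.truncn Y).+1 => //.
  have : Y < (Num.truncn Y).+1%:R by rewrite truncnS_gt.
  rewrite {1}/Y ltr_pdivrMr ?divr_gt0// => H.
  rewrite mulrA mulrAC ltr_pdivrMr//; lra.
pose h := Z / M%:R.
have h0 : 0 < h by rewrite divr_gt0// ltr0n.
have MZ : M%:R * h = Z by rewrite /h mulrC divfK// pnatr_eq0 -lt0n.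
(* The sum telescopes: it equals [((j+1) h)^(q+1)] when [j h < v <= (j+1) h] with [j < M], and
   [Z^(q+1)] beyond [Z = M h]. *)
pose g t := \sum_(m < M) ((m.+1%:R * h) ^+ q.+1 - (m%:R * h) ^+ q.+1) * \1_[set t | m%:R * h < v t] t.
exists g, (fun t => K * h * \1_[set t | 0 < v t] t + (if Z < v t then pos (v t) ^+ q.+1 else 0)).
have mi : measurable_fun setT (fun t => if Z < v t then pos (v t) ^+ q.+1 else 0).
  apply: measurable_fun_ifT => //.
    exact: measurable_fun_ltr.
  by apply: measurable_funX; exact: measurable_pos.
have i0 t : 0 <= (if Z < v t then pos (v t) ^+ q.+1 else 0).
  by case: ifP => // _; rewrite exprn_ge0// pos_ge0.
have Kh0 : 0 <= K * h by rewrite mulr_ge0 ?(ltW h0).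
have Ki t : 0 <= K * h * \1_[set t | 0 < v t] t by rewrite mulr_ge0// indicE.
have cK : cvg_int nu_ nu (fun t => K * h * \1_[set t | 0 < v t] t).
  by apply: cvg_intZ; exact: cv.
have [mK nK iK] : int_le nu_ nu (fun t => K * h * \1_[set t | 0 < v t] t) (e / 2).
  apply: cvg_int_le => //.
  by rewrite RintegralZl//; case: (cv 0 (lexx _)).
split.
- apply: cvg_int_sum => m; apply: cvg_intZ; apply: cv.
  by rewrite mulr_ge0// ltW.
- have step (m : {measure set T -> \bar R}) : (\int[m]_t (K * h * \1_[set t | 0 < v t] t)%:E <= (e / 2)%:E)%E ->
    (forall z, 1 <= z -> (m [set t | (z < v t)%R] <= (C * z ^- q.+2)%:E)%E) ->
    (\int[m]_t (K * h * \1_[set t | 0 < v t] t + (if Z < v t then pos (v t) ^+ q.+1 else 0))%:E <= e%:E)%E.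
    move=> H1 H2.
    under eq_integral do rewrite EFinD.
    rewrite ge0_integralD//; last 4 first.
    + by move=> t _; rewrite lee_fin.
    + exact/measurable_EFinP.
    + by move=> t _; rewrite lee_fin.
    + exact/measurable_EFinP.
    have -> : e = e / 2 + e / 2 by field.
    rewrite EFinD leeD//.
    by apply: (le_trans (tail_moment_le J mv C_0 H2)); rewrite lee_fin ltW.
  split.
  + exact: measurable_funD.
  + near=> n; apply: step; first by near: n.
    apply: (widen C1); first by rewrite lerDl.
    by near: n.
  + by apply: step => //; apply: (widen C2) => //; rewrite lerDr.
- move=> t.
  have gE : g t = \sum_(m < M) ((m.+1%:R * h) ^+ q.+1 - (m%:R * h) ^+ q.+1) * (m%:R * h < v t)%R%:R.
    by apply: eq_bigr => m _; rewrite (indic_pred _ (fun t => m%:R * h < v t)).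
  have gj j : (j <= M)%N -> (forall m, (m < j)%N -> m%:R * h < v t) ->
      (forall m, (j <= m)%N -> v t <= m%:R * h) -> g t = (j%:R * h) ^+ q.+1.
    move=> jM lo hi.
    rewrite gE (sum_step_telescope (fun m => (m%:R * h) ^+ q.+1) (P := fun m => m%:R * h < v t) jM)//.
      by rewrite mul0r (expr0n _ q.+1) subr0.
    by move=> m jm; rewrite -leNgt hi.
  have mulh (i j : nat) : (i <= j)%N -> i%:R * h <= j%:R * h.
    by move=> ij; rewrite ler_pM2r// ler_nat.
  have [v0|v0] := lerP (v t) 0.
    rewrite (gj 0%N)//; last by move=> m _; rewrite (le_trans v0)// mulr_ge0// ltW.
    rewrite mul0r pos_eq0// subrr normr0.
    by apply: addr_ge0 => //; rewrite ltNge (le_trans v0 (ltW Z0)).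
  rewrite indicE mem_set// mulr1 pos_id ?(ltW v0)//.
  have [vZ|vZ] := ltrP Z (v t).
    have -> : g t = Z ^+ q.+1.
      rewrite gE -MZ (eq_bigr (fun m : 'I_M => ((m.+1%:R * h) ^+ q.+1 - (m%:R * h) ^+ q.+1) * (m < M)%N%:R)).
        rewrite (sum_step_telescope (fun m => (m%:R * h) ^+ q.+1) (P := fun m => (m < M)%N) (leqnn M))//.
          by rewrite mul0r (expr0n _ q.+1) subr0.
        by move=> m; rewrite leqNgt.
      move=> m _; rewrite ltn_ord (_ : m%:R * h < v t)//.
      by apply: le_lt_trans vZ; rewrite -MZ mulh// ltnW.
    rewrite ger0_norm; last by rewrite subr_ge0 lerXn2r ?nnegrE ?(ltW Z0) ?(ltW v0) ?(ltW vZ).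
    by have : 0 <= Z ^+ q.+1 by [rewrite exprn_ge0 ?ltW]; lra.
  have [||j /andP[jv vj]] := @exists_step R (fun j => j%:R * h) (v t).
    - by rewrite mul0r.
    - by exists M; rewrite MZ.
  have jM : (j < M)%N.
    rewrite ltnNge; apply/negP => /mulh; rewrite MZ => Zj.
    by have := lt_le_trans jv (le_trans vZ Zj); rewrite ltxx.
  rewrite (gj j.+1)//; last 2 first.
    - by move=> m mj; apply: le_lt_trans jv; exact: mulh.
    - by move=> m mj; apply: le_trans vj _; exact: mulh.
  rewrite addr0 distrC ger0_norm; last first.
    by rewrite subr_ge0 lerXn2r ?nnegrE ?(ltW v0)// (le_trans _ vj) ?(ltW v0).
  apply: (@le_trans _ _ ((j.+1%:R * h) ^+ q.+1 - (j%:R * h) ^+ q.+1)).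
    by rewrite lerD2l lerN2 lerXn2r ?nnegrE ?(ltW v0) ?(ltW jv)// mulr_ge0// ltW.
  apply: le_trans (@subrX_le _ q _ _ Z _ _ _) _.
  - by rewrite mulr_ge0// ltW.
  - exact: mulh.
  - by rewrite -MZ mulh.
  - by rewrite -/K ler_wpM2l// -mulrBl -natrB// subSnn mul1r.
Unshelve. all: by end_near. Qed.

End powers.

(** * Gumbel tails *)

Section gumbel_tail.
Context (R : realType) (omega : \bar R).

(** Eventually as [t] increases to [omega], for finite and infinite endpoints alike. The explicit
    threshold lets a property be iterated along points moving to the right. *)
Definition near_end (P : R -> Prop) := exists T : R, (T%:E < omega)%E /\
  forall t, T < t -> (t%:E < omega)%E -> P t.

Lemma near_endW (P Q : R -> Prop) : (forall t, (t%:E < omega)%E -> P t -> Q t) ->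
  near_end P -> near_end Q.
Proof.
by move=> PQ [T [To HT]]; exists T; split=> // t Tt to; apply: PQ => //; exact: HT.
Qed.

Lemma near_endI (P Q : R -> Prop) : near_end P -> near_end Q ->
  near_end (fun t => P t /\ Q t).
Proof.
move=> [T [To HT]] [T' [To' HT']]; exists (Num.max T T'); split.
  by rewrite /Num.max; case: ifP.
by move=> t; rewrite gt_max => /andP[? ?] to; split; [exact: HT|exact: HT'].
Qed.

Lemma near_end_gt (T : R) : (T%:E < omega)%E -> near_end (fun t => T < t).
Proof. by move=> To; exists T; split. Qed.

Lemma ex_lt_end (T : R) : (T%:E < omega)%E -> exists2 t, T < t & (t%:E < omega)%E.
Proof.
case: omega => [r| |]; last by rewrite ltNge leNye.
  rewrite lte_fin => Tr; exists ((T + r) / 2); rewrite ?lte_fin; lra.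
by move=> _; exists (T + 1); rewrite ?ltrDl// ltry.
Qed.

Lemma near_end_ex (P : R -> Prop) : near_end P -> exists2 t, (t%:E < omega)%E & P t.
Proof.
by move=> [T [/[dup] /ex_lt_end[t Tt to] _ HT]]; exists t => //; exact: HT.
Qed.

(* [S] is the tail of a law in GMDA(1/u) with upper endpoint [omega]; the limit of ratios is
   written with a multiplicative error. *)
Definition gumbel_tail (u S : R -> R) :=
  [/\ (0 < omega)%E, forall t, (t%:E < omega)%E -> 0 < u t,
    forall s t, s <= t -> S t <= S s,
    (forall t, (t%:E < omega)%E -> 0 < S t) /\ (forall t, (omega <= t%:E)%E -> S t = 0)
   & forall x e, 0 < e -> near_end (fun t =>
      expR (- x - e) * S t <= S (t + x * u t) <= expR (- x + e) * S t)].

Lemma gumbel_tail_ratio (u S : R -> R) x e : 0 < e ->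
  (forall t, (t%:E < omega)%E -> 0 < S t) ->
  (forall e, 0 < e -> near_end (fun t => `|S (t + x * u t) / S t - expR (- x)| <= e)) ->
  near_end (fun t => expR (- x - e) * S t <= S (t + x * u t) <= expR (- x + e) * S t).
Proof.
move=> e0 S0 H.
pose r := Num.min (expR (- x) - expR (- x - e)) (expR (- x + e) - expR (- x)).
have r0 : 0 < r by rewrite lt_min !subr_gt0 !ltr_expR; apply/andP; split; lra.
have := H r r0.
apply: near_endW => t /S0 St; rewrite ler_norml => /andP[h1 h2].
have : r <= expR (- x) - expR (- x - e) by rewrite ge_min lexx.
have : r <= expR (- x + e) - expR (- x) by rewrite ge_min lexx orbT.
by move=> ? ?; apply/andP; split; [rewrite -ler_pdivlMr//|rewrite -ler_pdivrMr//]; lra.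
Qed.

Variables (u S : R -> R).
Hypothesis gS : gumbel_tail u S.

Let omega0 : (0 < omega)%E. Proof. by case: gS. Qed.

Let u0 t : (t%:E < omega)%E -> 0 < u t. Proof. by case: gS => _ + _ _ _; apply. Qed.

Let Smono s t : s <= t -> S t <= S s. Proof. by case: gS => _ _ + _ _; apply. Qed.

Let S0 t : (t%:E < omega)%E -> 0 < S t. Proof. by case: gS => _ _ _ [+ _] _; apply. Qed.

Let S_gt0 t : 0 < S t -> (t%:E < omega)%E.
Proof.
case: gS => _ _ _ [_ Sz] _ St; rewrite ltNge; apply/negP => /Sz St0.
by rewrite St0 ltxx in St.
Qed.

Let S_lt s t : S t < S s -> s < t.
Proof. by move=> St; rewrite ltNge; apply/negP => /Smono; rewrite leNgt St. Qed.

Lemma near_end_ratio x e : 0 < e -> near_end (fun t =>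
  expR (- x - e) * S t <= S (t + x * u t) <= expR (- x + e) * S t).
Proof. by move=> e0; case: gS => _ _ _ _; apply. Qed.

Lemma near_end_lt_end x : near_end (fun t => ((t + x * u t)%:E < omega)%E).
Proof.
apply: near_endW (near_end_ratio x ltr01) => t /S0 St /andP[h _].
by apply: S_gt0; apply: lt_le_trans h; rewrite mulr_gt0// expR_gt0.
Qed.

(** No mass stays at the endpoint. Otherwise the infimum [l] of [S] below [omega] is positive; for
    [t] with [S t < 2 l], the ratio at [x = 2] gives [S (t + 2 u t) <= exp (- 3 / 2) S t < l],
    although [t + 2 u t] is still below [omega]. *)
Lemma near_end_S_lt e : 0 < e -> near_end (fun t => S t < e).
Proof.
move=> e0; apply: contrapT => H.
have Se t : (t%:E < omega)%E -> e <= S t.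
  move=> to; rewrite leNgt; apply/negP => Ste; apply: H; exists t; split=> // s ts so.
  by apply: le_lt_trans Ste; exact/Smono/ltW.
pose E := [set S t | t in [set t | (t%:E < omega)%E]].
have hE : has_inf E.
  split; first by exists (S 0), 0 => //; exact: omega0.
  by exists e => _ [t /= to <-]; exact: Se.
pose l := inf E.
have l0 : 0 < l.
  by apply: lt_le_trans e0 _; apply: lb_le_inf; [case: hE|move=> _ [t to <-]; exact: Se].
have [_ [t0 /= t0o <-] St0] : exists2 y, E y & y < l + l by apply: inf_adherent.
have [t to [[/andP[h1 h2] tt0] h3]] := near_end_ex (near_endI (near_endI
   (@near_end_ratio 2 (1/2) (divr_gt0 ltr01 (ltr0Sn _ 1))) (near_end_gt t0o)) (near_end_lt_end 2)).
have : l <= S (t + 2 * u t) by apply: ge_inf; [case: hE|exists (t + 2 * u t)].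
have : S t < l + l by apply: le_lt_trans St0; exact/Smono/ltW.
have e2 : expR (- 2 + 1 / 2) <= 2^-1 :> R.
  rewrite (_ : - 2 + 1 / 2 = - (3 / 2)); last by field.
  rewrite expRN lef_pV2 ?posrE ?expR_gt0//.
  by apply: le_trans (expR_ge1Dx _); lra.
have := S0 to; nra.
Qed.

(** For negative [x] too, [t + x u t] approaches the endpoint: [S] there is at most
    [exp (1 - x) S t], which tends to 0, so monotonicity pushes the point past any threshold. *)
Lemma near_end_shift x (P : R -> Prop) : near_end P -> near_end (fun t => P (t + x * u t)).
Proof.
move=> [T [To HT]]; have [T' TT' To'] := ex_lt_end To.
have e0 : 0 < S T' / expR (- x + 1) by rewrite divr_gt0 ?expR_gt0 ?S0.
have := near_endI (near_endI (near_end_ratio x ltr01) (near_end_S_lt e0)) (near_end_lt_end x).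
apply: near_endW => t to [[/andP[_ h] St] so].
apply: HT => //; apply: lt_trans TT' _; apply: S_lt; apply: le_lt_trans h _.
by rewrite mulrC -ltr_pdivlMr// expR_gt0.
Qed.

(** [t - K u t] also approaches [omega], which is positive. *)
Lemma near_end_aux_small K : near_end (fun t => K * u t < t).
Proof.
apply: near_endW (near_end_shift (- K) (near_end_gt omega0)) => t _; lra.
Qed.

(** The auxiliary function is self-neglecting. With [s = t + x u t], the tail at [s + u s] is about
    [exp (- x - 1) S t], strictly between its values at [t + (x + 1 - e) u t] and
    [t + (x + 1 + e) u t]; as [S] is monotone, [s + u s] lies between these points. *)
Lemma near_end_aux_ratio x e : 0 < e -> near_end (fun t =>
  (1 - e) * u t <= u (t + x * u t) <= (1 + e) * u t).
Proof.
move=> e0; have e4 : 0 < e / 4 by rewrite divr_gt0.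
have := near_endI (near_endI (near_end_ratio x e4) (near_end_lt_end x))
  (near_endI (near_end_shift x (near_end_ratio 1 e4))
  (near_endI (near_end_ratio (x + 1 + e) e4) (near_end_ratio (x + 1 - e) e4))).
apply: near_endW => t to [[/andP[l1 h1] so] [/andP[l2 h2] [/andP[_ h3] /andP[l4 _]]]].
have ut := u0 to; have St := S0 to.
apply/andP; split; rewrite leNgt; apply/negP => us.
  have : S (t + (x + 1 - e) * u t) <= S (t + x * u t + 1 * u (t + x * u t)).
    by apply: Smono; nra.
  apply/negP; rewrite -ltNge; apply: le_lt_trans h2 _; apply: lt_le_trans l4.
  apply: (@le_lt_trans _ _ (expR (- 1 + e / 4) * (expR (- x + e / 4) * S t))).
    by rewrite ler_wpM2l ?expR_ge0.
  by rewrite mulrA -expRD ltr_pM2r// ltr_expR; lra.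
have : S (t + x * u t + 1 * u (t + x * u t)) <= S (t + (x + 1 + e) * u t).
  by apply: Smono; nra.
apply/negP; rewrite -ltNge; apply: le_lt_trans h3 _; apply: lt_le_trans l2.
apply: (@lt_le_trans _ _ (expR (- 1 - e / 4) * (expR (- x - e / 4) * S t))).
  by rewrite mulrA -expRD ltr_pM2r// ltr_expR; lra.
by rewrite ler_wpM2l ?expR_ge0.
Qed.

(** Iteration of [t |-> t + A u t]: each step at most doubles [u], so [j] steps move by at most
    [A (2^j - 1) u t], and divides [S] by at least [exp (A - 1) >= 2^p]. *)
Lemma near_end_geometric p : exists2 A, 0 < A & near_end (fun t => forall j,
  S (t + A * (2 ^+ j - 1) * u t) <= 2 ^- (p * j) * S t).
Proof.
pose A : R := 1 + (2 ^+ p).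
have A0 : 0 < A by rewrite ltr_pwDl// exprn_ge0.
exists A => //.
have [T [To HT]] := near_endI (near_endI (near_end_ratio A ltr01) (near_end_lt_end A))
   (near_end_aux_ratio A ltr01).
exists T; split=> // t Tt to j; elim: j t Tt to => [|j ih] t Tt to.
  by rewrite subrr mulr0 mul0r addr0 muln0 invr1 mul1r.
have ut := u0 to.
have [[/andP[_ h1] so] /andP[_ h2]] := HT t Tt to.
have Ts : T < t + A * u t by rewrite (lt_trans Tt)// ltrDl mulr_gt0.
have h3 := ih _ Ts so.
have tj : 0 <= 2 ^+ j - 1 :> R by rewrite subr_ge0 exprn_ege1// ler1n.
apply: (@le_trans _ _ (S (t + A * u t + A * (2 ^+ j - 1) * u (t + A * u t)))).
  apply: Smono; rewrite exprS.
  have : A * (2 ^+ j - 1) * u (t + A * u t) <= A * (2 ^+ j - 1) * ((1 + 1) * u t).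
    by rewrite ler_wpM2l// mulr_ge0// ltW.
  lra.
apply: le_trans h3 _; rewrite mulnS addnC exprD invfM -mulrA ler_wpM2l ?invr_ge0 ?exprn_ge0//.
apply: le_trans h1 _; rewrite ler_wpM2r ?(ltW (S0 to))//.
rewrite /A (_ : - _ + 1 = - (2 ^+ p)); last by ring.
rewrite expRN lef_pV2 ?posrE ?expR_gt0 ?exprn_gt0//.
by apply: le_trans (expR_ge1Dx _); rewrite lerDr.
Qed.

(** For [A (2^j - 1) < z <= A (2^(j+1) - 1)], the factor [2^-(p j)] is at most [(2 A / z)^p]. *)
Lemma near_end_poly p : exists2 C, 0 <= C & near_end (fun t => forall z, 1 <= z ->
  S (t + z * u t) <= C * z ^- p * S t).
Proof.
have [A A0 H] := near_end_geometric p.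
exists ((2 * A) ^+ p); first by rewrite exprn_ge0// mulr_ge0// ltW.
apply: near_endW H => t to H z z1.
have z0 : 0 < z by exact: lt_le_trans z1.
have [||j /andP[jz zj]] := @exists_step R (fun j => A * (2 ^+ j - 1)) z.
- by rewrite subrr mulr0.
- have [J zJ] := exists_expr2_gt (z / A + 1); exists J.
  by rewrite mulrC -ler_pdivrMr// lerBrDr ltW.
have ut := u0 to.
apply: (@le_trans _ _ (S (t + A * (2 ^+ j - 1) * u t))).
  by apply: Smono; rewrite lerD2l ler_pM2r// ltW.
apply: le_trans (H j) _; rewrite ler_wpM2r ?(ltW (S0 to))//.
rewrite mulnC exprM -expr_div_n -exprVn lerXn2r ?nnegrE ?invr_ge0 ?exprn_ge0//.
  by rewrite divr_ge0 ?mulr_ge0 ?(ltW A0) ?(ltW z0).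
rewrite -[leLHS]mul1r ler_pdivrMr ?exprn_gt0// mulrAC ler_pdivlMr// mul1r.
by move: zj; rewrite exprS; nra.
Qed.

Lemma near_end_all (I : eqType) (s : seq I) (P : I -> R -> Prop) :
  (forall i, near_end (P i)) -> near_end (fun t => forall i, i \in s -> P i t).
Proof.
move=> H; elim: s => [|i s ih].
  by exists 0; split=> //; exact: omega0.
apply: near_endW (near_endI (H i) ih) => t _ [Pi Ps] j.
by rewrite inE => /predU1P[->//|]; exact: Ps.
Qed.

(** Monotonicity makes pointwise convergence on a finite grid of mesh [e / 2] uniform on
    [[0, Y]]. *)
Lemma near_end_uniform Y e : 0 <= Y -> 0 < e -> near_end (fun t => forall y, 0 <= y <= Y ->
  expR (- y - e) * S t <= S (t + y * u t) <= expR (- y + e) * S t).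
Proof.
move=> Y0 e0; have e2 : 0 < e / 2 by rewrite divr_gt0.
pose N := (Num.truncn (Y / (e / 2))).+1.
have := near_end_all (iota 0 N.+1) (fun i => @near_end_ratio (i%:R * (e / 2)) _ e2).
apply: near_endW => t to H y /andP[y0 yY].
have ut := u0 to; have St := S0 to.
have [i [iN iy yi]] : exists i, [/\ (i < N)%N, i%:R * (e / 2) <= y & y <= i.+1%:R * (e / 2)].
  exists (Num.truncn (y / (e / 2))).
  have ye0 : 0 <= y / (e / 2) by rewrite divr_ge0// ltW.
  split.
  - rewrite /N ltnS; apply: le_truncn; rewrite ler_pM2r ?invr_gt0//.
  - by rewrite -ler_pdivlMr// truncn_le.
  - by rewrite -ler_pdivrMr// ltW// truncnS_gt.
have Hi := H i; have HSi := H i.+1.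
rewrite mem_iota/= add0n in Hi; rewrite mem_iota/= add0n in HSi.
have /andP[_ h1] := Hi (leqW iN); have /andP[h2 _] := HSi iN.
move: yi h2; rewrite -natr1 mulrDl mul1r => yi h2.
apply/andP; split.
  apply: (le_trans _ (le_trans h2 _)).
    by rewrite ler_pM2r// ler_expR; lra.
  by apply: Smono; rewrite lerD2l ler_pM2r.
apply: (@le_trans _ _ (S (t + i%:R * (e / 2) * u t))).
  by apply: Smono; rewrite lerD2l ler_pM2r.
apply: (le_trans h1); rewrite ler_pM2r// ler_expR; lra.
Qed.

End gumbel_tail.

(** * Tails at the normalising constants *)

Section quantiles.
Context (R : realType) (omega : \bar R) (u S : R -> R).
Hypothesis gS : gumbel_tail omega u S.
Let b (n : nat) := inf [set t | S t <= n%:R^-1].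
Let a (n : nat) := u (b n).

Let S0 t : (t%:E < omega)%E -> 0 < S t. Proof. by case: gS => _ _ _ [+ _] _; apply. Qed.

Let Smono s t : s <= t -> S t <= S s. Proof. by case: gS => _ _ + _ _; apply. Qed.

Let near_invr_lt e : 0 < e -> \forall n \near \oo, n%:R^-1 < e :> R.
Proof.
move=> e0; near=> n.
have n0 : 0 < n%:R :> R by rewrite ltr0n; near: n; exists 1%N.
rewrite -[ltRHS]invrK ltf_pV2 ?posrE ?invr_gt0//.
near: n; exists (Num.truncn e^-1).+1 => // n /= En.
by apply: lt_le_trans (truncnS_gt _) _; rewrite ler_nat.
Unshelve. all: by end_near. Qed.

(** [b n] approaches [omega] because [S] is positive below it, and stays strictly below because [S]
    takes values under [1 / n] there. *)
Lemma near_quantile (P : R -> Prop) : near_end omega P ->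
  \forall n \near \oo, ((b n)%:E < omega)%E /\ P (b n).
Proof.
move=> [T [To HT]].
have [T' TT' To'] := ex_lt_end To.
near=> n.
have ST' : n%:R^-1 < S T' by near: n; apply: near_invr_lt; exact: S0.
have n0 : 0 < n%:R :> R by rewrite ltr0n; near: n; exists 1%N.
have lb t : S t <= n%:R^-1 -> T' <= t.
  move=> St; rewrite leNgt; apply/negP => /ltW/Smono.
  by rewrite leNgt (le_lt_trans St ST').
have nV0 : 0 < n%:R^-1 :> R by rewrite invr_gt0.
have [t to St] := near_end_ex (near_end_S_lt gS nV0).
have hE : has_inf [set t | S t <= n%:R^-1].
  by split; [exists t; exact: ltW|exists T' => s; exact: lb].
have bo : ((b n)%:E < omega)%E.
  apply: le_lt_trans to; rewrite lee_fin; apply: ge_inf; first by case: hE.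
  exact: ltW.
split=> //; apply: HT => //; apply: lt_le_trans TT' _.
by apply: lb_le_inf; [case: hE|move=> s; exact: lb].
Unshelve. all: by end_near. Qed.

(** [S] may jump at [b n], so [n S (b n)] need not be 1. But [1 / n] lies between the values of [S]
    at [b n + (e / 2) u (b n)] and [b n - (e / 2) u (b n)], which are within factors [exp (- e)] and
    [exp e] of [S (b n)]. *)
Lemma quantile_ratio e : 0 < e -> \forall n \near \oo,
  expR (- e) <= n%:R * S (b n) <= expR e.
Proof.
move=> e0; have e2 : 0 < e / 2 by rewrite divr_gt0.
have := near_quantile (near_endI (near_end_ratio gS (- (e / 2)) e2) (near_end_ratio gS (e / 2) e2)).
have S00 : 0 < S 0 by apply: S0; case: gS.
move=> H; near=> n.
have [bo [/andP[_ h1] /andP[h2 _]]] : ((b n)%:E < omega)%E /\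
  (expR (- - (e / 2) - e / 2) * S (b n) <= S (b n + - (e / 2) * u (b n)) <= expR (- - (e / 2) + e / 2) * S (b n) /\
   expR (- (e / 2) - e / 2) * S (b n) <= S (b n + (e / 2) * u (b n)) <= expR (- (e / 2) + e / 2) * S (b n)).
  by near: n.
have n0 : 0 < n%:R :> R by rewrite ltr0n; near: n; exists 1%N.
have ub : 0 < u (b n) by case: gS => _ + _ _ _; apply.
have Sn0 : n%:R^-1 < S 0 by near: n; exact: near_invr_lt.
have hE : has_lbound [set t | S t <= n%:R^-1].
  exists 0 => t /= St; rewrite leNgt; apply/negP => /ltW/Smono.
  by rewrite leNgt (le_lt_trans St Sn0).
have nV0 : 0 < n%:R^-1 :> R by rewrite invr_gt0.
have [t to St] := near_end_ex (near_end_S_lt gS nV0).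
apply/andP; split.
  have : n%:R^-1 <= S (b n + - (e / 2) * u (b n)).
    rewrite leNgt; apply/negP => Sb.
    have := ge_inf hE (ltW Sb); rewrite -/(b n); nra.
  move=> /le_trans /(_ h1); rewrite opprK (_ : e / 2 + e / 2 = e); last by field.
  rewrite -[n%:R^-1]mul1r ler_pdivrMr// expRN -[(expR e)^-1]mul1r ler_pdivrMr ?expR_gt0//.
  by rewrite (_ : n%:R * _ * _ = expR e * S (b n) * n%:R)//; ring.
have : S (b n + (e / 2) * u (b n)) <= n%:R^-1.
  have [s /= Ss sb] : exists2 y, [set t | S t <= n%:R^-1] y & y < b n + e / 2 * u (b n).
    apply: inf_adherent; first by rewrite mulr_gt0.
    by split=> //; exists t; exact: ltW.
  by apply: le_trans Ss; exact/Smono/ltW.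
move=> /(le_trans h2); rewrite (_ : - (e / 2) - e / 2 = - e); last by field.
rewrite -[n%:R^-1]mul1r ler_pdivlMr// expRN => H1.
rewrite -[leRHS]mulr1 -ler_pdivrMl ?expR_gt0//.
by apply: le_trans H1; rewrite mulrA mulrAC.
Unshelve. all: by end_near. Qed.

(** Monotonicity squeezes the moving argument [zeta n] between the fixed ones [z - r / 4] and
    [z + r / 4]. *)
Lemma cvg_quantile_tail (zeta : nat -> R) (z : R) : zeta n @[n --> \oo] --> z ->
  n%:R * S (b n + zeta n * a n) @[n --> \oo] --> expR (- z).
Proof.
move=> cz; apply/cvgrPdist_le => e e0.
have /cvgrPdist_le /(_ _ e0) : expR x @[x --> - z] --> expR (- z) by exact: continuous_expR.
move=> /nbhs_ballP[r /= r0 rP].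
have r4 : 0 < r / 4 by rewrite divr_gt0.
have H := near_quantile (near_endI (near_end_ratio gS (z - r / 4) r4) (near_end_ratio gS (z + r / 4) r4)).
near=> n.
have [bo [/andP[_ h1] /andP[h2 _]]] : ((b n)%:E < omega)%E /\
  (expR (- (z - r / 4) - r / 4) * S (b n) <= S (b n + (z - r / 4) * u (b n)) <= expR (- (z - r / 4) + r / 4) * S (b n) /\
   expR (- (z + r / 4) - r / 4) * S (b n) <= S (b n + (z + r / 4) * u (b n)) <= expR (- (z + r / 4) + r / 4) * S (b n)).
  by near: n.
have ub : 0 < u (b n) by case: gS => _ + _ _ _; apply.
have n0 : 0 < n%:R :> R by rewrite ltr0n; near: n; exists 1%N.
have /andP[q1 q2] : expR (- (r / 4)) <= n%:R * S (b n) <= expR (r / 4).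
  by near: n; exact: quantile_ratio.
have : `|z - zeta n| <= r / 4 by near: n; move/cvgrPdist_le : cz; apply.
rewrite ler_norml => /andP[z1 z2].
have up : n%:R * S (b n + zeta n * a n) <= expR (- z + 3 * (r / 4)).
  apply: (@le_trans _ _ (n%:R * (expR (- (z - r / 4) + r / 4) * S (b n)))).
    rewrite ler_pM2l//; apply: le_trans h1; apply: Smono.
    by rewrite lerD2l ler_pM2r//; lra.
  rewrite mulrCA; apply: (@le_trans _ _ (expR (- (z - r / 4) + r / 4) * expR (r / 4))).
    by rewrite ler_pM2l ?expR_gt0.
  by rewrite -expRD ler_expR; lra.
have lo : expR (- z - 3 * (r / 4)) <= n%:R * S (b n + zeta n * a n).
  apply: (@le_trans _ _ (n%:R * (expR (- (z + r / 4) - r / 4) * S (b n)))); last first.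
    rewrite ler_pM2l//; apply: (le_trans h2); apply: Smono.
    by rewrite lerD2l ler_pM2r//; lra.
  rewrite [leRHS]mulrCA; apply: (@le_trans _ _ (expR (- (z + r / 4) - r / 4) * expR (- (r / 4)))).
    by rewrite -expRD ler_expR; lra.
  by rewrite ler_pM2l ?expR_gt0.
have := rP (- z + 3 * (r / 4)); have := rP (- z - 3 * (r / 4)).
rewrite /ball/= (_ : - z - (- z - _) = 3 * (r / 4)); last by ring.
rewrite (_ : - z - (- z + _) = - (3 * (r / 4))); last by ring.
rewrite normrN ger0_norm; last lra.
move=> /(_ ltac:(lra)); rewrite ler_norml => /andP[? ?] /(_ ltac:(lra)).
rewrite !ler_norml => /andP[? ?]; apply/andP; split; lra.
Unshelve. all: by end_near. Qed.

(** The form in which rescaled thresholds arrive: [z / 2] allows for division by a norm up to 2, [K]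
    for a bounded shift. If [z >= 4 K'] the argument is at least [z / 4]; smaller [z] are covered by
    the bounded value at [b n - K' a n]. *)
Lemma quantile_tail_poly K p : exists2 C, 0 <= C & \forall n \near \oo,
  forall z, 1 <= z -> n%:R * S (b n + (z / 2 - K) * a n) <= C * z ^- p.
Proof.
have [C0 C00 HC] := near_end_poly gS p.
pose K' := `|K| + 1.
have K'1 : 1 <= K' by rewrite lerDr.
have KK' : K <= K' by apply: le_trans (ler_norm _) _; rewrite lerDl.
pose C := expR 1 * (C0 * 4 ^+ p) + expR (K' + 2) * (4 * K') ^+ p.
have C'0 : 0 <= expR 1 * (C0 * 4 ^+ p) by rewrite !mulr_ge0 ?expR_ge0 ?exprn_ge0.
have C''0 : 0 <= expR (K' + 2) * (4 * K') ^+ p.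
  by rewrite !mulr_ge0 ?expR_ge0 ?exprn_ge0 ?mulr_ge0// (le_trans ler01).
exists C; first by rewrite addr_ge0.
have H := near_quantile (near_endI HC (near_end_ratio gS (- K') ltr01)).
near=> n.
have [bo [h1 /andP[_ h2]]] : ((b n)%:E < omega)%E /\
  ((forall z, 1 <= z -> S (b n + z * u (b n)) <= C0 * z ^- p * S (b n)) /\
   expR (- - K' - 1) * S (b n) <= S (b n + - K' * u (b n)) <= expR (- - K' + 1) * S (b n)).
  by near: n.
have ub : 0 < u (b n) by case: gS => _ + _ _ _; apply.
have n0 : 0 < n%:R :> R by rewrite ltr0n; near: n; exists 1%N.
have /andP[_ q2] : expR (- 1) <= n%:R * S (b n) <= expR 1.
  by near: n; exact: quantile_ratio.
move=> z z1; have z0 : 0 < z by exact: lt_le_trans z1.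
rewrite /C [leRHS]mulrDl.
have zp : 0 < z ^- p by rewrite invr_gt0 exprn_gt0.
have [zK|zK] := lerP (4 * K') z.
  apply: ler_wpDr; first by rewrite mulr_ge0// ltW.
  apply: (@le_trans _ _ (n%:R * (C0 * (z / 4) ^- p * S (b n)))).
    rewrite ler_pM2l//; apply: le_trans (h1 (z / 4) _); last lra.
    by apply: Smono; rewrite lerD2l ler_pM2r//; lra.
  rewrite [leLHS](_ : _ = n%:R * S (b n) * (C0 * 4 ^+ p * z ^- p)); last first.
    by rewrite expr_div_n invfM invrK; ring.
  rewrite -[leRHS]mulrA ler_pM// ?mulr_ge0 ?exprn_ge0 ?(ltW zp) ?(ltW n0) ?(ltW (S0 bo))//.
apply: ler_wpDl; first by rewrite mulr_ge0// ltW.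
apply: (@le_trans _ _ (n%:R * (expR (- - K' + 1) * S (b n)))).
  rewrite ler_pM2l//; apply: le_trans h2; apply: Smono.
  by rewrite lerD2l ler_pM2r//; lra.
rewrite mulrCA; apply: (@le_trans _ _ (expR (- - K' + 1) * expR 1)).
  by rewrite ler_pM2l ?expR_gt0.
rewrite -expRD (_ : - - K' + 1 + 1 = K' + 2); last by ring.
rewrite -mulrA ler_peMr ?expR_ge0// ler_pdivlMr ?exprn_gt0// mul1r.
by rewrite lerXn2r ?nnegrE ?mulr_ge0 ?(ltW z0) ?(ltW zK)// (le_trans ler01).
Unshelve. all: by end_near. Qed.

Lemma quantile_aux_small : \forall n \near \oo, ((b n)%:E < omega)%E /\ 0 < b n.
Proof. by apply: (near_quantile (P := fun t => 0 < t)); apply: near_end_gt; case: gS. Qed.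

Lemma cvg_aux_quantile : a n / b n @[n --> \oo] --> 0.
Proof.
apply/cvgr0Pnorm_le => e e0.
have H := near_quantile (near_endI (near_end_aux_small gS e^-1) (near_end_gt (_ : (0%:E < omega)%E))).
near=> n.
have [bo [h1 h2]] : ((b n)%:E < omega)%E /\ (e^-1 * u (b n) < b n /\ 0 < b n).
  by near: n; apply: H; case: gS.
have ub : 0 < u (b n) by case: gS => _ + _ _ _; apply.
rewrite ger0_norm ?divr_ge0 ?(ltW ub) ?(ltW h2)//.
by rewrite ler_pdivrMr// mulrC -ler_pdivrMr// mulrC ltW.
Unshelve. all: by end_near. Qed.

End quantiles.

(** * Gumbel tails of products *)

Section independence.
Context d d1 d2 (T : measurableType d) (T1 : measurableType d1) (T2 : measurableType d2).
Context (R : realType) (P : probability T R) (X : {RV P >-> T1}) (Y : {RV P >-> T2}).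
Hypothesis XY : independent_pair P X Y.

Lemma independent_pair_law (A : set (T1 * T2)) : measurable A ->
  P [set t | A (X t, Y t)] = (distribution P X \x distribution P Y)%E A.
Proof.
move=> mA.
have mZ : measurable_fun setT (fun t => (X t, Y t)).
  exact: measurable_fun_pair.
pose Z : {mfun T >-> (T1 * T2)%type} := mfun_Sub (mem_set mZ).
have := @product_measure_unique _ _ T1 T2 R (distribution P X) (distribution P Y) (distribution P Z).
move=> -> //.
Qed.

(** Plays the part of conditioning on [X]: inequalities with [x] frozen are integrated against its
    law. *)
Lemma independent_pair_le_xsection (A B : set (T1 * T2)) (c : R) :
  measurable A -> measurable B -> 0 <= c ->
  (forall x, P [set t | A (x, Y t)] <= c%:E * P [set t | B (x, Y t)])%E ->
  (P [set t | A (X t, Y t)] <= c%:E * P [set t | B (X t, Y t)])%E.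
Proof.
move=> mA mB c0 AB.
rewrite !independent_pair_law// /product_measure1.
rewrite -ge0_integralZl_EFin//; last exact: measurable_fun_xsection.
apply: ge0_le_integral => //=.
- exact: measurable_fun_xsection.
- by apply: emeasurable_funM => //; exact: measurable_fun_xsection.
- move=> x _; rewrite /distribution /pushforward.
  have sec C : Y @^-1` xsection C x = [set t | C (x, Y t)].
    by apply/seteqP; split => t /=; rewrite /xsection/= inE.
  by rewrite !sec; exact: AB.
Qed.

Lemma independent_pair_le_ysection (A B : set (T1 * T2)) (c : R) :
  measurable A -> measurable B -> 0 <= c ->
  (forall y, P [set t | A (X t, y)] <= c%:E * P [set t | B (X t, y)])%E ->
  (P [set t | A (X t, Y t)] <= c%:E * P [set t | B (X t, Y t)])%E.
Proof.
move=> mA mB c0 AB.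
have E C : measurable C -> P [set t | C (X t, Y t)] = (distribution P X \x^ distribution P Y)%E C.
  move=> mC; rewrite independent_pair_law//.
  by apply: product_measure_unique => //= *; rewrite product_measure2E.
rewrite !E// /product_measure2.
rewrite -ge0_integralZl_EFin//; last exact: measurable_fun_ysection.
apply: ge0_le_integral => //=.
- exact: measurable_fun_ysection.
- by apply: emeasurable_funM => //; exact: measurable_fun_ysection.
- move=> y _; rewrite /distribution /pushforward.
  have sec C : X @^-1` ysection C y = [set t | C (X t, y)].
    by apply/seteqP; split => t /=; rewrite /ysection/= inE.
  by rewrite !sec; exact: AB.
Qed.

End independence.

Lemma measurable_ler d (T : measurableType d) (R : realType) (v : T -> R) z :
  measurable_fun setT v -> measurable [set t | v t <= z].
Proof.
move=> mv; rewrite (_ : [set t | _] = v @^-1` `]-oo, z]).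
  by rewrite -[_ @^-1` _]setTI; exact: mv.
by apply/seteqP; split=> t /=; rewrite in_itv.
Qed.

Lemma measurable_ger d (T : measurableType d) (R : realType) (v : T -> R) z :
  measurable_fun setT v -> measurable [set t | z <= v t].
Proof.
move=> mv; rewrite (_ : [set t | _] = v @^-1` `[z, +oo[).
  by rewrite -[_ @^-1` _]setTI; exact: mv.
by apply/seteqP; split=> t /=; rewrite in_itv/= andbT.
Qed.

Section product_tail.
Context d (T : measurableType d) (R : realType) (P : probability T R).
Context (X V : {RV P >-> R}).
Hypothesis XV : independent_pair P X V.
Hypothesis X0 : P [set t | 0 < X t] = 1%E.
Hypothesis V1 : P [set t | V t <= 1] = 1%E.

Let SH s := fine (P [set t | s < X t]).
Let SG s := fine (P [set t | s < X t * V t]).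
Let g e := fine (P [set t | 1 - e < V t]).

Variables (C : R) (omega : \bar R) (u : R -> R).
Hypothesis C1 : 1 <= C.
Hypothesis g_gt0 : forall e, 0 < e -> 0 < g e.
Hypothesis g_doubling : forall e, 0 < e -> g (2 * e) <= C * g e.
Hypothesis gH : gumbel_tail omega u SH.

Let mX : measurable_fun setT X. Proof. exact: measurable_funPT. Qed.

Let mV : measurable_fun setT V. Proof. exact: measurable_funPT. Qed.

Let mXV : measurable_fun setT (fun t => X t * V t). Proof. exact: measurable_funM. Qed.

Let EFin_fine (A : set T) : measurable A -> (fine (P A))%:E = P A.
Proof. by move=> mA; rewrite fineK// fin_num_measure. Qed.

Let P_le (A B : set T) : measurable A -> measurable B -> A `<=` B -> (P A <= P B)%E.
Proof. by move=> mA mB; apply: le_measure; exact: mem_set. Qed.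

Let fine_le_P (A B : set T) : measurable A -> measurable B -> A `<=` B ->
  fine (P A) <= fine (P B).
Proof.
move=> mA mB AB; rewrite -lee_fin !EFin_fine//; apply: le_measure => //; exact: mem_set.
Qed.

Let good := [set t | 0 < X t] `&` [set t | V t <= 1].

Let mle1 : measurable [set t | V t <= 1].
Proof. exact: measurable_ler. Qed.

Let mgood : measurable good.
Proof. by apply: measurableI => //; exact: measurable_gtr. Qed.

Let P_good : P good = 1%E.
Proof.
have h (E : set T) : measurable E -> P E = 1%E -> P (~` E) = 0%E.
  by move=> mE PE; rewrite probability_setC// PE subee.
have mpos := measurable_gtr 0 mX.
have : P (~` good) = 0%E.
  apply/eqP; rewrite eq_le measure_ge0 andbT /good setCI.
  have : (P (~` [set t | 0 < X t]%R `|` ~` [set t | V t <= 1]%R) <=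
      P (~` [set t | 0 < X t]%R) + P (~` [set t | V t <= 1]%R))%E.
    by apply: measureU2; exact: measurableC.
  by rewrite (h _ mpos X0) (h _ mle1 V1) adde0.
move=> H; have := probability_setC P (measurableC mgood).
by rewrite setCK H sube0.
Qed.

Let P_goodI (E : set T) : measurable E -> P (E `&` good) = P E.
Proof.
move=> mE; apply/eqP; rewrite eq_le; apply/andP; split.
  by apply: P_le => //; exact: measurableI.
have -> : P E = (P (E `\` good) + P (E `&` good))%E by exact: measureDI.
rewrite (_ : P (E `\` good) = 0%E) ?add0e//.
apply/eqP; rewrite eq_le measure_ge0 andbT.
apply: (@le_trans _ _ (P (~` good))).
  by apply: P_le; [exact: measurableD|exact: measurableC|move=> t []].
by rewrite probability_setC// P_good subee.
Qed.

Let g_ge0 e : 0 <= g e. Proof. exact: fine_ge0. Qed.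

Let g_mono e e' : e <= e' -> g e <= g e'.
Proof.
move=> ee; apply: fine_le_P; try exact: measurable_gtr.
by move=> t /=; apply: le_lt_trans; rewrite lerB.
Qed.

Let g_iter e m : 0 < e -> g (2 ^+ m * e) <= C ^+ m * g e.
Proof.
move=> e0; elim: m => [|m ih]; first by rewrite !expr0 !mul1r.
rewrite exprS -mulrA; apply: le_trans (g_doubling _) _.
  by rewrite mulr_gt0// exprn_gt0.
by rewrite exprS -mulrA ler_wpM2l// (le_trans ler01).
Qed.

Let P_and r e : fine (P ([set t | r < X t] `&` [set t | 1 - e < V t])) = SH r * g e.
Proof.
rewrite /SH /g -fineM ?fin_num_measure//; try exact: measurable_gtr.
have := @XV `]r, +oo[%classic `]1 - e, +oo[%classic (measurable_itv _) (measurable_itv _).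
have E (Y : T -> R) z : Y @^-1` `]z, +oo[ = [set t | z < Y t].
  by apply/seteqP; split => t /=; rewrite in_itv/= andbT.
by rewrite !E => ->.
Qed.

(** If [X > t + 2 u t] and [V > 1 - u t / t], then [X V > t] once [u t / t <= 1 / 2]. The factor
    [exp 3] pays for the passage from [SH (t + 2 u t)] to [SH t]. *)
Let SG_lower : near_end omega (fun t => SH t * g (u t / t) <= expR 3 * SG t).
Proof.
have := near_endI (near_end_aux_small gH 2) (near_endI (near_end_gt (_ : (0%:E < omega)%E)) (near_end_ratio gH 2 ltr01)).
move=> H; apply: near_endW (H _); last by case: gH.
move=> t to [h2 [t0 /andP[h3 _]]].
have ut : 0 < u t by case: gH => _ + _ _ _; apply.
have : SH (t + 2 * u t) * g (u t / t) <= SG t.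
  rewrite -P_and /SG; apply: fine_le_P.
  - by apply: measurableI; exact: measurable_gtr.
  - exact: measurable_gtr.
  move=> s [/= h4 h5].
  have ut1 : u t / t <= 2^-1 by rewrite ler_pdivrMr//; lra.
  have ut2 : u t = u t / t * t by rewrite divfK// gt_eqF.
  have ut3 : 0 < u t / t by rewrite divr_gt0.
  apply: (@lt_le_trans _ _ ((t + 2 * u t) * V s)); last first.
    by rewrite ler_wpM2r ?(ltW h4)//; lra.
  move: (u t / t) ut1 ut2 ut3 h5 => k k1 -> k3 h5.
  have kt : 0 < k * t by rewrite mulr_gt0.
  have kk : 0 <= k * (k * t) by rewrite mulr_ge0 ?ltW.
  apply: (@le_lt_trans _ _ ((t + 2 * (k * t)) * (1 - k))); first by nra.
  by rewrite ltr_pM2l//; lra.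
move=> h4; apply: (@le_trans _ _ (expR 3 * SH (t + 2 * u t) * g (u t / t))); last first.
  by rewrite -mulrA ler_wpM2l ?expR_ge0.
rewrite ler_wpM2r//; move: h3; rewrite (_ : - 2 - 1 = - 3 :> R); last by ring.
by rewrite expRN ler_pdivrMl ?expR_gt0.
Qed.

(* Dyadic decomposition along [X > t + A 2^j u t], where [1 - V] must be below a multiple of
   [2^j u t / t]: the tail of [X] decreases faster than any power of [2^j], which beats the growth
   [C^j] allowed by the doubling of [g]. *)
Let far_part (delta : R) : 0 < delta -> exists2 Y, 0 < Y & near_end omega (fun t =>
  fine (P ([set s | t < X s * V s] `&` good `&` [set s | V s < t / (t + Y * u t)])) <= delta * SG t).
Proof.
move=> delta0.
have [p pC] := exists_expr2_gt (2 * C).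
have [A A0 HA] := near_end_geometric gH p.
have [m mA] := exists_expr2_gt A.
have C0 : 0 < C by exact: lt_le_trans C1.
pose K := C ^+ m.+1 * expR 3.
have K0 : 0 < K by rewrite mulr_gt0 ?expR_gt0 ?exprn_gt0.
have [J0 J0K] := exists_expr2_gt (2 * K / delta).
pose J := J0.+1.
have JK : 2 * K / 2 ^+ J <= delta.
  rewrite ler_pdivrMr ?exprn_gt0//; move: J0K; rewrite ltr_pdivrMr// => /ltW /le_trans; apply.
  by rewrite (mulrC delta) ler_pM2r// ler_eXn2l ?ltr1n.
have q1 n : 1 <= 2 ^+ n :> R by rewrite exprn_ege1// ler1n.
exists (A * (2 ^+ J - 1)).
  by rewrite mulr_gt0// subr_gt0 exprn_egt1// ltr1n.
have := near_endI HA (near_endI SG_lower (near_end_gt (_ : (0%:E < omega)%E))).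
move=> H; apply: near_endW (H _); last by case: gH.
move=> t to [h1 [h2 t0]].
have ut : 0 < u t by case: gH => _ + _ _ _; apply.
have SG0 : 0 <= SG t by exact: fine_ge0.
pose a j := t + A * (2 ^+ (J + j) - 1) * u t.
have at0 j : t <= a j by rewrite lerDl !mulr_ge0 ?(ltW A0) ?(ltW ut)// subr_ge0.
pose F j := [set s | a j < X s] `&` [set s | 1 - A * 2 ^+ (J + j).+1 * (u t / t) < V s].
have mF j : measurable (F j) by apply: measurableI; exact: measurable_gtr.
set E := (X in fine (P X)).
have mE : measurable E.
  apply: measurableI; first by apply: measurableI => //; exact: measurable_gtr.
  rewrite (_ : [set s | _] = ~` [set s | t / (t + A * (2 ^+ J - 1) * u t) <= V s]).
    by apply: measurableC; exact: measurable_ger.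
  by apply/seteqP; split => s /=; rewrite ltNge => /negP.
rewrite -lee_fin EFin_fine//.
apply: (@le_trans _ _ (\sum_(0 <= j <oo) P (F j))%E).
  apply: measure_sigma_subadditive => // s [[/= tXV [/= Xs Vs]] Vt].
  have aX : a 0%N < X s.
    rewrite /a addn0; move: Vt; rewrite ltr_pdivlMr; last first.
      by have := at0 0%N; rewrite /a addn0 => /(lt_le_trans t0).
    move: (t + _) => k; have V0 : 0 < V s by rewrite -(pmulr_rgt0 _ Xs) (lt_trans t0).
    move=> Vk; have : V s * k < X s * V s by exact: lt_trans tXV.
    by rewrite mulrC ltr_pM2r.
  have [|j /andP[j1 j2]] := @exists_step R a (X s) aX.
    have [n nP] := exists_expr2_gt (X s / (A * u t) + 1); exists n.
    have Au : 0 < A * u t by rewrite mulr_gt0.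
    have : X s <= A * (2 ^+ (J + n) - 1) * u t.
      rewrite mulrAC mulrC -ler_pdivrMr// lerBrDr (le_trans (ltW nP))//.
      by rewrite ler_eXn2l ?ltr1n// leq_addl.
    by rewrite /a; lra.
  exists j => //; split => //=.
  have X0' : 0 < a j.+1 by exact: lt_le_trans j2.
  have tV : t / X s < V s by rewrite ltr_pdivrMr// mulrC.
  apply: le_lt_trans tV.
  apply: (@le_trans _ _ (t / a j.+1)); last first.
    by rewrite ler_pM2l// lef_pV2.
  rewrite ler_pdivlMr// /a addnS.
  have {2}-> : u t = u t / t * t by rewrite divfK// gt_eqF.
  have k0 : 0 < u t / t by rewrite divr_gt0.
  have BA : A <= A * 2 ^+ (J + j).+1 by rewrite ler_peMr// ltW.
  rewrite (mulrBr A) mulr1.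
  move: (u t / t) (A * 2 ^+ _) k0 BA => k B k0 BA.
  rewrite (_ : _ * _ = t - t * (A * k + B * k * ((B - A) * k))); last by ring.
  by rewrite gerBl mulr_ge0 ?(ltW t0)// addr_ge0// !mulr_ge0 ?subr_ge0 ?(ltW k0) ?(ltW A0) ?(le_trans (ltW A0)).
apply: (@le_trans _ _ (\sum_(0 <= j <oo) ((delta * SG t) / (2 ^ j.+1)%:R)%:E)%E); last first.
  by apply: (epsilon_trick0 xpredT); rewrite mulr_ge0// ltW.
apply: lee_nneseries => // j _.
rewrite -[P (F j)]EFin_fine// P_and lee_fin.
have gle : g (A * 2 ^+ (J + j).+1 * (u t / t)) <= C ^+ (m + (J + j).+1) * g (u t / t).
  apply: le_trans (g_iter _ (divr_gt0 ut t0)); apply: g_mono.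
  by rewrite ler_pM2r ?divr_gt0// exprD ler_pM2r ?exprn_gt0// ltW.
apply: (@le_trans _ _ (2 ^- (p * (J + j)) * SH t * (C ^+ (m + (J + j).+1) * g (u t / t)))).
  by apply: ler_pM => //; rewrite ?fine_ge0//; exact: h1.
have -> : 2 ^- (p * (J + j)) * SH t * (C ^+ (m + (J + j).+1) * g (u t / t)) =
   C ^+ m.+1 * (C / 2 ^+ p) ^+ (J + j) * (SH t * g (u t / t)).
  rewrite addnS -addSn exprD expr_div_n exprM; ring.
have Cp : (C / 2 ^+ p) ^+ (J + j) <= 2 ^- (J + j).
  rewrite -[leRHS]exprVn lerXn2r ?nnegrE ?divr_ge0 ?exprn_ge0 ?invr_ge0 ?(ltW C0)//.
  rewrite ler_pdivrMr ?exprn_gt0//; lra.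
apply: (@le_trans _ _ (C ^+ m.+1 * 2 ^- (J + j) * (expR 3 * SG t))).
  have H1 : C ^+ m.+1 * (C / 2 ^+ p) ^+ (J + j) <= C ^+ m.+1 * 2 ^- (J + j).
    by rewrite ler_wpM2l ?exprn_ge0 ?(ltW C0).
  apply: ler_pM => //.
    by rewrite !mulr_ge0 ?exprn_ge0 ?divr_ge0 ?exprn_ge0 ?(ltW C0).
  by rewrite mulr_ge0// fine_ge0.
have -> : C ^+ m.+1 * 2 ^- (J + j) * (expR 3 * SG t) = 2 * K / 2 ^+ J * SG t / (2 ^ j.+1)%:R.
  rewrite /K natrX exprD (exprS 2 j) !invfM.
  by field; rewrite !expf_neq0.
by rewrite ler_pM2r ?invr_gt0 ?ltr0n ?expn_gt0// ler_wpM2r.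
Qed.

(* Given [V = v], the bound [t / v <= t + Y * u t] puts [t / v] in the range where the ratios of
   the tail of [X] converge uniformly. *)
Let near_part x Y e : 0 <= x -> 0 < Y -> 0 < e -> near_end omega (fun t =>
  let near := good `&` [set s | t / (t + Y * u t) <= V s] in
  expR (- x - e) * fine (P ([set s | t < X s * V s] `&` near)) <=
  fine (P ([set s | t + x * u t < X s * V s] `&` near)) <=
  expR (- x + e) * fine (P ([set s | t < X s * V s] `&` near))).
Proof.
move=> x0 Y0 e0.
pose r := e / 4.
have r0 : 0 < r by rewrite divr_gt0.
pose r1 := Num.min 1 r.
have r10 : 0 < r1 by rewrite lt_min ltr01.
have Y'0 : 0 <= Y + x + 1 by rewrite !addr_ge0// ltW.
have := near_endI (near_end_uniform gH Y'0 r0)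
  (near_endI (near_end_aux_small gH (x * Y / r1)) (near_end_gt (_ : (0%:E < omega)%E))).
move=> H; apply: near_endW (H _); last by case: gH.
move=> t to [h1 [h2 t0]] near.
have ut : 0 < u t by case: gH => _ + _ _ _; apply.
have Yu : 0 < t + Y * u t by rewrite addr_gt0// mulr_gt0.
set v0 := t / (t + Y * u t) in near *.
have v00 : 0 < v0 by rewrite divr_gt0.
pose B s : set (R * R) := [set p | s < p.1 * p.2] `&` ([set p | 0 < p.1] `&` [set p | p.2 <= 1] `&` [set p | v0 <= p.2]).
have m1 : measurable_fun setT (fun p : R * R => p.1) by exact: measurable_fst.
have m2 : measurable_fun setT (fun p : R * R => p.2) by exact: measurable_snd.
have mB s : measurable (B s).
  apply: measurableI; first by apply: measurable_gtr; exact: measurable_funM.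
  apply: measurableI; last exact: measurable_ger.
  by apply: measurableI; [exact: measurable_gtr|exact: measurable_ler].
have mE s : measurable ([set z | s < X z * V z] `&` near).
  apply: measurableI; first exact: measurable_gtr.
  by apply: measurableI => //; exact: measurable_ger.
have BE s : [set z | s < X z * V z] `&` near = [set z | B s (X z, V z)] by [].
have sec s v : 0 <= s -> v0 <= v <= 1 -> P [set z | B s (X z, v)] = (SH (s / v))%:E.
  move=> s0 /andP[v0v v1]; have vp : 0 < v by exact: lt_le_trans v0v.
  rewrite EFin_fine; last exact: measurable_gtr.
  congr (P _); apply/seteqP; split => z; rewrite /B/= ltr_pdivrMr//; first by case.
  move=> sX; split=> //; split=> //; split=> //.
  by rewrite -(pmulr_lgt0 _ vp) (le_lt_trans s0).
have key v : v0 <= v <= 1 ->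
   expR (- x - e) * SH (t / v) <= SH ((t + x * u t) / v) <= expR (- x + e) * SH (t / v).
  move=> /andP[v0v v1]; have vp : 0 < v by exact: lt_le_trans v0v.
  pose y := (t / v - t) / u t.
  have yE : t / v = t + y * u t by rewrite /y divfK ?gt_eqF//; ring.
  have y0 : 0 <= y.
    by rewrite divr_ge0 ?(ltW ut)// subr_ge0 ler_pdivlMr// ler_piMr// ltW.
  have yY : y <= Y.
    rewrite ler_pdivrMr// lerBlDl ler_pdivrMr// mulrC -ler_pdivrMr//.
  (* Division by [v] also stretches the increment: [x u t / v = x u t + x y (u t)^2 / t]. The last
     term is small relative to [u t], since [u t / t] tends to 0. *)
  pose y' := y + x + x * y * (u t / t).
  have y'E : (t + x * u t) / v = t + y' * u t.
    rewrite mulrDl yE (_ : x * u t / v = x * u t * (t / v) / t); last first.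
      by field; rewrite !gt_eqF.
    by rewrite yE /y'; field; rewrite gt_eqF.
  have z0 : 0 <= x * y * (u t / t) by rewrite mulr_ge0 ?divr_ge0 ?(ltW ut) ?(ltW t0)// mulr_ge0.
  have zr : x * y * (u t / t) <= r1.
    apply: (@le_trans _ _ (x * Y * (u t / t))).
      by rewrite ler_wpM2r ?ler_wpM2l// divr_ge0 ?(ltW ut) ?(ltW t0).
    by rewrite mulrA ler_pdivrMr// (mulrC r1) -ler_pdivrMr// mulrAC ltW.
  have [r11 r1r] : r1 <= 1 /\ r1 <= r by rewrite !ge_min !lexx orbT.
  have /andP[a1 a2] := h1 y ltac:(apply/andP; split; lra).
  have /andP[b1 b2] := h1 y' ltac:(apply/andP; rewrite /y'; split; lra).
  have St : 0 < SH t by case: gH => _ _ _ [+ _] _; apply.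
  rewrite yE y'E; apply/andP; split.
    apply: (le_trans _ b1).
    apply: (@le_trans _ _ (expR (- x - e) * (expR (- y + r) * SH t))).
      by rewrite ler_wpM2l ?expR_ge0.
    by rewrite mulrA -expRD ler_pM2r// ler_expR /y' /r; move: zr r1r; rewrite /r; lra.
  apply: (le_trans b2).
  apply: (@le_trans _ _ (expR (- x + e) * (expR (- y - r) * SH t))); last first.
    by rewrite ler_wpM2l ?expR_ge0.
  by rewrite mulrA -expRD ler_pM2r// ler_expR /y' /r; lra.
have xu0 : 0 <= t + x * u t by rewrite addr_ge0 ?(ltW t0)// mulr_ge0 ?(ltW ut).
have out s v : ~~ (v0 <= v <= 1) -> P [set z | B s (X z, v)] = 0%E.
  move=> vn; rewrite (_ : [set z | _] = set0) ?measure0//.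
  apply/seteqP; split => z //= [_ [[_ v1] v0v]].
  by move: vn; rewrite v1 andbT; move/negP; apply.
have lower : (P [set z | B t (X z, V z)] <=
    (expR (x + e))%:E * P [set z | B (t + x * u t)%R (X z, V z)])%E.
  apply: (independent_pair_le_ysection XV) => //.
  move=> v; have [v01|v01] := boolP (v0 <= v <= 1); last by rewrite !out// mule0.
  rewrite !sec ?(ltW t0)// -EFinM lee_fin; have /andP[+ _] := key v v01.
  by rewrite -opprD expRN ler_pdivrMl ?expR_gt0.
have upper : (P [set z | B (t + x * u t)%R (X z, V z)] <=
    (expR (- x + e))%:E * P [set z | B t (X z, V z)])%E.
  apply: (independent_pair_le_ysection XV) => //.
  move=> v; have [v01|v01] := boolP (v0 <= v <= 1); last by rewrite !out// mule0.
  by rewrite !sec ?(ltW t0)// -EFinM lee_fin; have /andP[] := key v v01.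
rewrite -opprD expRN ler_pdivrMl ?expR_gt0//.
by rewrite -!lee_fin !EFinM !EFin_fine// !BE lower.
Qed.

Let SG_mono s t : s <= t -> SG t <= SG s.
Proof.
move=> st; apply: fine_le_P; try exact: measurable_gtr.
by move=> z /=; exact: le_lt_trans.
Qed.

Let SG_gt0 t : (t%:E < omega)%E -> 0 < SG t.
Proof.
case: (gH) => o0 _ _ [SH0 _] _.
suff pos s : 0 < s -> (s%:E < omega)%E -> 0 < SG s.
  move=> to; have [t0|t0] := ltP 0 t; first exact: pos.
  have [s s0 so] := ex_lt_end o0.
  by apply: lt_le_trans (pos s s0 so) _; apply: SG_mono; rewrite (le_trans t0) ?ltW.
move=> s0 so; have [s' ss' so'] := ex_lt_end so.
have s'0 : 0 < s' by exact: lt_trans ss'.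
have e0 : 0 < 1 - s / s' by rewrite subr_gt0 ltr_pdivrMr// mul1r.
apply: (@lt_le_trans _ _ (SH s' * g (1 - s / s'))).
  by rewrite mulr_gt0 ?g_gt0 ?SH0.
rewrite -P_and; apply: fine_le_P.
- by apply: measurableI; exact: measurable_gtr.
- exact: measurable_gtr.
move=> z [/= Xz]; rewrite opprB addrCA subrr addr0 => Vz.
have Vp : 0 < V z by apply: lt_trans Vz; rewrite divr_gt0.
apply: (@lt_trans _ _ (s' * V z)); last by rewrite ltr_pM2r.
by rewrite mulrC -ltr_pdivrMr.
Qed.

(** The near part has the right ratio up to [e / 2] in the exponent. As [x >= 0], the far part at
    [t + x u t] is below the one at [t], hence below [delta SG t]; [delta] is the room left between
    [exp (- x + e / 2)] and [exp (- x + e)] and between [exp (- e / 2)] and 1. *)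
Let SG_ratio_pos x e : 0 <= x -> 0 < e -> near_end omega (fun t =>
  expR (- x - e) * SG t <= SG (t + x * u t) <= expR (- x + e) * SG t).
Proof.
move=> x0 e0; pose r := e / 2.
have r0 : 0 < r by rewrite divr_gt0.
have re : e = r + r by rewrite /r; field.
pose delta := Num.min (expR (- x + e) - expR (- x + r)) (1 - expR (- r)).
have d0 : 0 < delta.
  by rewrite lt_min !subr_gt0 ltr_expR expR_lt1; apply/andP; split; lra.
have d1 : expR (- x + r) + delta <= expR (- x + e).
  by rewrite -lerBrDl ge_min lexx.
have d2 : expR (- r) <= 1 - delta by rewrite lerBrDl -lerBrDr ge_min lexx orbT.
have [Y Y0 HY] := far_part d0.
apply: near_endW (near_endI HY (near_part x0 Y0 r0)) => t to [F /= /andP[N1 N2]].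
have ut : 0 < u t by case: gH => _ + _ _ _; apply.
move: F N1 N2; set v0 := t / _; set near := good `&` _ => F N1 N2.
pose near_prob s := fine (P ([set z | s < X z * V z] `&` near)).
pose far s := fine (P ([set z | s < X z * V z] `&` good `&` [set z | V z < v0])).
have mlt : measurable [set z | V z < v0].
  rewrite (_ : [set z | _] = ~` [set z | v0 <= V z]).
    by apply: measurableC; exact: measurable_ger.
  by apply/seteqP; split => z /=; rewrite ltNge => /negP.
have mXVgt s : measurable [set z | s < X z * V z] by exact: measurable_gtr.
have mnear s : measurable ([set z | s < X z * V z] `&` near).
  by apply: measurableI => //; apply: measurableI => //; exact: measurable_ger.
have mfar s : measurable ([set z | s < X z * V z] `&` good `&` [set z | V z < v0]).
  by apply: measurableI => //; exact: measurableI.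
have SGE s : SG s = near_prob s + far s.
  apply: EFin_inj; rewrite EFinD !EFin_fine// -(P_goodI (mXVgt s)).
  rewrite -measureU//.
    congr (P _); apply/seteqP; split => z /=.
      move=> [sz gz]; have [vz|vz] := ltP (V z) v0; first by right.
      by left; split.
    by move=> [[sz [gz vz]]|[[sz gz] vz]].
  apply/seteqP; split => z //= [[_ [_ v1]] [_ v2]].
  by have := le_lt_trans v1 v2; rewrite ltxx.
have farF : far (t + x * u t) <= far t.
  apply: fine_le_P => // z [[/= h1 h2] h3]; split=> //; split=> //=.
  by apply: le_lt_trans h1; rewrite lerDl mulr_ge0// ltW.
have far0 s : 0 <= far s by exact: fine_ge0.
have near0 s : 0 <= near_prob s by exact: fine_ge0.
have SG0 : 0 <= SG t by exact: fine_ge0.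
rewrite -/(far t) in F; rewrite -/(near_prob t) -/(near_prob (t + x * u t)) in N1 N2.
rewrite [SG (t + _)]SGE; apply/andP; split.
  apply: (@le_trans _ _ (near_prob (t + x * u t))); last by rewrite lerDl.
  apply: le_trans N1; rewrite (_ : - x - e = - x - r + - r); last by rewrite re; ring.
  rewrite expRD -mulrA ler_wpM2l ?expR_ge0//.
  apply: (@le_trans _ _ ((1 - delta) * SG t)); first by rewrite ler_wpM2r.
  by rewrite mulrBl mul1r; move: (SGE t); lra.
apply: (@le_trans _ _ (expR (- x + r) * SG t + delta * SG t)).
  apply: lerD; last exact: le_trans farF F.
  by apply: (le_trans N2); rewrite ler_wpM2l ?expR_ge0// SGE lerDl.
by rewrite -mulrDl ler_wpM2r.
Qed.

(** For [x < 0] the base point is changed: with [s = t + x u t] and [y = - x] one has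
    [t = s + y u t], where [u t] lies between [u s / (1 + eta)] and [u s / (1 - eta)]. So [SG t] is
    squeezed between values to the right of [s], where the nonnegative case applies. *)
Lemma gumbel_tail_product : gumbel_tail omega u SG.
Proof.
case: (gH) => o0 u0 _ [SH0 SH1] _.
split=> //.
  split=> // t ot; apply/eqP; rewrite eq_le fine_ge0 ?andbT//.
  rewrite -(SH1 t ot) -lee_fin !EFin_fine; try exact: measurable_gtr.
  rewrite -P_goodI; last exact: measurable_gtr.
  apply: P_le; first by apply: measurableI => //; exact: measurable_gtr.
    exact: measurable_gtr.
  move=> z [/= tXV [/= Xz Vz]]; apply: lt_le_trans tXV _.
  by rewrite ler_piMr// ltW.
move=> x e e0; have [x0|x0] := leP 0 x; first exact: SG_ratio_pos.
pose y := - x; have y0 : 0 < y by rewrite oppr_gt0.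
pose eta := Num.min 2^-1 (e / (4 * y)).
have eta0 : 0 < eta by rewrite lt_min invr_gt0 ltr0n divr_gt0// mulr_gt0.
have eta2 : eta <= 2^-1 by rewrite ge_min lexx.
have etay : y * eta <= e / 4.
  apply: (@le_trans _ _ (y * (e / (4 * y)))).
    by rewrite ler_pM2l// ge_min lexx orbT.
  rewrite [leLHS](_ : _ = e / 4)//; field.
  by rewrite gt_eqF.
have p1 : 0 < 1 + eta by lra.
have p2 : 0 < 1 - eta by lra.
have y10 : 0 <= y / (1 + eta) by rewrite divr_ge0 ?ltW.
have y20 : 0 <= y / (1 - eta) by rewrite divr_ge0 ?ltW.
have r0 : 0 < e / 2 by rewrite divr_gt0.
have H := near_endI (near_end_aux_ratio gH x eta0) (near_end_shift gH x
  (near_endI (SG_ratio_pos y10 r0) (SG_ratio_pos y20 r0))).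
apply: near_endW H => t to [/andP[u1 u2] []].
have ut := u0 t to.
have [s sE] : {s | s = t + x * u t} by exists (t + x * u t).
rewrite -sE in u1 u2 *; move=> /andP[_ h1] /andP[h2 _].
have tE : t = s + y * u t by rewrite sE /y; ring.
have A1 : SG t <= SG (s + y / (1 + eta) * u s).
  apply: SG_mono; rewrite [leRHS]tE lerD2l -mulrA ler_pM2l//.
  by rewrite ler_pdivrMl.
have A2 : SG (s + y / (1 - eta) * u s) <= SG t.
  apply: SG_mono; rewrite [leLHS]tE lerD2l -mulrA ler_pM2l//.
  by rewrite ler_pdivlMl.
have St0 : 0 <= SG s by exact: fine_ge0.
have xy : x = - y by rewrite opprK.
have B1 : y - y / (1 + eta) <= e / 4.
  apply: le_trans etay; rewrite (_ : _ - _ = y * eta / (1 + eta)).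
    by rewrite ler_pdivrMr// ler_peMr ?mulr_ge0 ?ltW//; lra.
  by field; rewrite gt_eqF.
have B2 : y / (1 - eta) - y <= e / 2.
  rewrite (_ : _ - _ = y * eta / (1 - eta)); last by field; rewrite gt_eqF.
  by rewrite ler_pdivrMr//; apply: (le_trans etay); nra.
have {h1}h1 := le_trans A1 h1; have {h2}h2 := le_trans h2 A2.
rewrite xy opprK; apply/andP; split.
  apply: (@le_trans _ _ (expR (y - e) * (expR (- (y / (1 + eta)) + e / 2) * SG s))).
    by rewrite ler_wpM2l ?expR_ge0.
  by rewrite mulrA -expRD ler_piMl// expR_le1; lra.
apply: (@le_trans _ _ (expR (y + e) * (expR (- (y / (1 - eta)) - e / 2) * SG s))).
  by rewrite mulrA -expRD ler_peMl// -[leLHS]expR0 ler_expR; lra.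
by rewrite ler_wpM2l ?expR_ge0.
Qed.

End product_tail.

Lemma near_end_increasing_to (R : realType) (omega : \bar R) (Q : R -> Prop) :
  (0 < omega)%E -> (\forall t \near increasing_to omega, Q t) -> near_end omega Q.
Proof.
case: omega => [r| |] //= o0.
  move=> [e /= e0 H]; exists (r - e).
  split=> [|t]; first by rewrite lte_fin ltrBlDr ltrDl.
  rewrite lte_fin => h1 h2; apply: H => //=.
  by rewrite ltr_norml; apply/andP; split; lra.
move=> [M [_ H]]; exists M; split=> [|t h _]; first exact: ltry.
exact: H.
Qed.

(** * From the max-domain of attraction to Gumbel tails *)

Section max_domain_of_attraction.
Context d (T : measurableType d) (R : realType) (P : probability T R).
Context (Y : {RV P >-> R}) (w : R -> R).

Let F := distr_fun P Y.
Let S t := fine (P [set s | t < Y s]).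

Let mY : measurable_fun setT Y. Proof. exact: measurable_funPT. Qed.

Lemma distr_fun_tail t : distr_fun P Y t = 1 - fine (P [set s | t < Y s]).
Proof.
rewrite /distr_fun (_ : [set s | Y s <= t] = ~` [set s | t < Y s]).
  rewrite probability_setC; last exact: measurable_gtr.
  by rewrite fineB// fin_num_measure//; exact: measurable_gtr.
by apply/seteqP; split => s /=; rewrite leNgt => /negP.
Qed.

Let SE t : S t = 1 - F t. Proof. by rewrite /F distr_fun_tail subKr. Qed.

Lemma gen_inverse_tail p : gen_inverse F (1 - p) = inf [set t | S t <= p].
Proof.
congr inf; apply/seteqP; split => t /=; rewrite SE; lra.
Qed.

Lemma gumbel_tail_GMDA : GMDA w F ->
  gumbel_tail (upper_endpoint F) (fun t => (w t)^-1) S.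
Proof.
move=> [end0 w0 H].
have S_ge0 t : 0 <= S t by exact: fine_ge0.
have Smono s t : s <= t -> S t <= S s.
  move=> st; rewrite -lee_fin !fineK ?fin_num_measure//; try exact: measurable_gtr.
  apply: le_measure; rewrite ?inE; try exact: measurable_gtr.
  by move=> z /=; exact: le_lt_trans.
have S0 t : (t%:E < upper_endpoint F)%E -> 0 < S t.
  move=> /ereal_sup_gt[_ [s /= Fs <-]]; rewrite lte_fin => ts.
  by apply: lt_le_trans (Smono _ _ (ltW ts)); rewrite SE subr_gt0.
(* The supremum only controls points beyond the endpoint; the endpoint itself follows since [t < Y]
   is the union of the events [t + 1 / (n+1) < Y]. *)
have S1 t : (upper_endpoint F <= t%:E)%E -> S t = 0.
  move=> ot; have Sn n : S (t + n.+1%:R^-1) = 0.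
    apply/eqP; rewrite eq_le S_ge0 andbT leNgt; apply/negP => Spos.
    have : ((t + n.+1%:R^-1)%:E <= upper_endpoint F)%E.
      by apply: ereal_sup_ubound; exists (t + n.+1%:R^-1) => //=; move: Spos; rewrite SE subr_gt0.
    by move=> /le_trans/(_ ot); rewrite lee_fin leNgt ltrDl invr_gt0 ltr0n.
  have mS n : measurable [set s | t + n.+1%:R^-1 < Y s] by exact: measurable_gtr.
  have : (P [set s | (t < Y s)%R] <= \sum_(0 <= n <oo) P [set s | (t + n.+1%:R^-1 < Y s)%R])%E.
    apply: measure_sigma_subadditive => // [|s /= ts]; first exact: measurable_gtr.
    have /ltr_add_invr[n] : 0 < Y s - t by rewrite subr_gt0.
    by rewrite add0r ltrBrDr addrC => h; exists n.
  rewrite eseries0 => [P0|n _ _]; last first.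
    by have := Sn n; rewrite /S => /eqP; rewrite fine_eq0 ?fin_num_measure// => /eqP.
  by rewrite /S (_ : P _ = 0%E)//; apply/eqP; rewrite eq_le P0 measure_ge0.
split => //.
  by move=> t to; rewrite invr_gt0 w0.
move=> x e e0; apply: gumbel_tail_ratio => // {e0} r r0.
apply: near_end_increasing_to => //.
have FF : Filter (increasing_to (upper_endpoint F)).
  by case: (upper_endpoint F) => [s| |] /=; exact: _.
have /cvgrPdist_le/(_ r r0) := H x.
by apply: filterS => t; rewrite !SE distrC.
Qed.

End max_domain_of_attraction.

(** * The uniform distribution on the sphere *)

Lemma orthogonal_with_row (R : rcfType) (k : nat) (i0 : 'I_k) (v : 'I_k -> R) :
  \sum_i v i ^+ 2 = 1 -> exists2 O : 'M[R]_k, O *m O^T = 1%:M & forall j, O i0 j = v j.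
Proof.
move=> v1.
(* Householder reflection exchanging the basis vector [i0] and [v] *)
pose y : 'cV[R]_k := \col_i ((i == i0)%:R - v i).
pose n : R := (y^T *m y) 0 0.
have yy : y^T *m y = n%:M by rewrite [LHS]mx11_scalar.
have nE : n = 2 * (1 - v i0).
  rewrite /n mxE (eq_bigr (fun i => (i == i0)%:R - 2 * (v i * (i == i0)%:R) + v i ^+ 2)); last first.
    by move=> i _; rewrite !mxE; case: (i == i0) => /=; ring.
  rewrite big_split/= v1 sumrB -mulr_sumr (bigD1 i0)//= big1 => [|i /negPf->//].
  rewrite (bigD1 i0)//= big1 => [|i /negPf->]; last by rewrite mulr0.
  by rewrite eqxx /=; ring.
have [n0|n0] := eqVneq n 0.
  have v01 : v i0 = 1 by move: n0; rewrite nE => /eqP; rewrite mulf_eq0 pnatr_eq0/= subr_eq0 => /eqP.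
  exists 1%:M; first by rewrite trmx1 mulmx1.
  move=> j; rewrite mxE; have [<-//|ij] := eqVneq i0 j.
  have : \sum_(i | i != i0) v i ^+ 2 = 0.
    by move: v1; rewrite (bigD1 i0)//= v01 expr1n => /(canRL (addKr _)); rewrite addNr.
  move=> /eqP; rewrite psumr_eq0 => [/allP/(_ j (mem_index_enum _))|i _]; last exact: sqr_ge0.
  by rewrite eq_sym ij/= sqrf_eq0 => /eqP ->.
exists (1%:M - (2 / n) *: (y *m y^T)).
  set S := y *m y^T; have ST : S^T = S by rewrite trmx_mul trmxK.
  have SS : S *m S = n *: S.
    by rewrite /S mulmxA -(mulmxA y) yy mul_mx_scalar -scalemxAl.
  have -> : (1%:M - (2 / n) *: S)^T = 1%:M - (2 / n) *: S.
    by rewrite raddfB/= trmx1 linearZ/= ST.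
  rewrite mulmxBl mul1mx mulmxBr mulmx1 -scalemxAl -scalemxAr SS !scalerA.
  rewrite opprB -addrA -[RHS]addr0; congr (_ + _).
  rewrite -scalerBl -[X in X + _]scaleNr -scalerDl (_ : _ + _ = 0) ?scale0r//.
  by field.
move=> j; rewrite !mxE big_ord1 !mxE eqxx.
have : 1 - v i0 = n / 2 by rewrite nE; field.
move=> ->; rewrite (eq_sym i0); by case: (j == i0) => /=; field.
Qed.

Section sphere.
Context d (T : measurableType d) (R : realType) (P : probability T R) (k : nat).
Context (U : {RV P >-> k.-tuple R}) (i0 : 'I_k).
Hypothesis unifU : uniform_on_sphere P U.

Let mU i : measurable_fun setT (fun t => tnth (U t) i).
Proof. by apply: (measurableT_comp (measurable_tnth i)); exact: measurable_funPT. Qed.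

Lemma measurable_lincomb (v : 'I_k -> R) :
  measurable_fun setT (fun t => \sum_i v i * tnth (U t) i).
Proof. by apply: measurable_sum => i; exact: measurable_funM. Qed.

Lemma sphere_invariance (v : 'I_k -> R) (B : set R) : \sum_i v i ^+ 2 = 1 -> measurable B ->
  P [set t | B (\sum_i v i * tnth (U t) i)] = P [set t | B (tnth (U t) i0)].
Proof.
move=> v1 mB; have [M MM Mv] := orthogonal_with_row i0 v1.
have [_ /(_ M MM)] := unifU.
move=> /(_ ((fun u : k.-tuple R => tnth u i0) @^-1` B)) H.
rewrite (_ : [set t | B (tnth (U t) i0)] = U @^-1` ((fun u : k.-tuple R => tnth u i0) @^-1` B))//.
rewrite -H; last by rewrite -[_ @^-1` _]setTI; exact: (measurable_tnth i0).
have E t : tnth (mulmx_tuple M (U t)) i0 = \sum_i v i * tnth (U t) i.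
  by rewrite tnth_mktuple mxE; apply: eq_bigr => i _; rewrite mxE Mv.
by congr (P _); apply/seteqP; split => t /=; rewrite E.
Qed.

Lemma sphere_invariance_norm (v : 'I_k -> R) (r : R) (B : set R) :
  0 < r -> \sum_i v i ^+ 2 = r ^+ 2 -> measurable B ->
  P [set t | B (\sum_i v i * tnth (U t) i)] = P [set t | B (r * tnth (U t) i0)].
Proof.
move=> r0 vr mB.
have mB' : measurable (( *%R r) @^-1` B).
  by rewrite -[_ @^-1` _]setTI; exact: (mulrl_measurable r).
rewrite -(sphere_invariance (v := fun i => v i / r) _ mB'); last first.
  under eq_bigr do rewrite expr_div_n.
  by rewrite -mulr_suml vr divff// expf_neq0// gt_eqF.
have E t : r * (\sum_i v i / r * tnth (U t) i) = \sum_i v i * tnth (U t) i.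
  rewrite mulr_sumr; apply: eq_bigr => i _; field.
  by rewrite gt_eqF.
by congr (P _); apply/seteqP; split => t /=; rewrite E.
Qed.

Let sphere : set T := [set t | \sum_(i < k) tnth (U t) i ^+ 2 = 1].

Let msphere : measurable sphere.
Proof.
rewrite (_ : sphere = (fun t => \sum_(i < k) tnth (U t) i ^+ 2) @^-1` [set 1]); last first.
  by apply/seteqP; split.
rewrite -[_ @^-1` _]setTI; have h : measurable_fun setT (fun t => \sum_(i < k) tnth (U t) i ^+ 2).
  by apply: measurable_sum => i; exact: measurable_funX.
exact: h.
Qed.

Let sphere1 : P sphere = 1%E. Proof. by case: unifU. Qed.

Let sphere_coord t i : sphere t -> -1 <= tnth (U t) i <= 1.
Proof.
move=> st; rewrite -ler_norml -(@ler_pXn2r _ 2)// ?nnegrE// expr1n real_normK ?num_real//.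
by rewrite -st (bigD1 i)//= lerDl sumr_ge0// => j _; exact: sqr_ge0.
Qed.

Lemma sphere_coord_le1 : P [set t | tnth (U t) i0 <= 1] = 1%E.
Proof.
have m1 : measurable [set t | tnth (U t) i0 <= 1] by exact: measurable_ler.
apply/eqP; rewrite eq_le probability_le1//= -sphere1.
by apply: le_measure; rewrite ?inE// => t /(sphere_coord i0)/= /andP[].
Qed.

Let cap (e : R) := fine (P [set t | 1 - e < tnth (U t) i0]).

Let PcapE e : P [set t | 1 - e < tnth (U t) i0] = (cap e)%:E.
Proof. by rewrite fineK ?fin_num_measure//; exact: measurable_gtr. Qed.

Let PsphereI (E : set T) : measurable E -> P E = P (E `&` sphere).
Proof.
move=> mE; have s0 : P (~` sphere) = 0%E by rewrite probability_setC// sphere1 subee.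
have -> : P E = (P (E `\` sphere) + P (E `&` sphere))%E by exact: measureDI.
rewrite (_ : P (E `\` sphere) = 0%E) ?add0e//; apply/eqP; rewrite eq_le measure_ge0 andbT -s0.
by apply: le_measure; rewrite ?inE; [exact: measurableD|exact: measurableC|move=> t []].
Qed.

(* The cells of a cubic grid of mesh [sqrt (e / k)] meet the sphere inside caps of height [e],
   all of equal mass, and (4 k + 1)^k of them cover the cap of height [2 e]. *)
Lemma cap_doubling : exists2 C : R, 1 <= C & forall e, 0 < e -> cap (2 * e) <= C * cap e.
Proof.
pose N := #|{ffun 'I_k -> 'I_(4 * k).+1}|.
exists N%:R => [|e e0].
  by rewrite ler1n; apply/card_gt0P; exists [ffun=> ord0].
have k0 : 0 < k%:R :> R by rewrite ltr0n; case: (k) i0 => // -[].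
pose h := Num.sqrt (e / k%:R).
have h0 : 0 < h by rewrite sqrtr_gt0 divr_gt0.
have hh : h ^+ 2 = e / k%:R by rewrite sqr_sqrtr// divr_ge0 ?ltW.
(* A point of the cap of height [2 e] has squared distance below [4 e = 4 k h^2] from the pole, so
   each coordinate is within [2 k h] of that of the pole. The shift by [2 k] makes the cell numbers
   run from 0 to [4 k]. *)
pose coord (t : T) i := (tnth (U t) i - (i == i0)%:R) / h + 2 * k%:R.
pose cell (t : T) : {ffun 'I_k -> 'I_(4 * k).+1} := [ffun i => inord (Num.truncn (coord t i))].
pose big t := sphere t /\ 1 - 2 * e < tnth (U t) i0.
have coordP t i : big t -> 0 <= coord t i < (4 * k).+1%:R.
  move=> [st ht].
  have : (tnth (U t) i - (i == i0)%:R) ^+ 2 <= (2 * k%:R * h) ^+ 2.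
    apply: (@le_trans _ _ (4 * e)); last first.
      rewrite exprMn hh exprMn; have : 1 <= k%:R :> R by rewrite ler1n -(ltr0n R).
      move: (k%:R : R) k0 => K K0 K1; rewrite [leRHS](_ : _ = 4 * (e * K)); last by field; rewrite gt_eqF.
      have : e <= e * K by rewrite ler_peMr// ltW.
      lra.
    apply: (@le_trans _ _ (\sum_j (tnth (U t) j - (j == i0)%:R) ^+ 2)).
      by rewrite (bigD1 i)//= lerDl sumr_ge0// => j _; exact: sqr_ge0.
    rewrite (eq_bigr (fun j => tnth (U t) j ^+ 2 - 2 * (tnth (U t) j * (j == i0)%:R) + (j == i0)%:R)); last first.
      by move=> j _; case: (j == i0) => /=; ring.
    rewrite big_split/= sumrB st -mulr_sumr (bigD1 i0)//= big1 => [|j /negPf->]; last by rewrite mulr0.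
    by rewrite (bigD1 i0)//= big1 => [|j /negPf->//]; rewrite eqxx /=; lra.
  have Kh : 0 <= 2 * k%:R * h by rewrite mulr_ge0 ?(ltW h0)// mulr_ge0 ?(ltW k0).
  rewrite -(real_normK (num_real (tnth (U t) i - _))) ler_pXn2r ?nnegrE//.
  rewrite ler_norml -mulNr -ler_pdivlMr// -[X in _ && X]ler_pdivrMr// /coord => /andP[h1 h2].
  by rewrite -(natr1 (4 * k)) natrM; apply/andP; split; lra.
(* The cap of height [e] around a chosen point of the cell [f], empty if the cell misses the big
   cap. Two points of one cell are at squared distance at most [k h^2 = e], so their inner product
   is at least [1 - e / 2]. *)
pose D f := if pselect (exists2 t, big t & cell t = f) is left ex
  then [set t | 1 - e < \sum_i tnth (U (sval (cid2 ex))) i * tnth (U t) i] else set0.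
have mD f : measurable (D f).
  rewrite /D; case: pselect => // ex; apply: measurable_gtr; exact: measurable_lincomb.
have PD f : (P (D f) <= (cap e)%:E)%E.
  rewrite /D; case: pselect => [ex|_]; last by rewrite measure0 lee_fin fine_ge0.
  case: cid2 => t [st _] _ /=.
  have /= := @sphere_invariance (fun i => tnth (U t) i) `]1 - e, +oo[%classic st (measurable_itv _).
  rewrite (_ : [set _ | _] = [set t0 | 1 - e < \sum_i tnth (U t) i * tnth (U t0) i]); last first.
    by apply/seteqP; split => z /=; rewrite in_itv/= andbT.
  rewrite (_ : [set t0 | tnth _ _ \in _] = [set t | 1 - e < tnth (U t) i0]) ?PcapE => [->//|].
  by apply/seteqP; split => z /=; rewrite in_itv/= andbT.
pose F j := nth set0 [seq D f | f <- enum {: {ffun 'I_k -> 'I_(4 * k).+1}}] j.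
have FE (Q : set T -> Prop) : Q set0 -> (forall f, Q (D f)) -> forall j, Q (F j).
  move=> Q0 QD j; rewrite /F; set s := enum _.
  have [js|js] := ltnP j (size s); last by rewrite nth_default// size_map.
  by rewrite (nth_map [ffun=> ord0]).
have cover : [set t | 1 - 2 * e < tnth (U t) i0] `&` sphere `<=`
   \big[setU/set0]_(j < N) F j.
  move=> t [/= ht st]; have bt : big t by split.
  rewrite -(bigcup_mkord N F); exists (index (cell t) (enum {: {ffun 'I_k -> 'I_(4 * k).+1}})) => /=.
    by rewrite /N cardE index_mem mem_enum.
  rewrite /F (nth_map [ffun=> ord0]) ?index_mem ?mem_enum// nth_index ?mem_enum// /D; case: pselect => [ex|]; last by case; exists t.
  case: cid2 => p bp cpt /=; have [sp _] := bp.
  have close i : (tnth (U p) i - tnth (U t) i) ^+ 2 <= h ^+ 2.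
    have /ffunP/(_ i) := cpt; rewrite !ffunE => /(congr1 (@nat_of_ord _)).
    have /andP[p0 p1] := coordP p i bp; have /andP[t0 t1] := coordP t i bt.
    have trunc_lt (x : R) : 0 <= x -> x < (4 * k).+1%:R -> (Num.truncn x < (4 * k).+1)%N.
      by move=> x0 x1; rewrite truncn_lt_nat.
    rewrite !inordK ?trunc_lt// => tr.
    have /andP[a1 a3] := truncn_itv p0; have /andP[a2 a4] := truncn_itv t0.
    have : `|coord p i - coord t i| <= 1.
      by rewrite ler_norml; move: a1 a3; rewrite tr -natr1 => a1 a3; move: a2 a4; rewrite -natr1 => a2 a4; apply/andP; split; lra.
    rewrite /coord opprD addrACA subrr addr0 -mulrBl opprB addrA subrK normrM normfV (gtr0_norm h0).
    rewrite ler_pdivrMr// mul1r => hn.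
    by rewrite -(real_normK (num_real (tnth (U p) i - _))) lerXn2r ?nnegrE ?(ltW h0).
  have : \sum_i (tnth (U p) i - tnth (U t) i) ^+ 2 <= e.
    apply: (@le_trans _ _ (\sum_(i < k) h ^+ 2)); first exact: ler_sum.
    by rewrite sumr_const card_ord hh -[leLHS]mulr_natr divfK// gt_eqF.
  rewrite (eq_bigr (fun j => tnth (U p) j ^+ 2 - 2 * (tnth (U p) j * tnth (U t) j) + tnth (U t) j ^+ 2)); last first.
    by move=> j _; ring.
  by rewrite big_split/= sumrB sp st -mulr_sumr; lra.
rewrite -lee_fin EFinM -[X in (X <= _)%E]PcapE.
have m2 : measurable [set t | 1 - 2 * e < tnth (U t) i0] by exact: measurable_gtr.
rewrite PsphereI//.
have : (P ([set t | (1 - 2 * e < tnth (U t) i0)%R] `&` sphere) <= \sum_(j < N) P (F j))%E.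
  apply: content_subadditive cover; first by move=> j _; exact: FE.
  exact: measurableI.
move=> /le_trans; apply.
apply: (@le_trans _ _ (\sum_(j < N) (cap e)%:E)%E); first by apply: lee_sum => j _; apply: (FE (fun A => P A <= _)%E) => //; rewrite measure0 lee_fin fine_ge0.
by rewrite sumEFin sumr_const card_ord -EFinM mulr_natl.
Qed.

(** A null cap would, by iterated doubling, make the cap of height [2^m e > 3] null, and this one
    contains the whole sphere. *)
Lemma cap_gt0 e : 0 < e -> 0 < cap e.
Proof.
move=> e0; have [C C1 HC] := cap_doubling.
have C0 : 0 < C by exact: lt_le_trans C1.
have [m mP] := exists_expr2_gt (3 / e).
have iter j : cap (2 ^+ j * e) <= C ^+ j * cap e.
  elim: j => [|j ih]; first by rewrite !expr0 !mul1r.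
  rewrite exprS -mulrA; apply: (le_trans (HC _ _)); first by rewrite mulr_gt0// exprn_gt0.
  by rewrite (exprS C) -mulrA ler_pM2l.
have : 1 <= cap (2 ^+ m * e).
  rewrite -lee_fin -PcapE -sphere1; apply: le_measure; rewrite ?inE//.
    exact: measurable_gtr.
  move=> t /(sphere_coord i0) /andP[h _] /=.
  by move: mP; rewrite ltr_pdivrMr//; lra.
move=> /le_trans/(_ (iter m)); rewrite ltNge => h; apply/negP => c0; move: h.
by rewrite leNgt (@le_lt_trans _ _ 0)// mulr_ge0_le0// exprn_ge0// ltW.
Qed.

(** With [X] frozen, rotation invariance equates the two probabilities; independence integrates this
    over [X], once in each direction. *)
Lemma sphere_scale_tail (X : {RV P >-> R}) (v : 'I_k -> R) (r s : R) :
  independent_pair P X U -> 0 < r -> \sum_i v i ^+ 2 = r ^+ 2 ->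
  P [set t | s < X t * \sum_i v i * tnth (U t) i] = P [set t | s < X t * (r * tnth (U t) i0)].
Proof.
move=> XU r0 vr.
pose A : set (R * k.-tuple R) := [set p | s < p.1 * \sum_i v i * tnth p.2 i].
pose B : set (R * k.-tuple R) := [set p | s < p.1 * (r * tnth p.2 i0)].
have mt i : measurable_fun setT (fun p : R * k.-tuple R => tnth p.2 i).
  exact: (measurableT_comp (measurable_tnth i)).
have mA : measurable A.
  apply: measurable_gtr; apply: measurable_funM => //; apply: measurable_sum => i.
  exact: measurable_funM.
have mB : measurable B.
  by apply: measurable_gtr; apply: measurable_funM => //; exact: measurable_funM.
have AB x : P [set t | A (x, U t)] = P [set t | B (x, U t)].
  have /(_ ([set y | s < x * y])) := sphere_invariance_norm r0 vr.
  by apply; apply: measurable_gtr; exact: measurable_funM.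
apply/eqP; rewrite eq_le; apply/andP; split; rewrite -[X in (_ <= X)%E]mul1e.
  by apply: (independent_pair_le_xsection XU mA mB ler01) => x; rewrite mul1e AB.
by apply: (independent_pair_le_xsection XU mB mA ler01) => x; rewrite mul1e AB.
Qed.

End sphere.

(** * Thresholds divided by the norm of a projection *)

Section rescaled_quantiles.
Context (R : realType) (omega : \bar R) (u S : R -> R).
Hypothesis gS : gumbel_tail omega u S.
Let b (n : nat) := inf [set t | S t <= n%:R^-1].
Let a n := u (b n).
Variables (kappa rho : nat -> R) (kap : R).
Hypothesis cvg_kappa : kappa n @[n --> \oo] --> kap.
Hypothesis rho0 : \forall n \near \oo, 0 < rho n.
Hypothesis rhoE : \forall n \near \oo, rho n ^+ 2 = 1 - kappa n / (2 * (b n / a n)).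

Let cvg_rho : rho n @[n --> \oo] --> (1 : R).
Proof.
have h : Num.sqrt (1 - kappa n / 2 * (a n / b n)) @[n --> \oo] --> Num.sqrt (1 - kap / 2 * 0).
  apply: continuous_cvg; first exact: sqrt_continuous.
  apply: cvgB; first exact: cvg_cst.
  by apply: cvgM; [apply: cvgM => //; exact: cvg_cst|exact: (cvg_aux_quantile gS)].
rewrite mulr0 subr0 sqrtr1 in h; apply: cvg_trans h; apply: near_eq_cvg.
near=> n.
have -> : 1 - kappa n / 2 * (a n / b n) = rho n ^+ 2.
  have -> : rho n ^+ 2 = 1 - kappa n / (2 * (b n / a n)) by near: n.
  by rewrite invfM invf_div !mulrA.
by rewrite sqrtr_sqr gtr0_norm//; near: n.
Unshelve. all: by end_near. Qed.

(** This is [(b n / a n) (1 / rho n - 1)], rewritten through [1 - rho^2 = kappa a / (2 b)] so that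
    the diverging ratio [b / a] cancels. Since [rho n] tends to 1, the limit is [kap / 4]. *)
Let shift n := kappa n / 2 / (rho n * (1 + rho n)).

Let cvg_shift : shift n @[n --> \oo] --> kap / 4.
Proof.
rewrite (_ : kap / 4 = kap / 2 / (1 * (1 + 1))); last by field.
apply: cvgM; first by apply: cvgM => //; exact: cvg_cst.
apply: cvgV; first by rewrite mul1r.
by apply: cvgM => //; apply: cvgD => //; exact: cvg_cst.
Qed.

Let rescaleE : \forall n \near \oo, forall z,
  (b n + z * a n) / rho n = b n + (shift n + z / rho n) * a n.
Proof.
near=> n => z.
have r0 : 0 < rho n by near: n.
have [bo b0] : ((b n)%:E < omega)%E /\ 0 < b n by near: n; exact: (quantile_aux_small gS).
have a0 : 0 < a n by case: gS => _ + _ _ _; apply.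
have r2 : rho n ^+ 2 = 1 - kappa n / (2 * (b n / a n)) by near: n.
have kE : kappa n = (1 - rho n ^+ 2) * (2 * (b n / a n)).
  rewrite r2; field; by rewrite !gt_eqF.
rewrite /shift kE; field; rewrite !gt_eqF// addr_gt0//.
Unshelve. all: by end_near. Qed.

Lemma cvg_rescaled_tail z :
  n%:R * S ((b n + z * a n) / rho n) @[n --> \oo] --> expR (- z - kap / 4).
Proof.
have h : shift n + z / rho n @[n --> \oo] --> kap / 4 + z / 1.
  apply: cvgD => //; apply: cvgM; first exact: cvg_cst.
  exact: cvgV.
have := cvg_quantile_tail gS h.
rewrite divr1 (_ : - (kap / 4 + z) = - z - kap / 4); last by ring.
apply: cvg_trans; apply: near_eq_cvg; near=> n.
rewrite -/(a n) -/(b n); congr (_ * S _); apply/esym; move: z {h}; near: n.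
exact: rescaleE.
Unshelve. all: by end_near. Qed.

Lemma rescaled_tail_poly c p : exists2 C, 0 <= C & \forall n \near \oo, forall z, 1 <= z ->
  n%:R * S ((b n + (z + c) * a n) / rho n) <= C * z ^- p.
Proof.
(* Collects the eventual bounds [shift n >= - (|kap / 4| + 1)] and [c / rho n >= - 2 |c|], the
   latter from [rho n >= 1 / 2]; the term [z / 2] comes from [rho n <= 2]. *)
pose K := `|kap / 4| + 1 + 2 * `|c|.
have [C C0 HC] := quantile_tail_poly gS K p.
exists C => //; near=> n => z z1.
have [bo b0] : ((b n)%:E < omega)%E /\ 0 < b n by near: n; exact: (quantile_aux_small gS).
have a0 : 0 < a n by case: gS => _ + _ _ _; apply.
have r0 : 0 < rho n by near: n.
have -> : (b n + (z + c) * a n) / rho n = b n + (shift n + (z + c) / rho n) * a n.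
  by move: (z + c); near: n; exact: rescaleE.
have : n%:R * S (b n + (z / 2 - K) * a n) <= C * z ^- p.
  by move: z z1; near: n.
apply: le_trans; rewrite ler_wpM2l//; case: (gS) => _ _ Smono _ _; apply: Smono.
rewrite lerD2l ler_pM2r//.
have r2 : rho n <= 2.
  near: n; apply: (cvgr_le 1) => //; lra.
have r1 : 2^-1 <= rho n.
  near: n; apply: (cvgr_ge 1) => //; lra.
have : - (`|kap / 4| + 1) <= shift n.
  near: n; apply: (cvgr_ge (kap / 4)) => //.
  by have := ler_norm (- (kap / 4)); rewrite normrN; lra.
have : z / 2 <= z / rho n by rewrite ler_pM2l ?lef_pV2 ?posrE//; lra.
have : - (2 * `|c|) <= c / rho n.
  rewrite lerNl -mulNr ler_pdivrMr//; have := ler_norm (- c); rewrite normrN.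
  by have := ler_wpM2l (normr_ge0 c) r1; lra.
rewrite /K mulrDl; lra.
Unshelve. all: by end_near. Qed.

End rescaled_quantiles.

(** * Gaussian vectors *)

Section layer_cake.
Context d (T : measurableType d) (R : realType) (mu : {sigma_finite_measure set T -> \bar R}).

(** The density [p] is carried along so that one formula serves the normal density and, with
    [p = 1], probabilities and point masses. *)
Lemma layer_cake (g p : T -> R) : measurable_fun setT g -> measurable_fun setT p ->
  (forall x, 0 <= g x) -> (forall x, 0 <= p x) ->
  (\int[mu]_x (g x * p x)%:E =
   \int[lebesgue_measure]_(r in `]0%R, +oo[) \int[mu]_(x in [set x | (r < g x)%R]) (p x)%:E)%E.
Proof.
move=> mg mp g0 p0.
pose F (q : R * T) : \bar R := (\1_[set q : R * T | 0 < q.1 < g q.2] q * p q.2)%:E.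
have mF : measurable_fun setT F.
  apply/measurable_EFinP; apply: measurable_funM; last exact: measurableT_comp.
  apply: measurable_indic.
  rewrite (_ : [set _ | _] = [set q : R * T | 0 < q.1] `&` [set q | 0 < g q.2 - q.1]).
    apply: measurableI; first exact: measurable_gtr.
    by apply: measurable_gtr; apply: measurable_funB => //; exact: measurableT_comp.
  by apply/seteqP; split => q /=; rewrite subr_gt0; [move=> /andP[]|move=> [-> ->]].
have F0 q : (0 <= F q)%E by rewrite lee_fin mulr_ge0.
transitivity (\int[mu]_x \int[lebesgue_measure]_r F (r, x))%E.
  apply: eq_integral => x _.
  rewrite /F /=.

  have E : [set r | 0 < r < g x] = `]0, g x[%classic.
    by apply/seteqP; split => r /=; rewrite in_itv.
  have mE : measurable [set r | 0 < r < g x] by rewrite E; exact: measurable_itv.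
  rewrite (_ : (fun r => _) = (fun r => (\1_[set r | 0 < r < g x] r)%:E * (p x)%:E)%E); last first.
    by apply/funext => r; rewrite EFinM !indicE.
  have mI : measurable_fun setT (fun r : R => (\1_[set r | 0 < r < g x] r : R)%:E).
    by apply/measurable_EFinP; exact: measurable_indic.
  rewrite ge0_integralZr ?lee_fin//.
  rewrite integral_indic// setIT E EFinM; congr (_ * _)%E.
  transitivity (@lebesgue_measure R `]0, g x[%classic) => //.
  rewrite lebesgue_measure_itv/= lte_fin; case: ifPn => [_|]; first by rewrite sube0.
  by rewrite -leNgt => gx; congr EFin; apply/eqP; rewrite eq_le gx g0.
rewrite -(@fubini_tonelli _ _ _ _ _ lebesgue_measure mu F)//.
rewrite [RHS]integral_mkcond; apply: eq_integral => r _.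
rewrite patchE; case: ifPn => [|rn].
  rewrite inE/= in_itv/= andbT => r0; rewrite [RHS]integral_mkcond; apply: eq_integral => x _.
  rewrite /F patchE indicE; case: ifPn => [|xn].
    by rewrite inE/= => rg; rewrite mem_set/= ?r0//= mul1r.
  rewrite (_ : (_ \in _) = false) ?mul0r//; apply/negbTE; move: xn.
  by rewrite !notin_setE /= r0.
apply: integral0_eq => x _; rewrite /F indicE (_ : (_ \in _) = false) ?mul0r//.
apply/negbTE; move: rn; rewrite !notin_setE /= in_itv/= andbT => rn.
by move=> /andP[/rn].
Qed.

End layer_cake.

Lemma layer_cake1 d (T : measurableType d) (R : realType)
    (mu : {sigma_finite_measure set T -> \bar R}) (g : T -> R) :
  measurable_fun setT g -> (forall x, 0 <= g x) ->
  (\int[mu]_x (g x)%:E =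
   \int[lebesgue_measure]_(r in `]0%R, +oo[) mu [set x | (r < g x)%R])%E.
Proof.
move=> mg g0; have := layer_cake mu mg (measurable_cst (1 : R)) g0 (fun=> ler01).
under eq_integral do rewrite mulr1.
move=> ->; apply: eq_integral => r _.
by rewrite (@integral_cst _ _ _ _ _ _ 1%:E) ?mul1e//; exact: measurable_gtr.
Qed.

Section normal_moments.
Context (R : realType).

Context d (T : measurableType d) (P : probability T R).

(** The law is given on sets, so both sides pass through masses of superlevel sets. For [s] nonzero,
    tilting the normal density of parameters [m], [s] by [exp (t y)] gives a constant times the
    density of parameters [m + t s^2], [s]; for [s = 0] it is a point mass. *)
Lemma normal_law_mgf (Y : T -> R) (m s t : R) : measurable_fun setT Y ->
  (forall B : set R, measurable B -> P (Y @^-1` B) = normal_law m s B) ->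
  (\int[P]_x (expR (t * Y x))%:E = (expR (t * m + t ^+ 2 * s ^+ 2 / 2))%:E)%E.
Proof.
move=> mY lawY.
have mexp : measurable_fun setT (fun y : R => expR (t * y)).
  by apply: measurableT_comp => //; exact: measurable_funM.
have e0 (y : R) : 0 <= expR (t * y) by exact: expR_ge0.
have PE r : P [set x | r < expR (t * Y x)] = normal_law m s [set y | r < expR (t * y)].
  by rewrite -lawY//; exact: measurable_gtr.
rewrite layer_cake1//; last exact: (measurableT_comp mexp).
transitivity (\int[lebesgue_measure]_(r in `]0%R, +oo[)
    normal_law m s [set y | (r < expR (t * y))%R])%E.
  by apply: eq_integral => r _; exact: PE.
rewrite /normal_law; have [s0|s0] := eqVneq s 0.
  rewrite -(layer_cake1 (\d_ m) mexp e0) integral_dirac//; last exact/measurable_EFinP.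
  by rewrite diracT mul1e s0 expr0n/= mulr0 mul0r addr0.
rewrite -(layer_cake lebesgue_measure mexp (measurable_normal_pdf m s) e0 (normal_pdf_ge0 m s)).
transitivity (\int[lebesgue_measure]_x ((expR (t * m + t ^+ 2 * s ^+ 2 / 2))%:E *
    (normal_pdf (m + t * s ^+ 2) s x)%:E))%E.
  apply: eq_integral => x _.
  rewrite -EFinM !normal_pdfE// /normal_fun; congr EFin.
  rewrite [LHS]mulrCA [RHS]mulrCA; congr (_ * _).
  by rewrite -!expRD; congr expR; field.
rewrite ge0_integralZl_EFin ?expR_ge0//.
- by rewrite integral_normal_pdf mule1.
- by move=> x _; rewrite lee_fin normal_pdf_ge0.
- by apply/measurable_EFinP; exact: measurable_normal_pdf.
Qed.

End normal_moments.

Section exponential_inequalities.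
Context (R : realType).
Implicit Types x : R.

Lemma ge0_of_derive (h g : R -> R) : (forall x, is_derive x 1 h (g x)) -> h 0 = 0 ->
  (forall x, 0 <= x -> 0 <= g x) -> forall x, 0 <= x -> 0 <= h x.
Proof.
move=> dh h0 g0 x; rewrite le_eqVlt => /predU1P[<-|x0]; first by rewrite h0.
have [|c] := @MVT R h g 0 x x0 (fun y _ => dh y).
  apply: continuous_subspaceT => y; apply: differentiable_continuous.
  by apply/derivable1_diffP; case: (dh y).
rewrite in_itv/= h0 !subr0 => /andP[c0 _] ->.
by rewrite mulr_ge0 ?(ltW x0)// g0// ltW.
Qed.

Let expRK x : expR x * expR (- x) = 1. Proof. by rewrite expRN divff// gt_eqF// expR_gt0. Qed.

Let is_derive_expRN x : is_derive x 1 (fun y => expR (- y)) (- expR (- x)).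
Proof.
by apply: is_derive_eq; rewrite mulrN1.
Qed.

Let cosh_ge1 x : 2 <= expR x + expR (- x).
Proof.
rewrite -(@ler_pXn2r _ 2)// ?nnegrE ?addr_ge0 ?expR_ge0//.
rewrite (_ : (expR x + _) ^+ 2 = (expR x - expR (- x)) ^+ 2 + 4 * (expR x * expR (- x))); last by ring.
rewrite expRK; have := sqr_ge0 (expR x - expR (- x)); lra.
Qed.

Let sinh_ge x : 0 <= x -> 2 * x <= expR x - expR (- x).
Proof.
move=> x0; rewrite -subr_ge0; move: x x0.
apply: (@ge0_of_derive _ (fun x => expR x + expR (- x) - 2)).
- move=> x; apply: is_derive_eq; rewrite !scaler1; ring.
- by rewrite oppr0 subrr mulr0 subr0.
- by move=> x _; rewrite subr_ge0.
Qed.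

(** Together with [sqr_ge_cosh] this encloses [x^2] between combinations of exponentials, so that
    second moments are read off the moment generating function without differentiating under the
    integral. *)
Lemma cosh_ge_sqr x : 2 + x ^+ 2 <= expR x + expR (- x).
Proof.
wlog x0 : x / 0 <= x.
  move=> H; have [/H//|/ltW x0] := leP 0 x.
  by have := H (- x); rewrite opprK sqrrN addrC (addrC (expR _)); apply; rewrite oppr_ge0.
rewrite -subr_ge0; move: x x0.
apply: (@ge0_of_derive _ (fun x => expR x - expR (- x) - 2 * x)).
- by move=> x; apply: is_derive_eq; rewrite !scaler1; ring.
- by rewrite oppr0 expR0 expr0n/=; lra.
- by move=> x x0; rewrite subr_ge0 sinh_ge.
Qed.

(* [x ^ 2 >= tanh ^ 2 x >= sigma - sigma ^ 2] where [sigma = sinh ^ 2 x]. *)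
Lemma sqr_ge_cosh x : 8 * (expR (2 * x) + expR (- (2 * x))) - 14 -
  (expR (4 * x) + expR (- (4 * x))) <= 16 * x ^+ 2.
Proof.
wlog x0 : x / 0 <= x.
  move=> H; have [/H//|/ltW x0] := leP 0 x.
  by have := H (- x); rewrite !mulrN !opprK sqrrN (addrC (expR (- (2 * x)))) (addrC (expR (- (4 * x)))); apply; rewrite oppr_ge0.
have h1 : expR x - expR (- x) <= x * (expR x + expR (- x)).
  rewrite -subr_ge0; move: x x0.
  apply: (@ge0_of_derive _ (fun x => x * (expR x - expR (- x)))).
  - by move=> x; apply: is_derive_eq; rewrite !scaler1 /GRing.scale/=; ring.
  - by rewrite oppr0 subrr mul0r subr0.
  - by move=> x x0; rewrite mulr_ge0//; have := sinh_ge x0; lra.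
have := sinh_ge x0; have := expRK x; have := expR_gt0 x; have := expR_gt0 (- x).
have E2 : expR (2 * x) = expR x ^+ 2 by rewrite expRM_natl.
have E2' : expR (- (2 * x)) = expR (- x) ^+ 2 by rewrite -mulrN expRM_natl.
have E4 : expR (4 * x) = expR x ^+ 4 by rewrite expRM_natl.
have E4' : expR (- (4 * x)) = expR (- x) ^+ 4 by rewrite -mulrN expRM_natl.
rewrite E2 E2' E4 E4'; move: (expR x) (expR (- x)) h1 => p p' h1 p'0 p0 pp' h2.
pose s := (p - p') ^+ 2.
have sE : 8 * (p ^+ 2 + p' ^+ 2) - 14 - (p ^+ 4 + p' ^+ 4) = 4 * s - s ^+ 2.
  rewrite /s (_ : (p - p') ^+ 2 = p ^+ 2 + p' ^+ 2 - 2 * (p * p')); last by ring.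
  rewrite pp' (_ : (_ - 2 * 1) ^+ 2 = p ^+ 4 + p' ^+ 4 + 2 * (p * p') ^+ 2
    - 4 * (p ^+ 2 + p' ^+ 2) + 4); last by ring.
  by rewrite pp'; ring.
have cE : (p + p') ^+ 2 = 4 + s by have := pp'; rewrite /s; nra.
have s0 : 0 <= s by exact: sqr_ge0.
have h3 : s <= x ^+ 2 * (4 + s).
  rewrite -cE -exprMn /s lerXn2r ?nnegrE//; first by lra.
  by rewrite mulr_ge0// addr_ge0// ltW.
rewrite sE -(ler_pM2r (_ : 0 < 4 + s)); last by lra.
apply: (@le_trans _ _ (16 * s)); last by rewrite -mulrA ler_pM2l.
have : 0 <= s ^+ 3 by exact: exprn_ge0.
rewrite (_ : (4 * s - s ^+ 2) * (4 + s) = 16 * s - s ^+ 3); last by ring.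
lra.
Qed.

Lemma expR_le1Dxexp x : expR x <= 1 + x * expR x.
Proof.
have := expR_ge1Dx (- x); rewrite -(ler_pM2r (expR_gt0 x)) -[X in _ <= X]mulrC expRK; lra.
Qed.

Lemma le_of_small (A B K : R) : (forall t, 0 < t -> t <= 1 -> A <= B + t * K) -> A <= B.
Proof.
move=> H; rewrite leNgt; apply/negP => BA.
pose t := Num.min 1 ((A - B) / (2 * (`|K| + 1))).
have K0 : 0 < `|K| + 1 by rewrite ltr_wpDl.
have t0 : 0 < t by rewrite lt_min ltr01 divr_gt0 ?subr_gt0// mulr_gt0.
have t1 : t <= 1 by rewrite ge_min lexx.
have tK : t * (`|K| + 1) <= (A - B) / 2.
  rewrite -ler_pdivlMr// -mulrA -invfM; apply: le_trans (_ : _ <= (A - B) / (2 * (`|K| + 1))) _ => //.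
  by rewrite ge_min lexx orbT.
have := H t t0 t1; have : t * K <= t * (`|K| + 1).
  by rewrite ler_pM2l//; have := ler_norm K; lra.
lra.
Qed.

End exponential_inequalities.

(** * Mean and variance from the moment generating function *)

Section moments_of_mgf.
Context d (T : measurableType d) (R : realType) (P : probability T R).
Variables (W : T -> R) (v : R).
Hypothesis mW : measurable_fun setT W.
Hypothesis v0 : 0 <= v.
Hypothesis mgfW : forall t, (\int[P]_x (expR (t * W x))%:E = (expR (t ^+ 2 * v / 2))%:E)%E.

Let iE t : P.-integrable setT (EFin \o (fun x => expR (t * W x))).
Proof.
apply/integrableP; split.
  apply/measurable_EFinP; apply: measurableT_comp => //; exact: measurable_funM.
rewrite (eq_integral (fun x => (expR (t * W x))%:E)); first by rewrite mgfW ltry.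
by move=> x _ /=; rewrite ger0_norm ?expR_ge0.
Qed.

Let RE t : \int[P]_x expR (t * W x) = expR (t ^+ 2 * v / 2).
Proof. by apply: EFin_inj; rewrite EFin_Rintegral. Qed.

Let iC t : P.-integrable setT (EFin \o (fun x => expR (t * W x) + expR (- (t * W x)))).
Proof.
have := integrableD measurableT (iE t) (iE (- t)).
by apply: eq_integrable => // x _; rewrite /= mulNr.
Qed.

Let RC t : \int[P]_x (expR (t * W x) + expR (- (t * W x))) = 2 * expR (t ^+ 2 * v / 2).
Proof.
have iN : P.-integrable setT (EFin \o (fun x => expR (- (t * W x)))).
  by have := iE (- t); apply: eq_integrable => // x _; rewrite /= mulNr.
rewrite RintegralD// RE (_ : \int[P]_x expR (- (t * W x)) = expR (t ^+ 2 * v / 2)); first by ring.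
by rewrite -(sqrrN t) -RE; apply: eq_Rintegral => x _; rewrite mulNr.
Qed.

Lemma integrable_mgf_sqr : P.-integrable setT (EFin \o (fun x => W x ^+ 2)).
Proof.
apply: le_integrable (iC 1) => //.
  by apply/measurable_EFinP; exact: measurable_funX.
move=> x _ /=; rewrite lee_fin ger0_norm ?sqr_ge0// ger0_norm ?addr_ge0 ?expR_ge0//.
by rewrite mul1r; have := cosh_ge_sqr (W x); lra.
Qed.

Lemma integrable_mgf : P.-integrable setT (EFin \o W).
Proof.
apply: le_integrable (iC 1) => //; first exact/measurable_EFinP.
move=> x _ /=; rewrite lee_fin [leRHS]ger0_norm ?addr_ge0 ?expR_ge0//.
rewrite mul1r; have := cosh_ge_sqr (W x); rewrite -(real_normK (num_real (W x))).
by have := sqr_ge0 (`|W x| - 1); nra.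
Qed.

Let RI1 (c : R) : \int[P]_x (cst c x) = c.
Proof.
transitivity (c * fine (P setT)); first exact: Rintegral_cst.
by rewrite probability_setT mulr1.
Qed.

Let exp_small t : 0 < t -> t <= 1 -> expR (t ^+ 2 * v / 2) <= 1 + t * (t * (v / 2 * expR (v / 2))).
Proof.
move=> t0 t1; apply: (le_trans (expR_le1Dxexp _)); rewrite lerD2l.
have tv : t ^+ 2 * v / 2 <= v / 2.
  by rewrite -mulrA ler_piMl ?divr_ge0// expr_le1// ltW.
rewrite (_ : t * _ = t ^+ 2 * v / 2 * expR (v / 2)); last by ring.
by rewrite ler_wpM2l ?ler_expR// divr_ge0// mulr_ge0 ?sqr_ge0.
Qed.

(** Integrate [1 + t e W <= exp (t e W)], divide by [t] and let [t] tend to 0; the two signs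
    together give mean zero. *)
Let mean_le e : e = 1 \/ e = -1 -> \int[P]_x (e * W x) <= 0.
Proof.
move=> e1; have e2 : e ^+ 2 = 1 by case: e1 => ->; rewrite ?expr1n// sqrrN expr1n.
have ieW : P.-integrable setT (EFin \o (fun x => e * W x)).
  by have := integrableZl measurableT e integrable_mgf; apply: eq_integrable.
apply: (@le_of_small _ _ 0 (v / 2 * expR (v / 2))) => t t0 t1.
rewrite add0r -(ler_pM2l t0) -(lerD2l 1); apply: le_trans (exp_small t0 t1).
have <- : (t * e) ^+ 2 = t ^+ 2 by rewrite exprMn e2 mulr1.
have it : P.-integrable setT (EFin \o (fun x => t * (e * W x))).
  by have := integrableZl measurableT t ieW; apply: eq_integrable.
have i1 : P.-integrable setT (EFin \o cst (1 : R)) by exact: finite_measure_integrable_cst.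
rewrite -RE -RintegralZl// (_ : 1 = \int[P]_x (cst (1:R) x)).
  rewrite -RintegralD//; apply: le_Rintegral => //.
    by have := integrableD measurableT i1 it; apply: eq_integrable.
  by move=> x _; rewrite mulrA; exact: expR_ge1Dx.
by rewrite RI1.
Qed.

Lemma Rintegral_mgf : \int[P]_x W x = 0.
Proof.
have /(_ 1 (or_introl erefl)) := mean_le; have /(_ (-1) (or_intror erefl)) := mean_le.
rewrite !RintegralZl ?integrable_mgf//; lra.
Qed.

(* [cosh_ge_sqr] and [sqr_ge_cosh] at [t W], divided by [t ^ 2], as [t -> 0]. *)
Lemma Rintegral_mgf_sqr : \int[P]_x (W x ^+ 2) = v.
Proof.
have iS t : P.-integrable setT (EFin \o (fun x => t * W x ^+ 2)).
  by have := integrableZl measurableT t integrable_mgf_sqr; apply: eq_integrable.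
have i1 (c : R) : P.-integrable setT (EFin \o cst c) by exact: finite_measure_integrable_cst.
set M := \int[P]_x (W x ^+ 2).
have MZ t : \int[P]_x (t * W x ^+ 2) = t * M by rewrite RintegralZl// integrable_mgf_sqr.
apply/eqP; rewrite eq_le; apply/andP; split.
  apply: (@le_of_small _ _ _ (v * (v / 2 * expR (v / 2)))) => t t0 t1.
  have h : 2 + t ^+ 2 * M <= 2 * expR (t ^+ 2 * v / 2).
    rewrite -MZ -RC -[X in X + _ <= _](RI1 2) -RintegralD//; apply: le_Rintegral => //.
      by have := integrableD measurableT (i1 2) (iS (t ^+ 2)); apply: eq_integrable.
    by move=> x _; rewrite /= -exprMn; exact: cosh_ge_sqr.
  have h2 := expR_le1Dxexp (t ^+ 2 * v / 2).
  have t20 : 0 < t ^+ 2 by rewrite exprn_gt0.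
  have h3 : M <= v * expR (t ^+ 2 * v / 2).
    by rewrite -(ler_pM2l t20); move: (expR _) h h2 => E; lra.
  apply: (le_trans h3); rewrite -[X in _ <= X + _]mulr1 mulrCA -mulrDr ler_wpM2l//.
  apply: (le_trans (exp_small t0 t1)); rewrite lerD2l ler_pM2l//.
  by rewrite ler_piMl// mulr_ge0 ?expR_ge0 ?divr_ge0.
pose Q := expR (2 * v).
have Q1 : 1 <= Q by rewrite -[leLHS]expR0 ler_expR mulr_ge0.
apply: (@le_of_small _ _ _ (3 * v ^+ 2 * Q ^+ 4)) => t t0 t1.
pose q := expR (2 * (t ^+ 2 * v)).
have a0 : 0 <= t ^+ 2 * v by rewrite mulr_ge0// sqr_ge0.
have q1 : 1 + 2 * (t ^+ 2 * v) <= q by exact: expR_ge1Dx.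
have qQ : q <= Q.
  by rewrite ler_expR ler_pM2l// ler_piMl// expr_le1// ltW.
have q2 : q <= 1 + 2 * (t ^+ 2 * v) * Q.
  by apply: (le_trans (expR_le1Dxexp _)); rewrite lerD2l ler_wpM2l// mulr_ge0.
have h : 16 * q - 14 - 2 * q ^+ 4 <= 16 * (t ^+ 2 * M).
  have <- : 8 * (2 * expR ((2 * t) ^+ 2 * v / 2)) = 16 * q.
    by rewrite /q (_ : (2 * t) ^+ 2 * v / 2 = 2 * (t ^+ 2 * v)); [ring|field].
  have <- : 2 * expR ((4 * t) ^+ 2 * v / 2) = 2 * q ^+ 4.
    by rewrite /q -expRM_natl; congr (_ * expR _); field.
  rewrite -!RC -[X in _ - X - _](RI1 14) mulrA -MZ -RintegralZl//.
  have iA : P.-integrable setT (EFin \o (fun x => 8 * (expR (2 * t * W x) + expR (- (2 * t * W x))))).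
    by have := integrableZl measurableT 8 (iC (2 * t)); apply: eq_integrable.
  have iB : P.-integrable setT (EFin \o (fun x => 8 * (expR (2 * t * W x) + expR (- (2 * t * W x))) - cst 14 x)).
    by have := integrableB measurableT iA (i1 14); apply: eq_integrable.
  rewrite -RintegralB// -RintegralB//; apply: le_Rintegral => //.
    by have := integrableB measurableT iB (iC (4 * t)); apply: eq_integrable.
  move=> x _; have := sqr_ge_cosh (t * W x); rewrite !(mulrA _ t) exprMn; lra.
have t20 : 0 < t ^+ 2 by rewrite exprn_gt0.
rewrite -(ler_pM2l (_ : 0 < 16 * t ^+ 2)) ?mulr_gt0// mulrDr.
rewrite -[leLHS]mulrA; apply: (@le_trans _ _ (16 * (t ^+ 2 * M) + 48 * (t ^+ 2 * v) ^+ 2 * Q ^+ 4)); last first.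
  rewrite lerD//; first by rewrite mulrA.
  rewrite (_ : 48 * (t ^+ 2 * v) ^+ 2 * Q ^+ 4 = 16 * t ^+ 2 * (t ^+ 2 * (3 * v ^+ 2 * Q ^+ 4))); last by ring.
  rewrite ler_pM2l ?mulr_gt0// ler_wpM2r//; last by rewrite expr2 ler_piMl// ltW.
  by rewrite !mulr_ge0 ?exprn_ge0// (le_trans _ Q1).
move: (t ^+ 2 * v) (t ^+ 2 * M) a0 q1 q2 h => a m a0 q1 q2 h.
have qE : 16 * q - 14 - 2 * q ^+ 4 = 8 * (q - 1) - 2 * ((q - 1) ^+ 2 * (q ^+ 2 + 2 * q + 3)) by ring.
have q0 : 1 <= q by lra.
have b1 : (q - 1) ^+ 2 <= (2 * a * Q) ^+ 2.
  by rewrite lerXn2r ?nnegrE ?subr_ge0 ?mulr_ge0 ?(le_trans _ Q1)//; lra.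
have b2 : q ^+ 2 + 2 * q + 3 <= 6 * Q ^+ 2.
  have : q ^+ 2 <= Q ^+ 2 by rewrite lerXn2r ?nnegrE//; lra.
  have : 1 <= Q ^+ 2 by rewrite exprn_ege1.
  have : Q <= Q ^+ 2 by rewrite expr2 ler_peMl// (le_trans _ Q1).
  lra.
have b3 : (q - 1) ^+ 2 * (q ^+ 2 + 2 * q + 3) <= (2 * a * Q) ^+ 2 * (6 * Q ^+ 2).
  apply: ler_pM => //; first exact: sqr_ge0.
  by rewrite !addr_ge0 ?sqr_ge0 ?mulr_ge0//; lra.
have b4 : (2 * a * Q) ^+ 2 * (6 * Q ^+ 2) = 24 * (a ^+ 2 * Q ^+ 4) by ring.
move: b3; rewrite b4 => b3; move: h; rewrite qE => h; rewrite -(mulrA 48); lra.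
Qed.

End moments_of_mgf.

Lemma integrable_sumR d (T : measurableType d) (R : realType)
    (m : {measure set T -> \bar R}) (I : Type) (r : seq I) (f : I -> T -> R) :
  (forall i, m.-integrable setT (EFin \o f i)) ->
  m.-integrable setT (EFin \o (fun t => \sum_(i <- r) f i t)).
Proof.
move=> if_; elim: r => [|i r ih].
  rewrite (_ : _ \o _ = cst 0%E); first exact: integrable0.
  by apply/funext => t /=; rewrite big_nil.
have := integrableD measurableT (if_ i) ih.
by apply: eq_integrable => // t _; rewrite /= big_cons EFinD.
Qed.

Section normal_moments.
Context d (T : measurableType d) (R : realType) (P : probability T R).
Variables (Y : T -> R) (m s : R).
Hypothesis mY : measurable_fun setT Y.
Hypothesis lawY : forall B : set R, measurable B -> P (Y @^-1` B) = normal_law m s B.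

Let W x := Y x - m.

Let mW : measurable_fun setT W. Proof. exact: measurable_funB. Qed.

Let mgfW t : (\int[P]_x (expR (t * W x))%:E = (expR (t ^+ 2 * s ^+ 2 / 2))%:E)%E.
Proof.
transitivity (\int[P]_x ((expR (- (t * m)))%:E * (expR (t * Y x))%:E))%E.
  by apply: eq_integral => x _; rewrite -EFinM -expRD /W mulrBr addrC.
rewrite ge0_integralZl_EFin ?expR_ge0//; last first.
  by apply/measurable_EFinP; apply: measurableT_comp => //; exact: measurable_funM.
by rewrite (normal_law_mgf t mY lawY) -EFinM -expRD addrA addNr add0r.
Qed.

Let iW := integrable_mgf mW mgfW.

Lemma integrable_normal_law : P.-integrable setT (EFin \o Y).
Proof.
have i1 : P.-integrable setT (EFin \o cst m) by exact: finite_measure_integrable_cst.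
have := integrableD measurableT iW i1.
by apply: eq_integrable => // x _; rewrite /= -EFinD subrK.
Qed.

Lemma Rintegral_normal_law : \int[P]_x Y x = m.
Proof.
have i1 : P.-integrable setT (EFin \o cst m) by exact: finite_measure_integrable_cst.
have : \int[P]_x W x = 0 by apply: (Rintegral_mgf mW (sqr_ge0 s)).
rewrite RintegralB//; last exact: integrable_normal_law.
have -> : \int[P]_x (cst m x) = m.
  transitivity (m * fine (P setT)); first exact: Rintegral_cst.
  by rewrite probability_setT mulr1.
by move/eqP; rewrite subr_eq0 => /eqP.
Qed.

Lemma integrable_normal_law_sqr : m = 0 -> P.-integrable setT (EFin \o (fun x => Y x ^+ 2)).
Proof.
move=> m0; have := integrable_mgf_sqr mW mgfW.
by apply: eq_integrable => // x _; rewrite /= /W m0 subr0.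
Qed.

Lemma Rintegral_normal_law_sqr : m = 0 -> \int[P]_x (Y x ^+ 2) = s ^+ 2.
Proof.
move=> m0; rewrite -(Rintegral_mgf_sqr mW (sqr_ge0 s) mgfW).
by apply: eq_Rintegral => x _; rewrite /W m0 subr0.
Qed.

End normal_moments.

Section gaussian_vectors.
Context d (T : measurableType d) (R : realType) (P : probability T R) (k : nat).
Context (Gamma : 'M[R]_k) (Z : {RV P >-> k.-tuple R}).
Hypothesis gaussZ : Gauss P Gamma Z.

Let z i x := tnth (Z x) i.
Let theta i : R := fine ('V_P[(fun t => tnth (Z t) i)%R])%E.

Lemma measurable_RV_tnth i : measurable_fun setT (fun x => tnth (Z x) i).
Proof. by apply: (measurableT_comp (measurable_tnth i)); exact: measurable_funPT. Qed.

Let lin (c : 'I_k -> R) x := \sum_i c i * z i x.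

Let mlin c : measurable_fun setT (lin c).
Proof. by apply: measurable_sum => i; apply: measurable_funM => //; exact: measurable_RV_tnth. Qed.

Let coord i : exists s : R, forall B : set R, measurable B -> P (z i @^-1` B) = normal_law 0 s B.
Proof.
have [gv Ez _ _] := gaussZ.
have [m [s H]] := gv (fun j => (j == i)%:R).
have {}H : forall B : set R, measurable B -> P (z i @^-1` B) = normal_law m s B.
  move=> B mB; rewrite -H//; congr (P (_ @^-1` B)); apply/funext => x.
  by rewrite (bigD1 i)//= eqxx mul1r big1 ?addr0// => j /negPf->; rewrite mul0r.
exists s; suff -> : 0 = m by [].
have mz : measurable_fun setT (z i) by exact: measurable_RV_tnth.
rewrite -(Rintegral_normal_law mz H); have := Ez i; rewrite unlock => E0.
by rewrite /Rintegral E0.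
Qed.

Let mz i : measurable_fun setT (z i). Proof. exact: measurable_RV_tnth. Qed.

Let iz i : P.-integrable setT (EFin \o z i).
Proof. by have [s H] := coord i; exact: (integrable_normal_law _ H). Qed.

Let iz2 i : P.-integrable setT (EFin \o (fun x => z i x ^+ 2)).
Proof. by have [s H] := coord i; exact: (integrable_normal_law_sqr (mz i) H). Qed.

Let Ez0 i : \int[P]_x z i x = 0.
Proof. by have [s H] := coord i; exact: (Rintegral_normal_law (mz i) H). Qed.

Let izz i j : P.-integrable setT (EFin \o (fun x => (z i x - z j x) ^+ 2)).
Proof.
have i2 : P.-integrable setT (EFin \o (fun x => 2 * (z i x ^+ 2 + z j x ^+ 2))).
  have := integrableZl measurableT 2 (integrableD measurableT (iz2 i) (iz2 j)).
  by apply: eq_integrable.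
apply: le_integrable i2 => //.
  by apply/measurable_EFinP; apply: measurable_funX; exact: measurable_funB.
move=> x _ /=; rewrite lee_fin ger0_norm ?sqr_ge0// ger0_norm ?mulr_ge0 ?addr_ge0 ?sqr_ge0//.
by have := sqr_ge0 (z i x + z j x); rewrite sqrrD sqrrB !mulr2n; lra.
Qed.

Let varianceE (Y : T -> R) : P.-integrable setT (EFin \o Y) -> \int[P]_x Y x = 0 ->
  ('V_P[Y] = \int[P]_x (Y x ^+ 2)%:E)%E.
Proof.
move=> iY Y0; have EE (X : T -> R) : ('E_P[X] = \int[P]_x (X x)%:E)%E by rewrite unlock.
rewrite /variance covariance.unlock EE; apply: eq_integral => x _ /=.
have F0 : fine 'E_P[Y] = 0 by rewrite EE; exact: Y0.
by rewrite F0; transitivity ((Y x - 0) * (Y x - 0))%:E => //; rewrite subr0 expr2.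
Qed.

Let thetaE i : theta i = \int[P]_x (z i x ^+ 2).
Proof. by rewrite /theta (varianceE (iz i) (Ez0 i)). Qed.

Let GammaE i j : Gamma i j = \int[P]_x ((z i x - z j x) ^+ 2).
Proof.
have [_ _ _ V] := gaussZ; apply: EFin_inj; rewrite -V varianceE.
- by rewrite EFin_Rintegral.
- by have := integrableB measurableT (iz i) (iz j); apply: eq_integrable.
- rewrite (RintegralB _ (iz i) (iz j))//.
  by rewrite [X in X - _]Ez0 [X in _ - X]Ez0 subrr.
Qed.

(** Expanding the squares of differences, with [sum_i s_i = 1], trades the square of the form for
    squares of coordinates and of increments. In expectation these are the [theta i] and the entries
    of [Gamma]. *)
Let polarization (s : 'I_k -> R) x : \sum_i s i = 1 -> lin s x ^+ 2 =
  \sum_i s i * z i x ^+ 2 - \sum_i \sum_j (s i * s j / 2) * (z i x - z j x) ^+ 2.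
Proof.
move=> s1.
have E : \sum_i \sum_j (s i * s j / 2) * (z i x - z j x) ^+ 2 =
   \sum_i s i * z i x ^+ 2 - lin s x ^+ 2.
  transitivity (\sum_i \sum_j (2^-1 * (s i * z i x ^+ 2) * s j + 2^-1 * (s i) * (s j * z j x ^+ 2)
      - (s i * z i x) * (s j * z j x))).
    by apply: eq_bigr => i _; apply: eq_bigr => j _; field.
  under eq_bigr do rewrite sumrB big_split/= -!mulr_sumr s1 mulr1.
  rewrite sumrB big_split/= -!mulr_suml -!mulr_sumr s1 mulr1 /lin expr2.
  by congr (_ - _); rewrite mulrC -mulrDl; field.
by rewrite E opprB addrC subrK.
Qed.

(** Half the variance of [<s, Z>] contributes [sum_i s_i theta_i / 2], exactly what the compensators
    [theta i / 2] remove; half of the remaining [Gamma] term gives the factor [1 / 4]. *)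
Lemma gaussian_exp_moment (s : 'I_k -> R) y : \sum_i s i = 1 ->
  (\int[P]_x (expR (\sum_i s i * (tnth (Z x) i - theta i / 2) - y))%:E =
   (expR (- y - (\sum_i \sum_j s i * s j * Gamma i j) / 4))%:E)%E.
Proof.
move=> s1; have [gv _ _ _] := gaussZ.
have [m [sg H]] := gv s.
have il : P.-integrable setT (EFin \o lin s).
  exact: (integrable_normal_law (mlin s) H).
have m0 : m = 0.
  rewrite -(Rintegral_normal_law (mlin s) H) Rintegral_sum//.
    by rewrite big1// => i _; rewrite RintegralZl// Ez0 mulr0.
  by move=> i; have := integrableZl measurableT (s i) (iz i); apply: eq_integrable.
have i1 i : P.-integrable setT (EFin \o (fun x => s i * z i x ^+ 2)).
  by have := integrableZl measurableT (s i) (iz2 i); apply: eq_integrable.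
have i2 i j : P.-integrable setT (EFin \o (fun x => s i * s j / 2 * (z i x - z j x) ^+ 2)).
  by have := integrableZl measurableT (s i * s j / 2) (izz i j); apply: eq_integrable.
have sgE : sg ^+ 2 = \sum_i s i * theta i - (\sum_i \sum_j s i * s j * Gamma i j) / 2.
  rewrite -(Rintegral_normal_law_sqr (mlin s) H m0).
  transitivity (\int[P]_x (\sum_i s i * z i x ^+ 2 -
    \sum_i \sum_j (s i * s j / 2) * (z i x - z j x) ^+ 2)).
    by apply: eq_Rintegral => x _; exact: polarization.
  have i3 i : P.-integrable setT (EFin \o (fun x => \sum_j s i * s j / 2 * (z i x - z j x) ^+ 2)).
    exact: integrable_sumR.
  rewrite RintegralB//; [|exact: integrable_sumR|exact: integrable_sumR].
  rewrite !Rintegral_sum//; congr (_ - _).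
    by apply: eq_bigr => i _; rewrite RintegralZl// thetaE.
  rewrite mulr_suml; apply: eq_bigr => i _; rewrite Rintegral_sum// mulr_suml.
  by apply: eq_bigr => j _; rewrite RintegralZl// -GammaE; ring.
transitivity (\int[P]_x ((expR (- (\sum_i s i * theta i) / 2 - y))%:E * (expR (1 * lin s x))%:E))%E.
  apply: eq_integral => x _; rewrite -EFinM -expRD mul1r; congr (expR _)%:E.
  under eq_bigr do rewrite mulrBr mulrA.
  by rewrite sumrB -mulr_suml /lin /z; ring.
rewrite ge0_integralZl_EFin ?expR_ge0//; last first.
  by apply/measurable_EFinP; apply: measurableT_comp => //; apply: measurable_funM.
rewrite (normal_law_mgf 1 (mlin s) H) -EFinM -expRD sgE m0; congr (expR _)%:E.
by field.
Qed.

End gaussian_vectors.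

(** * The limiting intensity *)

Section half_space_convergence.
Context d (T : measurableType d) (R : realType) (k : nat).
Variables (nu_ : nat -> {measure set T -> \bar R}) (nu : {measure set T -> \bar R}).
Variables (x : 'I_k -> T -> R) (kappa : ('I_k -> R) -> R).
Let lin (s : 'I_k -> R) t := \sum_(i < k) s i * x i t.
Hypothesis mx : forall i, measurable_fun setT (x i).
Hypothesis nu_half : forall s z, \sum_i s i = 1 ->
  nu [set t | z < lin s t] = (expR (- z - kappa s))%:E.
Hypothesis nu_n_half : forall s z, \sum_i s i = 1 ->
  nu_ n [set t | z < lin s t] @[n --> \oo] --> (expR (- z - kappa s))%:E.
Hypothesis nu_n_tail : forall s c p, \sum_i s i = 1 -> exists2 C : R, 0 <= C &
  \forall n \near \oo, forall z, 1 <= z ->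
    (nu_ n [set t | (z + c < lin s t)%R] <= (C * z ^- p)%:E)%E.

Let mlin s : measurable_fun setT (lin s).
Proof. by apply: measurable_sum => i; apply: measurable_funM. Qed.

Let integrable_set (m : {measure set T -> \bar R}) E : measurable E -> (m E < +oo)%E ->
  m.-integrable setT (EFin \o (\1_E : T -> R)).
Proof.
move=> mE Ey; apply/integrableP; split; first exact/measurable_EFinP/measurable_indic.
rewrite (eq_integral (fun t => (\1_E t)%:E)) ?integral_indic ?setIT//.
by move=> t _ /=; rewrite ger0_norm.
Qed.

Let cvg_half s z : \sum_i s i = 1 -> cvg_int nu_ nu (\1_[set t | z < lin s t]).
Proof.
move=> s1; have mE : measurable [set t | z < lin s t] by exact: measurable_gtr.
have fin : \forall n \near \oo, nu_ n [set t | z < lin s t] \is a fin_num.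
  by have /fine_cvgP[] := @nu_n_half s z s1.
split.
- exact: measurable_indic.
- near=> n; apply: integrable_set => //.
  by rewrite ltey_eq (_ : _ \is a fin_num)//; near: n.
- by apply: integrable_set; rewrite // nu_half// ltry.
- have RE (m : {measure set T -> \bar R}) : \int[m]_t \1_[set t | z < lin s t] t = fine (m [set t | z < lin s t]).
    by rewrite /Rintegral integral_indic// setIT.
  rewrite RE nu_half//; under eq_fun do rewrite RE.
  by have /fine_cvgP[] := @nu_n_half s z s1.
Unshelve. all: by end_near. Qed.

Let shiftE s c z : [set t | z < lin s t - c] = [set t | z + c < lin s t].
Proof. by apply/seteqP; split => t /=; rewrite ltrBrDr. Qed.

Let C0 s (c : R) := expR (- c - kappa s).

Let nu_tail s c z : \sum_i s i = 1 ->
  (nu [set t | (z < lin s t - c)%R] = (C0 s c * expR (- z))%:E)%E.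
Proof. by move=> s1; rewrite shiftE nu_half// -expRD; congr (expR _)%:E; ring. Qed.

Let mlinB s c : measurable_fun setT (fun t => lin s t - c).
Proof. exact: measurable_funB. Qed.

Let lin_pow s c q : \sum_i s i = 1 -> cvg_int nu_ nu (fun t => pos (lin s t - c) ^+ q.+1).
Proof.
move=> s1; apply: (@cvg_int_pow_of_tails _ _ _ _ _ (fun t => lin s t - c) (C0 s c)) => //.
- exact: expR_ge0.
- by move=> z _; rewrite shiftE; exact: cvg_half.
- move=> p; have [C C00 HC] := @nu_n_tail s c p s1; exists C => //.
  by apply: filterS HC => n HC z z1; rewrite shiftE; exact: HC.
- by move=> z _; rewrite nu_tail.
Qed.

Let lin_bound s c : \sum_i s i = 1 -> exists C : R, forall q,
  \int[nu]_t (pos (lin s t - c) ^+ q.+1) <= C * 2 ^+ q.+1 * (q.+1)`!%:R.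
Proof.
move=> s1; exists (C0 s c * expR 1 * 2) => q.
rewrite -lee_fin EFin_Rintegral; last by have [] := lin_pow c q s1.
apply: exp_moment_le => //; first exact: expR_ge0.
by move=> z _; rewrite nu_tail.
Qed.

(** The trapezoid is below the indicator of [c - h < x_j <= c + 2 h], whose mass is an explicit
    difference of exponentials, at most [3 h K]. *)
Let lin_thin j c e : 0 < e -> exists2 h : R, 0 < h &
  \int[nu]_t (ramp (c - h) h (x j t) - ramp (c + h) h (x j t)) < e.
Proof.
move=> e0; pose s (i : 'I_k) : R := (i == j)%:R.
have linE t : x j t = lin s t.
  by rewrite /lin (bigD1 j)//= /s eqxx mul1r big1 ?addr0// => i /negPf->; rewrite mul0r.
have s1 : \sum_i s i = 1.
  by rewrite (bigD1 j)//= /s eqxx big1 ?addr0// => i /negPf->.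
pose K := expR (- c + 2 - kappa s).
have K0 : 0 < K by exact: expR_gt0.
pose h := Num.min 1 (e / (4 * K)).
have h0 : 0 < h by rewrite lt_min ltr01 divr_gt0// mulr_gt0.
have h1 : h <= 1 by rewrite ge_min lexx.
exists h => //.
pose f t : R := \1_[set t | c - h < lin s t] t - \1_[set t | c + 2 * h < lin s t] t.
have [_ _ i1 _] := cvg_half (c - h) s1; have [_ _ i2 _] := cvg_half (c + 2 * h) s1.
have iB : nu.-integrable setT (EFin \o f).
  by have := integrableB measurableT i1 i2; apply: eq_integrable.
have RE z : \int[nu]_t \1_[set t | z < lin s t] t = expR (- z - kappa s).
  by rewrite /Rintegral integral_indic ?setIT ?nu_half//; exact: measurable_gtr.
have fE : \int[nu]_t f t = expR (- (c - h) - kappa s) - expR (- (c + 2 * h) - kappa s).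
  by rewrite RintegralB// !RE.
have rf t : ramp (c - h) h (x j t) - ramp (c + h) h (x j t) <= f t.
  rewrite linE /f !indic_pred; apply: lerB.
    have [lt|le] := ltP (c - h) (lin s t); first exact: ramp_le1.
    by rewrite ramp_eq0.
  have [lt|le] := ltP (c + 2 * h) (lin s t); last exact: ramp_ge0.
  by rewrite ramp_eq1//; lra.
have r0 t : 0 <= ramp (c - h) h (x j t) - ramp (c + h) h (x j t).
  by apply: le_trans (indic_ramp_le c (x j t) h0); exact: normr_ge0.
have ir : nu.-integrable setT (EFin \o (fun t => ramp (c - h) h (x j t) - ramp (c + h) h (x j t))).
  apply: le_integrable iB => //.
    by apply/measurable_EFinP; apply: measurable_funB; exact: measurable_ramp.
  by move=> t _ /=; rewrite lee_fin ger0_norm// ger0_norm// (le_trans (r0 t)).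
apply: (@le_lt_trans _ _ (\int[nu]_t f t)); first by apply: le_Rintegral.
rewrite fE.
have -> : - (c + 2 * h) - kappa s = - (c - h) - kappa s - 3 * h by ring.
have : expR (- (c - h) - kappa s) <= K by rewrite ler_expR; lra.
have := expR_gt0 (- (c - h) - kappa s); rewrite (expRD (- (c - h) - kappa s)).
have := expR_ge1Dx (- (3 * h)); move: (expR (- (c - h) - kappa s)) (expR (- (3 * h))) => E F h2 E0 EK.
have hK : h * K <= e / 4.
  apply: (@le_trans _ _ (e / (4 * K) * K)); first by rewrite ler_pM2r// ge_min lexx orbT.
  by rewrite [leLHS](_ : _ = e / 4)//; field; rewrite gt_eqF.
apply: (@le_lt_trans _ _ (3 * (h * K))); last lra.
have : E * (1 - F) <= K * (3 * h); last by lra.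
apply: (@le_trans _ _ (E * (3 * h))); first by rewrite ler_pM2l//; lra.
by rewrite ler_pM2r// mulr_gt0.
Qed.

Lemma cvg_int_exceedance_of_half_spaces (t_ : 'I_k -> R) :
  cvg_int nu_ nu (\1_[set t | exists j, t_ j < x j t]).
Proof. exact: (cvg_int_exceedance mx lin_pow lin_bound lin_thin). Qed.

End half_space_convergence.

Section exponential_density.
Context (R : realType).

Lemma integral_expRN_above (a : R) :
  (\int[lebesgue_measure]_(y in `]a, +oo[) (expR (- y))%:E = (expR (- a))%:E)%E.
Proof.
have cexp : continuous (fun y : R => expR (- y)).
  by move=> y; apply: differentiable_continuous; exact/derivable1_diffP.
rewrite integral_itv_obnd_cbnd; last first.
  by apply: measurable_funTS; apply/measurable_EFinP; exact: continuous_measurable_fun.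
rewrite (@ge0_continuous_FTC2y _ (fun y => expR (- y)) (fun y => - expR (- y)) a 0).
- by rewrite EFinN oppeK add0e.
- by move=> y _; exact: expR_ge0.
- exact: continuous_subspaceT.
- by rewrite -oppr0; apply: cvgN; exact: cvgr_expR.
- by move=> y _; apply: ex_derive.
- by apply: cvgN; apply: cvg_at_right_filter; exact: cexp.
- move=> y _; rewrite derive1E; apply: derive_val.
  by apply: is_derive_eq; rewrite mulrN1 opprK.
Qed.

Context d (T : measurableType d) (P : probability T R).

(** Fubini: for fixed [t] the condition reads [y > - ln (M t)], and [exp (- y)] integrates to [M t]
    there. *)
Lemma integral_expRN_tail (M : T -> R) : measurable_fun setT M -> (forall t, 0 < M t) ->
  (\int[lebesgue_measure]_y (P [set t | (expR (- y) < M t)%R] * (expR (- y))%:E) =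
   \int[P]_t (M t)%:E)%E.
Proof.
move=> mM M0.
have mexp : measurable_fun setT (fun y : R => expR (- y)).
  by apply: measurableT_comp => //; exact: measurableT_comp.
pose F (q : R * T) : \bar R := (\1_[set q : R * T | expR (- q.1) < M q.2] q * expR (- q.1))%:E.
have mF : measurable_fun setT F.
  apply/measurable_EFinP; apply: measurable_funM; last exact: (measurableT_comp mexp).
  apply: measurable_indic.
  rewrite (_ : [set _ | _] = [set q : R * T | 0 < M q.2 - expR (- q.1)]).
    apply: measurable_gtr; apply: measurable_funB; first exact: measurableT_comp.
    exact: (measurableT_comp mexp).
  by apply/seteqP; split => q /=; rewrite subr_gt0.
have F0 q : (0 <= F q)%E by rewrite lee_fin mulr_ge0// expR_ge0.
transitivity (\int[lebesgue_measure]_y \int[P]_t F (y, t))%E.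
  apply: eq_integral => y _.
  have mE : measurable [set t | expR (- y) < M t] by exact: measurable_gtr.
  transitivity (\int[P]_t ((\1_[set t | (expR (- y) < M t)%R] t)%:E * (expR (- y))%:E))%E; last first.
    by apply: eq_integral => t _; rewrite -EFinM /F !indicE.
  have mI : measurable_fun setT (fun t => (\1_[set t | (expR (- y) < M t)%R] t : R)%:E).
    by apply/measurable_EFinP; exact: measurable_indic.
  by rewrite ge0_integralZr ?lee_fin ?expR_ge0// integral_indic// setIT.
rewrite (@fubini_tonelli _ _ _ _ _ lebesgue_measure P F)//.
apply: eq_integral => t _.
transitivity (\int[lebesgue_measure]_(y in `](- ln (M t))%R, +oo[) (expR (- y))%:E)%E; last first.
  by rewrite integral_expRN_above opprK lnK// posrE.
rewrite [RHS]integral_mkcond; apply: eq_integral => y _.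
rewrite patchE /F indicE; case: ifPn => yM.
  rewrite (_ : (_ \in _) = true) ?mul1r//; apply: mem_set => /=.
  move: yM; rewrite inE/= in_itv/= andbT ltrNl => yM.
  by rewrite -[ltRHS](lnK (_ : M t \is Num.pos)) ?posrE// ltr_expR.
rewrite (_ : (_ \in _) = false) ?mul0r//; apply/negbTE; move: yM.
rewrite !notin_setE/= in_itv/= andbT ltrNl => + yM; apply.
by rewrite -ltr_expR lnK// posrE.
Qed.

End exponential_density.

Definition image_measure d d' (T1 : measurableType d) (T2 : measurableType d') (R : realType)
    (m : {measure set T1 -> \bar R}) (f : T1 -> T2) (mf : measurable_fun setT f) :
    {measure set T2 -> \bar R} :=
  measure_function_pushforward__canonical__measure_function_Measure m mf.

Lemma measurable_exceedance (R : realType) (k : nat) (x : k.-tuple R) :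
  measurable [set t : k.-tuple R | exists j, tnth x j < tnth t j].
Proof.
rewrite (_ : [set _ | _] = \bigcup_j [set t : k.-tuple R | tnth x j < tnth t j]).
  by apply: fin_bigcup_measurable => // j _; apply: measurable_gtr; exact: measurable_tnth.
by apply/seteqP; split => t /=; [move=> [j]; exists j|move=> [j _]; exists j].
Qed.

Section limit_measure.
Context d (T : measurableType d) (R : realType) (P : probability T R) (k : nat).
Context (Gamma : 'M[R]_k) (Z : {RV P >-> k.-tuple R}).
Hypothesis gaussZ : Gauss P Gamma Z.

Let theta i : R := fine ('V_P[(fun t => tnth (Z t) i)%R])%E.

Let point_of (q : R * T) : k.-tuple R :=
  [tuple tnth (Z q.2) i - theta i / 2 - ln q.1 | i < k].

Let mpoint_of : measurable_fun setT point_of.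
Proof.
apply/measurable_fun_tnthP => i; rewrite (_ : _ \o _ =
    (fun q : R * T => tnth (Z q.2) i - theta i / 2 - ln q.1)); last first.
  by apply/funext => q /=; rewrite tnth_mktuple.
apply: measurable_funB; last by apply: measurableT_comp => //; exact: measurable_ln.
apply: measurable_funB => //.
exact: (measurableT_comp (@measurable_RV_tnth _ _ _ P k Z i)).
Qed.

Let D : set (R * T) := [set q | 0 < q.1].

Let mD : measurable D. Proof. exact: measurable_gtr. Qed.

Let base : {measure set (measurableTypeR R * T) -> \bar R} := mrestr (lebesgue_measure \x P)%E mD.

(* The Poisson intensity of the limiting exceedances: the image of Lebesgue measure on
   ]0, +oo[ times the law of [Z] under [(r, z) |-> z - theta / 2 - ln r]; note that
   [y = - ln r] has intensity [exp (- y) dy]. *)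
Definition limit_intensity : {measure set (k.-tuple R) -> \bar R} :=
  image_measure base mpoint_of.

(** The coordinate [r = exp (- y)] makes the intensity Lebesgue measure, so that half-spaces and
    unions of exceedances become subgraphs [r < g t]; their mass is the expectation of [g] by the
    layer-cake formula. *)
Let limit_intensityE (B : set (k.-tuple R)) (g : T -> R) : measurable B ->
  measurable_fun setT g -> (forall t, 0 <= g t) ->
  (forall r t, 0 < r -> B (point_of (r, t)) <-> r < g t) ->
  limit_intensity B = (\int[P]_t (g t)%:E)%E.
Proof.
move=> mB mg g0 Bg; rewrite layer_cake1// [RHS]integral_mkcond.
rewrite /limit_intensity /pushforward /base /mrestr /product_measure1.
apply: eq_integral => r _; rewrite patchE /xsection /=; case: ifPn => r0.
  move: r0; rewrite inE/= in_itv/= andbT => r0; congr (P _); apply/seteqP; split => t /=.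
    by rewrite inE => -[/= /(Bg _ _ r0)].
  by move=> rg; rewrite inE; split => //=; exact/(Bg _ _ r0).
rewrite (_ : [set _ | _] = set0) ?measure0//; apply/seteqP; split => t //=.
rewrite inE => -[_ /=]; move: r0; rewrite notin_setE/= in_itv/= andbT.
by move=> r0 /r0.
Qed.

Lemma limit_intensity_half (s : 'I_k -> R) z : \sum_i s i = 1 ->
  limit_intensity [set t | z < \sum_i s i * tnth t i] =
  (expR (- z - (\sum_i \sum_j s i * s j * Gamma i j) / 4))%:E.
Proof.
move=> s1; rewrite -(gaussian_exp_moment gaussZ z s1).
apply: (@limit_intensityE _ (fun x => expR (\sum_i s i * (tnth (Z x) i - theta i / 2) - z))).
- apply: measurable_gtr; apply: measurable_sum => i; apply: measurable_funM => //.
  exact: measurable_tnth.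
- apply: measurableT_comp => //; apply: measurable_funB => //.
  apply: measurable_sum => i; apply: measurable_funM => //; apply: measurable_funB => //.
  exact: measurable_RV_tnth.
- by move=> t; exact: expR_ge0.
move=> r t r0; rewrite -[X in X < expR _](lnK (_ : r \is Num.pos)) ?posrE// ltr_expR /=.
under eq_bigr do rewrite tnth_mktuple/= mulrBr.
by rewrite sumrB -mulr_suml s1 mul1r ltrBrDl -ltrBrDr; split; lra.
Qed.

(** Its expectation is the integral in the exponent of [Q_Gamma] as well as the limiting mass of
    exceedances of [x]. All terms being positive, the default 0 of the maximum does not interfere
    when [0 < k]. *)
Let M (x : k.-tuple R) t := \big[Num.max/0]_i expR (tnth (Z t) i - theta i / 2 - tnth x i).

Let mM x : measurable_fun setT (M x).
Proof.
rewrite /M; elim: (index_enum _) => [|i r ih].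
  by under eq_fun do rewrite big_nil; exact: measurable_cst.
under eq_fun do rewrite big_cons.
apply: measurable_maxr => //; apply: measurableT_comp => //.
by apply: measurable_funB => //; apply: measurable_funB => //; exact: measurable_RV_tnth.
Qed.

Let M0 x t : (0 < k)%N -> 0 < M x t.
Proof.
move=> k0; apply/bigmax_gtP; right; exists (Ordinal k0) => //; exact: expR_gt0.
Qed.

Let ltM r x t : 0 < r -> r < M x t <-> exists i, r < expR (tnth (Z t) i - theta i / 2 - tnth x i).
Proof.
move=> r0; split.
  by move=> /bigmax_gtP[|[i _ ri]]; [rewrite ltNge ltW|exists i].
by move=> [i ri]; apply/bigmax_gtP; right; exists i.
Qed.

Lemma Q_Gamma_limit_intensity (x : k.-tuple R) : (0 < k)%N ->
  Q_Gamma P Z x = expeR (- limit_intensity [set t | exists j, (tnth x j < tnth t j)%R])%E.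
Proof.
move=> k0; rewrite /Q_Gamma; congr (expeR (- _)).
transitivity (\int[P]_t (M x t)%:E)%E.
  rewrite -(integral_expRN_tail P (@mM x))//; last by move=> t; exact: M0.
  apply: eq_integral => y _; congr (P _ * _)%E; apply/seteqP; split => t /=.
    move=> [i Zi]; apply/ltM; first exact: expR_gt0.
    by exists i; rewrite ltr_expR; move: Zi; rewrite -/(theta i); lra.
  move=> /ltM[]; first exact: expR_gt0.
  by move=> i; rewrite ltr_expR => Zi; exists i; rewrite -/(theta i); lra.
apply/esym/limit_intensityE.
- exact: measurable_exceedance.
- exact: mM.
- by move=> t; exact/ltW/M0.
move=> r t r0; rewrite ltM//; split.
  move=> [i]; rewrite tnth_mktuple/= => h; exists i.
  by rewrite -[X in X < expR _](lnK (_ : r \is Num.pos)) ?posrE// ltr_expR; lra.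
move=> [i]; rewrite -[X in X < expR _](lnK (_ : r \is Num.pos)) ?posrE// ltr_expR => h.
by exists i; rewrite tnth_mktuple/=; lra.
Qed.

End limit_measure.

(** * Maxima of elliptical vectors *)

Lemma cvg_sumr (R : realType) (I : Type) (r : seq I) (f : I -> nat -> R) (l : I -> R) :
  (forall i, f i n @[n --> \oo] --> l i) ->
  \sum_(i <- r) f i n @[n --> \oo] --> \sum_(i <- r) l i.
Proof.
move=> fl; elim: r => [|i r ih].
  by rewrite big_nil; under eq_fun do rewrite big_nil; exact: cvg_cst.
by rewrite big_cons; under eq_fun do rewrite big_cons; exact: cvgD.
Qed.

Section elliptical_law.
Context d (T : measurableType d) (R : realType) (P : probability T R) (k : nat).
Context (X : {RV P >-> R}) (U : {RV P >-> k.-tuple R}) (i0 : 'I_k) (w : R -> R).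
Hypothesis X0 : P [set t | 0 < X t] = 1%E.
Hypothesis unifU : uniform_on_sphere P U.
Hypothesis XU : independent_pair P X U.

Let S s := fine (P [set t | s < X t * tnth (U t) i0]).

Let mcoord : measurable_fun setT (fun t => tnth (U t) i0).
Proof. exact: measurable_RV_tnth. Qed.

Let V : {RV P >-> R} := mfun_Sub (mem_set mcoord).

Let mradial : measurable_fun setT (fun t => X t * tnth (U t) i0).
Proof. by apply: measurable_funM => //; exact: measurable_funPT. Qed.

Let Y : {RV P >-> R} := mfun_Sub (mem_set mradial).

Lemma gen_inverse_radial p :
  gen_inverse (distr_fun P (fun t => X t * tnth (U t) i0)) (1 - p) =
  inf [set t | S t <= p].
Proof. exact: (gen_inverse_tail Y). Qed.

Lemma gumbel_tail_elliptical :
  GMDA w (distr_fun P (fun t => X t * tnth (U t) i0)) \/ GMDA w (distr_fun P X) ->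
  exists omega, gumbel_tail omega (fun t => (w t)^-1) S.
Proof.
case=> H; first by eexists; exact: (gumbel_tail_GMDA (Y := Y) H).
eexists; have [C C1 HC] := cap_doubling i0 unifU.
have XV : independent_pair P X V.
  move=> B1 B2 mB1 mB2; have := XU (B := B1) (C := (fun u : k.-tuple R => tnth u i0) @^-1` B2).
  apply=> //; rewrite -[_ @^-1` _]setTI; exact: (measurable_tnth i0).
apply: (gumbel_tail_product XV X0 _ C1 _ HC (gumbel_tail_GMDA H)).
  exact: sphere_coord_le1.
by move=> e; exact: cap_gt0.
Qed.

Variables (omega : \bar R) (u : R -> R) (A : nat -> 'M[R]_k) (Gamma : 'M[R]_k).
Hypothesis gS : gumbel_tail omega u S.
Let b (n : nat) := inf [set t | S t <= n%:R^-1].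
Let a n := u (b n).
Hypothesis corA : forall n, (0 < n)%N -> posdef_correlation (A n *m (A n)^T).
Hypothesis cvgA :
  (2 * (b n / a n)) *: ((const_mx 1 : 'cV[R]_k) *m (const_mx 1 : 'cV[R]_k)^T - A n *m (A n)^T)
    @[n --> \oo] --> Gamma.

Definition normalized (n : nat) (t : T) : k.-tuple R :=
  [tuple (tnth (scale_tuple (X t) (mulmx_tuple (A n) (U t))) j - b n) / a n | j < k].

Let normalizedE n t j : tnth (normalized n t) j =
  (X t * (\sum_i A n j i * tnth (U t) i) - b n) / a n.
Proof.
rewrite !tnth_mktuple mxE; congr ((_ * _ - _) / _).
by apply: eq_bigr => i _; rewrite mxE.
Qed.

Lemma measurable_normalized n : measurable_fun setT (normalized n).
Proof.
apply/measurable_fun_tnthP => j.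
rewrite (_ : _ \o _ = fun t => (X t * (\sum_i A n j i * tnth (U t) i) - b n) / a n); last first.
  by apply/funext => t; exact: normalizedE.
apply: measurable_funM => //; apply: measurable_funB => //; apply: measurable_funM.
  exact: measurable_funPT.
exact: measurable_lincomb.
Qed.

(** The expected number of points of a set among [n] independent normalised vectors. *)
Let nu_ n : {measure set (k.-tuple R) -> \bar R} :=
  mscale (n%:R%:nng) (image_measure P (measurable_normalized n)).

Let nu_E n E : nu_ n E = (n%:R%:E * P (normalized n @^-1` E))%E.
Proof. by []. Qed.

Section half_spaces.
Variable s : 'I_k -> R.
Hypothesis s1 : \sum_i s i = 1.

(** [v n] is [A_n^T s], so that [<s, A_n U> = <v n, U>], and [rho n] is its norm. [kappa n] is
    [c_n (1 - rho_n^2)], expanded through [sum_ij s_i s_j = 1] so that the entrywise limit of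
    [c_n (1 1^T - Sigma_n)] applies. *)
Let v n j := \sum_i s i * A n i j.
Let rho n := Num.sqrt (\sum_j v n j ^+ 2).
Let kappa n := \sum_i \sum_j s i * s j * (2 * (b n / a n) * (1 - (A n *m (A n)^T) i j)).

Let sqr_norm n : \sum_j v n j ^+ 2 = \sum_i \sum_j s i * s j * (A n *m (A n)^T) i j.
Proof.
transitivity (\sum_l \sum_i \sum_j s i * s j * (A n i l * A n j l)).
  apply: eq_bigr => l _; rewrite expr2 /v mulr_suml; apply: eq_bigr => i _.
  by rewrite mulr_sumr; apply: eq_bigr => j _; ring.
rewrite exchange_big; apply: eq_bigr => i _; rewrite exchange_big; apply: eq_bigr => j _.
by rewrite mxE mulr_sumr; apply: eq_bigr => l _; rewrite mxE.
Qed.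

Let sqr_norm_gt0 n : (0 < n)%N -> 0 < \sum_j v n j ^+ 2.
Proof.
move=> n0; have [[_ pd] _] := corA n0.
pose c : 'cV[R]_k := \col_i s i.
have c0 : c != 0.
  apply/eqP => /matrixP c0; have := s1; rewrite big1 => [/eqP|i _]; first by rewrite eq_sym oner_eq0.
  by have := c0 i 0; rewrite !mxE.
have := pd c c0; rewrite sqr_norm mxE; congr (0 < _).
rewrite exchange_big; apply: eq_bigr => j _; rewrite !mxE mulr_suml.
by apply: eq_bigr => i _; rewrite !mxE; ring.
Qed.

Let rho_gt0 : \forall n \near \oo, 0 < rho n.
Proof. by exists 1%N => // n n0; rewrite sqrtr_gt0 sqr_norm_gt0. Qed.

Let near_ab : \forall n \near \oo, 0 < b n /\ 0 < a n.
Proof.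
apply: filterS (quantile_aux_small gS) => n [bo b0]; split=> //.
by case: gS => _ + _ _ _; apply.
Qed.

Let rhoE : \forall n \near \oo, rho n ^+ 2 = 1 - kappa n / (2 * (b n / a n)).
Proof.
near=> n; have [b0 a0] : 0 < b n /\ 0 < a n by near: n; exact: near_ab.
rewrite sqr_sqrtr; last by apply: sumr_ge0 => j _; exact: sqr_ge0.
rewrite sqr_norm.
have -> : kappa n / (2 * (b n / a n)) = \sum_i \sum_j s i * s j * (1 - (A n *m (A n)^T) i j).
  rewrite /kappa mulr_suml; apply: eq_bigr => i _; rewrite mulr_suml; apply: eq_bigr => j _.
  by field; rewrite !gt_eqF.
have one : \sum_i \sum_j s i * s j = 1.
  by under eq_bigr do rewrite -mulr_sumr s1 mulr1.
rewrite -[X in _ = X - _]one.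
rewrite -sumrB; apply: eq_bigr => i _; rewrite -sumrB; apply: eq_bigr => j _; ring.
Unshelve. all: by end_near. Qed.

Let cvg_kappa : kappa n @[n --> \oo] --> \sum_i \sum_j s i * s j * Gamma i j.
Proof.
apply: cvg_sumr => i; apply: cvg_sumr => j; apply: cvgM; first exact: cvg_cst.
have := cvg_comp _ _ cvgA (@coord_continuous R k k i j Gamma).
apply: cvg_trans; apply: near_eq_cvg; apply: nearW => n /=.
by rewrite !mxE big_ord1 !mxE mul1r.
Qed.

(** As [sum_i s_i = 1], centring and scaling act on the form as on one coordinate: the half-space
    becomes [X <v n, U> > b n + z a n], and rotation replaces [<v n, U>] by [rho n] times one
    coordinate. *)
Let half_tail : \forall n \near \oo, forall z,
  nu_ n [set t | z < \sum_i s i * tnth t i] = (n%:R * S ((b n + z * a n) / rho n))%:E.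
Proof.
near=> n => z; have [b0 a0] : 0 < b n /\ 0 < a n by near: n; exact: near_ab.
have r0 : 0 < rho n by near: n; exact: rho_gt0.
rewrite nu_E EFinM; congr (_ * _)%E.
have rv : \sum_j v n j ^+ 2 = rho n ^+ 2.
  by rewrite sqr_sqrtr//; apply: sumr_ge0 => j _; exact: sqr_ge0.
have -> : normalized n @^-1` [set t | z < \sum_i s i * tnth t i] =
    [set t | b n + z * a n < X t * \sum_j v n j * tnth (U t) j].
  have E t : \sum_i s i * tnth (normalized n t) i =
      (X t * (\sum_j v n j * tnth (U t) j) - b n) / a n.
    under eq_bigr do rewrite normalizedE mulrA mulrBr.
    rewrite -mulr_suml sumrB -mulr_suml s1 mul1r; congr ((_ - _) / _).
    under eq_bigr do rewrite mulrCA mulr_sumr.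
    rewrite -mulr_sumr exchange_big; congr (_ * _); apply: eq_bigr => j _.
    by rewrite /v mulr_suml; apply: eq_bigr => i _; rewrite mulrA.
  by apply/seteqP; split => t /=; rewrite E ltr_pdivlMr// ltrBrDl.
rewrite (sphere_scale_tail i0 unifU _ XU r0 rv) /S fineK ?fin_num_measure//.
  by congr (P _); apply/seteqP; split => t /=; rewrite ltr_pdivrMr// mulrAC mulrA.
exact: measurable_gtr.
Unshelve. all: by end_near. Qed.

Lemma cvg_normalized_half z : nu_ n [set t | z < \sum_i s i * tnth t i] @[n --> \oo] -->
  (expR (- z - (\sum_i \sum_j s i * s j * Gamma i j) / 4))%:E.
Proof.
have h := @cvg_rescaled_tail _ _ _ _ gS _ _ _ cvg_kappa rho_gt0 rhoE z.
apply/fine_cvgP; split; first by apply: filterS half_tail => n ->.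
apply: cvg_trans h; apply: near_eq_cvg; near=> n => /=.
rewrite (_ : nu_ n _ = (n%:R * S ((b n + z * a n) / rho n))%:E)//.
by move: z; near: n; exact: half_tail.
Unshelve. all: by end_near. Qed.

Lemma normalized_half_tail c p : exists2 C : R, 0 <= C &
  \forall n \near \oo, forall z, 1 <= z ->
    (nu_ n [set t | (z + c < \sum_i s i * tnth t i)%R] <= (C * z ^- p)%:E)%E.
Proof.
have [C C0 HC] := rescaled_tail_poly gS cvg_kappa rho_gt0 rhoE c p.
exists C => //; near=> n => z z1.
have -> : nu_ n [set t | z + c < \sum_i s i * tnth t i] =
    (n%:R * S ((b n + (z + c) * a n) / rho n))%:E.
  by move: (z + c); near: n; exact: half_tail.
by rewrite lee_fin; move: z z1; near: n.
Unshelve. all: by end_near. Qed.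

End half_spaces.

Lemma cvg_normalized_exceedance d1 (T1 : measurableType d1) (P1 : probability T1 R)
    (Z : {RV P1 >-> k.-tuple R}) (x : k.-tuple R) : Gauss P1 Gamma Z ->
  let E := [set t : k.-tuple R | exists j, tnth x j < tnth t j] in
  limit_intensity Z E \is a fin_num /\
  n%:R * fine (P (normalized n @^-1` E)) @[n --> \oo] --> fine (limit_intensity Z E).
Proof.
move=> gaussZ E.
have [mE _ iE cE] : cvg_int nu_ (limit_intensity Z) (\1_E).
  apply: (@cvg_int_exceedance_of_half_spaces _ _ _ _ _ _ (fun j t => tnth t j)
    (fun s => (\sum_i \sum_j s i * s j * Gamma i j) / 4)) => [i|s z s1|s z s1|s c p s1].
  - exact: measurable_tnth.
  - exact: limit_intensity_half.
  - exact: cvg_normalized_half.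
  - exact: normalized_half_tail.
have measE : measurable E by exact: measurable_exceedance.
have RE (m : {measure set (k.-tuple R) -> \bar R}) : \int[m]_t \1_E t = fine (m E).
  by rewrite /Rintegral integral_indic// setIT.
split.
  rewrite ge0_fin_numE//; case/integrableP: iE => _.
  rewrite (eq_integral (fun t => (\1_E t)%:E)) ?integral_indic ?setIT//.
  by move=> t _ /=; rewrite ger0_norm.
move: cE; rewrite RE; apply: cvg_trans; apply: near_eq_cvg; apply: nearW => n.
rewrite RE nu_E fineM// fin_num_measure//.
by rewrite -[_ @^-1` _]setTI; exact: measurable_normalized.
Qed.

End elliptical_law.

(** The [n]-th powers of [exp (- y / (1 - y)) <= 1 - y <= exp (- y)] at [y = l n / n]; both outer
    sequences converge to the limit. *)
Lemma cvg_exprB_expR (R : realType) (l : nat -> R) (lim : R) :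
  l n @[n --> \oo] --> lim -> (1 - l n / n%:R) ^+ n @[n --> \oo] --> expR (- lim).
Proof.
move=> cl.
have y0 : l n / n%:R @[n --> \oo] --> (0 : R).
  rewrite -(mulr0 lim); apply: cvgM => //; apply/gtr0_cvgV0; last exact: cvgr_idn.
  by exists 1%N => // n n0; rewrite /= ltr0n.
have lower : expR (- (l n / (1 - l n / n%:R))) @[n --> \oo] --> expR (- lim).
  apply: continuous_cvg; first exact: continuous_expR.
  apply: cvgN; rewrite -[X in _ --> X]divr1; apply: cvgM => //; apply: cvgV => //.
  by rewrite -[X in _ --> X]subr0; apply: cvgB => //; exact: cvg_cst.
have upper : expR (- l n) @[n --> \oo] --> expR (- lim).
  by apply: continuous_cvg; [exact: continuous_expR|exact: cvgN].
apply: squeeze_cvgr lower upper; near=> n.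
have n0 : 0 < n%:R :> R by rewrite ltr0n; near: n; exists 1%N.
have y1 : 0 < 1 - l n / n%:R.
  by rewrite subr_gt0; near: n; apply: (cvgr_lt 0).
have lE : l n = l n / n%:R * n%:R by rewrite divfK// gt_eqF.
move: (l n / n%:R) y1 lE => y y1 ->; apply/andP; split.
  rewrite mulrAC -mulNr expRM_natr lerXn2r ?nnegrE ?expR_ge0 ?(ltW y1)//.
  rewrite expRN -[leRHS]invrK lef_pV2 ?posrE ?expR_gt0 ?invr_gt0//.
  apply: le_trans (expR_ge1Dx _).
  by rewrite [leLHS](_ : _ = 1 + y / (1 - y))//; field; rewrite gt_eqF.
rewrite -mulNr expRM_natr lerXn2r ?nnegrE ?expR_ge0 ?(ltW y1)//.
exact: expR_ge1Dx.
Unshelve. all: by end_near. Qed.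

(** For [0 < n] the extended maximum is finite, so [fine] returns it and not its default value. *)
Lemma max_coord_le (T : Type) (R : realType) (k n : nat) (X : 'I_n -> T -> k.-tuple R)
    (j : 'I_k) (t : T) (y : R) : (0 < n)%N ->
  max_coord X j t <= y <-> forall i, tnth (X i t) j <= y.
Proof.
move=> n0; rewrite /max_coord.
set m := \big[maxe/-oo%E]_(i < n) _.
have mfin : m \is a fin_num.
  rewrite fin_numE; apply/andP; split.
    rewrite -ltNye; apply: (@lt_le_trans _ _ (tnth (X (Ordinal n0) t) j)%:E); first exact: ltNyr.
    exact: (le_bigmax _ (fun i => (tnth (X i t) j)%:E)).
  by rewrite -ltey; apply/bigmax_ltP; split=> // i _; exact: ltry.
rewrite -lee_fin fineK//; split=> [/bigmax_leP[_ h] i|h].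
  by rewrite -lee_fin; exact: h.
by apply/bigmax_leP; split=> [|i _]; rewrite ?leNye ?lee_fin.
Qed.

Lemma prob_max_coord_le d (Omega : measurableType d) (R : realType) (P : probability Omega R)
    (k : nat) d0 (Omega0 : measurableType d0) (P0 : probability Omega0 R)
    (X : forall n : nat, 'I_n -> {RV P >-> k.-tuple R}) (n : nat) (Y : Omega0 -> k.-tuple R)
    (b a : R) (x : k.-tuple R) :
  independent_family P (fun p : {n : nat & 'I_n} => X (tag p) (tagged p)) ->
  (forall i, eq_in_law P P0 (X n i) Y) -> (0 < n)%N -> 0 < a ->
  P [set t | forall j : 'I_k, (max_coord (fun i => X n i) j t - b) / a <= tnth x j] =
  (fine (P0 (Y @^-1` [set u | forall j, (tnth u j - b) / a <= tnth x j])) ^+ n)%:E.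
Proof.
move=> indX lawX n0 a0; set B := [set u : k.-tuple R | _].
have mB : measurable B.
  rewrite (_ : B = \bigcap_(j in setT) [set u : k.-tuple R | (tnth u j - b) / a <= tnth x j]).
    apply: fin_bigcap_measurable => // j _; apply: measurable_ler.
    by apply: measurable_funM => //; apply: measurable_funB => //; exact: measurable_tnth.
  by apply/seteqP; split => u /= h j; [move=> _|]; exact: h.
(* Row [n] of the triangular array, listed in the dependent index type over which independence is
   stated. *)
pose J := [seq existT (fun n => 'I_n) n i | i <- enum 'I_n].
have uJ : uniq J.
  rewrite map_inj_uniq ?enum_uniq// => i j /eqP; rewrite eq_Tagged => /eqP.
  exact.
have -> : [set t | forall j : 'I_k, (max_coord (fun i => X n i) j t - b) / a <= tnth x j] =
    \bigcap_(p in [set` J]) (X (tag p) (tagged p) @^-1` B).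
  apply/seteqP; split => t /= h.
    move=> p /mapP[i _ ->] j /=; have := h j.
    by rewrite !ler_pdivrMr// !lerBlDr => /(max_coord_le _ _ _ _ n0); apply.
  move=> j; rewrite ler_pdivrMr// lerBlDr; apply/(max_coord_le _ _ _ _ n0) => i.
  have /(_ j) : B (X n i t) by apply: (h (existT _ n i)); apply/mapP; exists i; rewrite ?mem_enum.
  by rewrite ler_pdivrMr// lerBlDr.
rewrite indX// big_map big_enum/=.
rewrite (eq_bigr (fun=> (fine (P0 (Y @^-1` B)))%:E)).
  by rewrite prodEFin prodr_const card_ord.
move=> i _; rewrite fineK; first exact: lawX.
by rewrite -(lawX i B mB) fin_num_measure// -[_ @^-1` _]setTI; exact: measurable_funPT.
Qed.

Theorem theorem4p1 (R : realType) (k : nat) (k_ge2 : (2 <= k)%N)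
    (d : measure_display) (Omega : measurableType d) (P : probability Omega R)
    (X : forall n : nat, 'I_n -> {RV P >-> k.-tuple R})
    (d0 : measure_display) (Omega0 : measurableType d0)
    (P0 : probability Omega0 R)
    (Rk : {RV P0 >-> R}) (U : {RV P0 >-> k.-tuple R})
    (A : nat -> 'M[R]_k) (w : R -> R) (Gamma : 'M[R]_k) :
  let Sigma n := A n *m (A n)^T in
  let Hk := distr_fun P0 Rk in
  let G := distr_fun P0 (fun t => Rk t * tnth (U t) (Ordinal (ltnW k_ge2))) in
  let b n := gen_inverse G (1 - n%:R^-1) in
  let a n := (w (b n))^-1 in
  let c n := 2 * (b n / a n) in
  let M n := max_coord (fun i => X n i) in
  independent_family P (fun p : {n : nat & 'I_n} => X (tag p) (tagged p)) ->
  P0 [set t | 0 < Rk t] = 1%E ->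
  uniform_on_sphere P0 U ->
  independent_pair P0 Rk U ->
  (forall n (i : 'I_n), eq_in_law P P0 (X n i)
     (fun t => scale_tuple (Rk t) (mulmx_tuple (A n) (U t)))) ->
  (forall n, (0 < n)%N -> posdef_correlation (Sigma n)) ->
  GMDA w G \/ GMDA w Hk ->
  (forall i j, i != j -> 0 < Gamma i j) ->
  c n *: ((const_mx 1 : 'cV[R]_k) *m (const_mx 1 : 'cV[R]_k)^T - Sigma n)
    @[n --> \oo] --> Gamma ->
  forall (x : k.-tuple R)
    (d1 : measure_display) (Omega1 : measurableType d1)
    (P1 : probability Omega1 R) (Z : {RV P1 >-> k.-tuple R}),
  Gauss P1 Gamma Z ->
  P [set t | forall j : 'I_k, (M n j t - b n) / a n <= tnth x j]
    @[n --> \oo] --> Q_Gamma P1 Z x.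
Proof.
move=> Sigma Hk G b a c M indX R0 unifU RU lawX corA gm _ cG x d1 Omega1 P1 Z gaussZ.
pose i0 := Ordinal (ltnW k_ge2).
have [omega gS] := gumbel_tail_elliptical (i0 := i0) R0 unifU RU gm.
(* The quantile of [G] at [1 - 1 / n] is the level where the tail falls to [1 / n]; this identifies
   the constants of the statement with those of the tail estimates. *)
have bE n : b n = inf [set t | fine (P0 [set s | t < Rk s * tnth (U s) i0]) <= n%:R^-1].
  exact: gen_inverse_radial.
have near_ab : \forall n \near \oo, (0 < n)%N /\ 0 < a n.
  near=> n; split; first by near: n; exists 1%N.
  case: (gS) => _ u0 _ _ _; rewrite /a bE; apply: u0.
  by near: n; apply: filterS (quantile_aux_small gS) => n [].
have cG' : (2 * (inf [set t | fine (P0 [set s | t < Rk s * tnth (U s) i0]) <= n%:R^-1] /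
      (w (inf [set t | fine (P0 [set s | t < Rk s * tnth (U s) i0]) <= n%:R^-1]))^-1)) *:
    ((const_mx 1 : 'cV[R]_k) *m (const_mx 1 : 'cV[R]_k)^T - A n *m (A n)^T)
    @[n --> \oo] --> Gamma.
  by apply: cvg_trans cG; apply: near_eq_cvg; apply: nearW => n; rewrite /c /a bE.
have := cvg_normalized_exceedance unifU RU gS corA cG' x gaussZ.
set E := [set t | _] => -[Lfin cv].
rewrite Q_Gamma_limit_intensity; last exact: ltnW.
rewrite -/E (_ : expeR _ = (expR (- fine (limit_intensity Z E)))%:E); last by rewrite -(fineK Lfin).
pose Y n t := scale_tuple (Rk t) (mulmx_tuple (A n) (U t)).
pose B n := [set u : k.-tuple R | forall j, (tnth u j - b n) / a n <= tnth x j].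
pose p n := fine (P0 (normalized Rk U i0 (fun t => (w t)^-1) A n @^-1` E)).
have pE n : fine (P0 (Y n @^-1` B n)) = 1 - p n.
  have mN : measurable (normalized Rk U i0 (fun t => (w t)^-1) A n @^-1` E).
    by rewrite -[_ @^-1` _]setTI; apply: measurable_normalized => //; exact: measurable_exceedance.
  rewrite (_ : Y n @^-1` B n = ~` (normalized Rk U i0 (fun t => (w t)^-1) A n @^-1` E)).
    by rewrite probability_setC// fineB// fin_num_measure.
  have NE t j : tnth (normalized Rk U i0 (fun t => (w t)^-1) A n t) j = (tnth (Y n t) j - b n) / a n.
    by rewrite tnth_mktuple /a bE.
  apply/seteqP; split => t /=.
    by move=> Bt [j]; rewrite NE ltNge => /negP; apply; exact: Bt.
  by move=> Et j; rewrite leNgt -NE; apply/negP => h; apply: Et; exists j.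
(* [p n] is written as [n p_n / n] to exhibit the converging intensity [l n = n p_n]. *)
have probE : \forall n \near \oo,
    P [set t | forall j, (M n j t - b n) / a n <= tnth x j] = ((1 - n%:R * p n / n%:R) ^+ n)%:E.
  apply: filterS near_ab => n [n0 a0].
  rewrite (prob_max_coord_le (b n) x indX (lawX n) n0 a0) -/(B n) pE.
  by rewrite mulrAC divff ?mul1r// pnatr_eq0 -lt0n.
apply/fine_cvgP; split; first by apply: filterS probE => n ->.
have := cvg_exprB_expR cv; apply: cvg_trans; apply: near_eq_cvg.
by apply: filterS probE => n /= ->.
Unshelve. all: by end_near. Qed.
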